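(* Let $\tilde G=\mathbb{R}$ with the Euclidean norm, $G=\mathbb{S}^1=\mathbb{R}/\mathbb{Z}$ with the quotient norm, and let $\phi:\mathbb{R}\to\mathbb{R}/\mathbb{Z}$ be the quotient projection. Let $K\subset\mathbb{R}^d$ be a convex, compact set with nonempty interior and let $\pi:\mathscr{F}_1^{\mathbb{R}}(K)\to\mathscr{F}_1^{\mathbb{S}^1}(K)$ be the map induced by $\phi$. Then the restriction of $\pi$ is surjective between $\{\tilde T\in\mathscr{F}_1^{\mathbb{R}}(K):\mathbb{M}(\tilde T)<\infty\}$ and $\{T\in\mathscr{F}_1^{\mathbb{S}^1}(K):\mathbb{M}(T)<\infty\}$.
   Context: Quotient norm on $\mathbb{R}/\mathbb{Z}$: $\|\phi(x)\|:=\min\{\mathrm{frac}(x),1-\mathrm{frac}(x)\}$ with $\mathrm{frac}(x)=x-\lfloor x\rfloor$. For a complete normed Abelian group $G$: $\mathscr{P}_k^G(K)$ is the group of polyhedral chains, i.e. finite formal sums $P=\sum_{\ell=1}^N g_\ell\llbracket\sigma_\ell\rrbracket$, with $g_\ell\in G$ and $\sigma_\ell\subset K$ non-overlapping oriented $k$-simplexes, identified when they have a common refinement (reversing orientation changes $g_\ell$ to $-g_\ell$). Mass: $\mathbb{M}(P)=\sum_\ell\|g_\ell\|\mathcal{H}^k(\sigma_\ell)$. Boundary: $\partial P=\sum_\ell g_\ell\,\partial\llbracket\sigma_\ell\rrbracket$. Flat norm: $\mathbb{F}(P)=\inf\{\mathbb{M}(Q)+\mathbb{M}(P-\partial Q):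 Q\in\mathscr{P}_{k+1}^G(K)\}$. $\mathscr{F}_k^G(K)$ (flat chains) is the $\mathbb{F}$-completion of $\mathscr{P}_k^G(K)$; mass extends by relaxation, $\mathbb{M}(T)=\inf\{\liminf_n\mathbb{M}(P_n): P_n\in\mathscr{P}_k^G(K),\ \mathbb{F}(P_n-T)\to0\}$. Induced map: on polyhedral chains $\pi(\sum_i\tilde g_i\llbracket\sigma_i\rrbracket):=\sum_i\phi(\tilde g_i)\llbracket\sigma_i\rrbracket$; it is Lipschitz for the flat norms and extends by continuity to $\pi:\mathscr{F}_k^{\mathbb{R}}(K)\to\mathscr{F}_k^{\mathbb{S}^1}(K)$. *)

(* Defs.v *)
From HB Require Import structures.
From mathcomp Require Import all_boot all_order all_algebra.
From mathcomp Require Import all_classical all_reals all_analysis.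
From mathcomp Require Import lra.

Set Implicit Arguments.
Unset Strict Implicit.
Unset Printing Implicit Defensive.

Import Order.TTheory GRing.Theory Num.Theory.
Import numFieldNormedType.Exports.

Local Open Scope classical_set_scope.
Local Open Scope quotient_scope.
Local Open Scope ring_scope.

(* The library's normedZmodType demands `|x *+ n| = `|x| *+ n, which fails in
   R/Z; hence a separate structure. *)
Record normedGroup (R : realType) := NormedGroup {
  ng_sort :> zmodType;
  ng_norm : ng_sort -> R;
  ng_norm_eq0 : forall g, ng_norm g = 0 <-> g = 0;
  ng_normN : forall g, ng_norm (- g) = ng_norm g;
  ng_normD : forall g h, ng_norm (g + h) <= ng_norm g + ng_norm h;
  ng_complete : forall u : nat -> ng_sort,
    (forall e, 0 < e -> exists N, forall m n, (N <= m)%N -> (N <= n)%N ->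
       ng_norm (u m - u n) < e) ->
    exists l, forall e, 0 < e -> exists N, forall n, (N <= n)%N ->
       ng_norm (u n - l) < e
}.

Section RealAndCircle.
Variable R : realType.

Lemma real_norm_eq0 (x : R) : `|x| = 0 <-> x = 0.
Proof. by split=> [/eqP|->]; rewrite ?normr0// normr_eq0 => /eqP. Qed.

Lemma real_complete (u : nat -> R) :
  (forall e, 0 < e -> exists N, forall m n, (N <= m)%N -> (N <= n)%N ->
     `|u m - u n| < e) ->
  exists l, forall e, 0 < e -> exists N, forall n, (N <= n)%N ->
     `|u n - l| < e.
Proof.
move=> cu; have /cvg_ex[l ul] : cvgn u.
  apply/cauchy_cvgP/cauchy_exP => e e0; have [N uN] := cu _ e0.
  exists (u N), N => // n /= Nn; rewrite -ball_normE /=; exact: uN.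
exists l => e e0; move/cvgrPdist_lt : ul => /(_ _ e0)[N _ uN].
by exists N => n Nn; rewrite distrC; apply: uN.
Qed.

Definition real_group : normedGroup R :=
  NormedGroup real_norm_eq0 (@normrN _ _) (@ler_normD _ _) real_complete.

(* R/Z; the subgroup is [pred x | x \is a Num.int]. *)
Definition circle : zmodType :=
  Quotient.quot (GRing.ZmodClosed.clone R (@Num.int_num_subdef R) _).

Definition circle_proj (x : R) : circle := \pi_circle x.

Definition frac (x : R) : R := x - (Num.floor x)%:~R.

Definition circle_norm (g : circle) : R :=
  let x := repr g in Num.min (frac x) (1 - frac x).

Lemma circle_proj_is_zmod_morphism : zmod_morphism circle_proj.
Proof. by move=> x y; rewrite /circle_proj raddfB. Qed.

HB.instance Definition _ :=
  GRing.isZmodMorphism.Build R circle circle_proj circle_proj_is_zmod_morphism.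

Lemma circle_proj_eqP (x y : R) :
  circle_proj x = circle_proj y <-> exists m : int, x - y = m%:~R.
Proof.
split.
  move=> /eqP; rewrite /circle_proj -Quotient.idealrBE => h.
  by have /intrP : x - y \is a Num.int by [].
move=> [m xy]; apply/eqP; rewrite /circle_proj -Quotient.idealrBE.
have : x - y \is a Num.int by rewrite xy intr_int.
by [].
Qed.

Lemma circle_projK (g : circle) : circle_proj (repr g) = g.
Proof. exact: reprK. Qed.

Lemma frac_itv (x : R) : 0 <= frac x < 1.
Proof.
have /andP[h1 h2] := floor_itv x.
by rewrite /frac subr_ge0 h1 ltrBlDl -[X in _ + X]/(1%:~R) -intrD h2.
Qed.

Lemma circle_normE (x : R) :
  circle_norm (circle_proj x) = Num.min (frac x) (1 - frac x).
Proof.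
rewrite /circle_norm; set y := repr _.
have /circle_proj_eqP[m xy] : circle_proj y = circle_proj x.
  by rewrite circle_projK.
suff -> : frac y = frac x by [].
have -> : y = x + m%:~R by rewrite -xy addrC subrK.
rewrite /frac floorDrz ?intr_int// intrKfloor intrD.
by rewrite opprD addrACA subrr addr0.
Qed.

Lemma circle_norm_le (x : R) (m : int) :
  circle_norm (circle_proj x) <= `|x - m%:~R|.
Proof.
rewrite circle_normE; have /andP[f0 f1] := frac_itv x.
set f := frac x in f0 f1 *.
have -> : x - m%:~R = f + (Num.floor x - m)%:~R.
  by rewrite /f /frac intrB addrA subrK.
move: (_ - m) f f0 f1 => j f f0 f1; case: (lerP 0 j) => j0.
  rewrite ge_min; apply/orP; left; have j0' : 0 <= j%:~R :> R by rewrite ler0z.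
  by rewrite ger0_norm; [rewrite lerDl|exact: addr_ge0].
rewrite ge_min; apply/orP; right.
have j1 : j%:~R <= -1 :> R by rewrite -[-1]/((-1)%:~R) ler_int; case: j j0.
have fj : f + j%:~R <= 0 by rewrite -(subrr 1) lerD// ltW.
by rewrite (ler0_norm fj) opprD [leRHS]addrC lerD2r lerNr.
Qed.

Lemma circle_norm_lift (g : circle) :
  exists2 x, circle_proj x = g & `|x| = circle_norm g.
Proof.
have [f0 f1] := andP (frac_itv (repr g)).
have fE : circle_proj (frac (repr g)) = g.
  rewrite -[RHS]circle_projK; apply/circle_proj_eqP.
  by exists (- Num.floor (repr g)); rewrite /frac addrC addKr intrN.
rewrite /circle_norm /=; case: (lerP (frac (repr g)) (1 - frac (repr g))) => h.
  by exists (frac (repr g)) => //; rewrite ger0_norm.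
exists (frac (repr g) - 1).
  rewrite -[RHS]fE; apply/circle_proj_eqP; exists (-1).
  by rewrite addrC addKr.
by rewrite distrC gtr0_norm// subr_gt0.
Qed.

Lemma circle_norm_proj (x : R) : circle_norm (circle_proj x) <= `|x|.
Proof. by have := circle_norm_le x 0; rewrite subr0. Qed.

Lemma circle_norm_eq0 g : circle_norm g = 0 <-> g = 0.
Proof.
split=> [g0|->].
  have [x xg xn] := circle_norm_lift g.
  by move/eqP: xn; rewrite g0 normr_eq0 -xg => /eqP ->; rewrite raddf0.
have := circle_norm_proj 0; rewrite raddf0 normr0 => h.
have [x _ xE] := circle_norm_lift 0.
by apply/eqP; rewrite eq_le h -xE normr_ge0.
Qed.

Lemma circle_normN g : circle_norm (- g) = circle_norm g.
Proof.
have le h : circle_norm (- h) <= circle_norm h.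
  have [x xh <-] := circle_norm_lift h; rewrite -xh.
  by rewrite -raddfN -[leRHS]normrN; exact: circle_norm_proj.
by apply/eqP; rewrite eq_le le -{1}[g]opprK le.
Qed.

Lemma circle_normD g h :
  circle_norm (g + h) <= circle_norm g + circle_norm h.
Proof.
have [x xg <-] := circle_norm_lift g; have [y yh <-] := circle_norm_lift h.
rewrite -xg -yh.
by rewrite -raddfD (le_trans (circle_norm_proj _))// ler_normD.
Qed.

Lemma circle_complete (u : nat -> circle) :
  (forall e, 0 < e -> exists N, forall m n, (N <= m)%N -> (N <= n)%N ->
     circle_norm (u m - u n) < e) ->
  exists l, forall e, 0 < e -> exists N, forall n, (N <= n)%N ->
     circle_norm (u n - l) < e.
Proof.
move=> cu.
have e4 : 0 < 4^-1 :> R by rewrite invr_gt0.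
have [N uN] := cu _ e4.
have /choice[y yE] : forall n, exists y, circle_proj y = u n /\
    `|y - repr (u N)| = circle_norm (u n - u N).
  move=> n; have [z zE <-] := circle_norm_lift (u n - u N).
  exists (z + repr (u N)); split; last by rewrite addrK.
  by rewrite raddfD /= zE circle_projK subrK.
have ysmall m n : (N <= m)%N -> (N <= n)%N ->
    `|y m - y n| = circle_norm (u m - u n).
  move=> Nm Nn; have [x xE xn] := circle_norm_lift (u m - u n).
  have d1 : `|y m - y n| < 4^-1 + 4^-1.
    rewrite -(subrKA (repr (u N))) (le_lt_trans (ler_normD _ _))//.
    rewrite (distrC _ (y n)) (yE m).2 (yE n).2 ltrD// uN//.
  have x4 : `|x| < 4^-1 by rewrite xn uN.
  have /circle_proj_eqP[j jE] : circle_proj (y m - y n) = circle_proj x.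
    by rewrite raddfB /= (yE m).1 (yE n).1 xE.
  suff j0 : j = 0 by rewrite -xn; move/eqP: jE; rewrite j0 subr_eq0 => /eqP ->.
  have : `|j%:~R : R| < 1.
    rewrite -jE (le_lt_trans (ler_normB _ _))//.
    have -> : 1 = 4^-1 + 4^-1 + (4^-1 + 4^-1) :> R.
      by lra.
    rewrite ltrD// (lt_trans x4)// ltrDl//.
  by rewrite -intr_norm -[1]/(1%:~R) ltr_int; case: j {jE} => [[|j]|j].
have [|l lE] := @real_complete y.
  move=> e e0; have [M uM] := cu _ e0; exists (maxn M N) => m n.
  by rewrite !geq_max => /andP[Mm Nm] /andP[Mn Nn]; rewrite ysmall// uM.
exists (circle_proj l) => e e0; have [M yM] := lE _ e0; exists M => n Mn.
by rewrite -(yE n).1 -raddfB (le_lt_trans (circle_norm_proj _))// yM.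
Qed.

Definition circle_group : normedGroup R :=
  NormedGroup circle_norm_eq0 circle_normN circle_normD circle_complete.

End RealAndCircle.

Section Hausdorff.
Variables (R : realType) (d : nat).
Implicit Types A : set 'rV[R]_d.

(* The library's norm on 'rV[R]_d is the sup norm. *)
Definition euclid_norm (x : 'rV[R]_d) : R := Num.sqrt (\sum_i x 0 i ^+ 2).

Definition diameter A : \bar R :=
  ereal_sup [set (euclid_norm (x - y))%:E | x in A & y in A].

(* Volume of the unit ball of R^k, by w_(k+2) = 2 pi / (k+2) * w_k. *)
Fixpoint ball_volume (k : nat) : R :=
  match k with
  | 0 => 1
  | 1 => 2
  | k'.+2 => 2 * pi / k'.+2%:R * ball_volume k'
  end.

(* The value on the empty set only matters for k = 0, where 0 ^+ 0 = 1. *)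
Definition hausdorff_gauge k A : \bar R :=
  if `[< A = set0 >] then 0%E
  else (ball_volume k * (fine (diameter A) / 2) ^+ k)%:E.

Definition hausdorff_size k (delta : R) A : \bar R :=
  ereal_inf [set (\sum_(0 <= i <oo) hausdorff_gauge k (U i))%E |
    U in [set U : nat -> set 'rV[R]_d |
      (forall i, (diameter (U i) <= delta%:E)%E) /\ A `<=` \bigcup_i U i]].

Definition hausdorff k A : \bar R :=
  ereal_sup [set hausdorff_size k delta A | delta in [set x | 0 < x]].

Lemma euclid_norm0 : euclid_norm 0 = 0.
Proof.
by rewrite /euclid_norm big1 ?sqrtr0// => i _; rewrite mxE expr0n.
Qed.

Lemma diameter_ge0 A : A !=set0 -> (0 <= diameter A)%E.
Proof.
move=> [x Ax]; apply: ereal_sup_ubound; exists x => //; exists x => //.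
by rewrite subrr euclid_norm0.
Qed.

Lemma ball_volume_ge0 k : 0 <= ball_volume k.
Proof.
suff : 0 <= ball_volume k /\ 0 <= ball_volume k.+1 by case.
elim: k => [|k [k0 k1]]; first by split.
split=> //=; apply: mulr_ge0 => //; apply: divr_ge0 => //.
by apply: mulr_ge0 => //; exact: pi_ge0.
Qed.

Lemma hausdorff_gauge_ge0 k A : (0 <= hausdorff_gauge k A)%E.
Proof.
rewrite /hausdorff_gauge; case: asboolP => // /eqP/set0P A0.
rewrite lee_fin mulr_ge0 ?ball_volume_ge0// exprn_ge0// divr_ge0//.
exact/fine_ge0/diameter_ge0.
Qed.

Lemma hausdorff_ge0 k A : (0 <= hausdorff k A)%E.
Proof.
apply: (@le_trans _ _ (hausdorff_size k 1 A)); last first.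
  by apply: ereal_sup_ubound; exists 1 => //=.
apply: le_ereal_inf_tmp => _ [U _ <-].
by apply: nneseries_ge0 => i _ _; exact: hausdorff_gauge_ge0.
Qed.

End Hausdorff.

Section Simplexes.
Variables (R : realType) (d : nat) (K : set 'rV[R]_d).

Definition aff_indep n (p : 'I_n -> 'rV[R]_d) : Prop :=
  forall c : 'I_n -> R, \sum_i c i = 0 -> \sum_i c i *: p i = 0 ->
    forall i, c i = 0.

Definition hull n (p : 'I_n -> 'rV[R]_d) : set 'rV[R]_d :=
  [set x | exists w : 'I_n -> R,
    [/\ forall i, 0 <= w i, \sum_i w i = 1 & x = \sum_i w i *: p i]].

(* Oriented (nondegenerate) simplexes: the orientation is given by the order of
   the vertices. *)
Record simplex k := Simplex {
  vertices :> {ffun 'I_k.+1 -> 'rV[R]_d};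
  simplexP : `[< aff_indep vertices /\ hull vertices `<=` K >] }.

HB.instance Definition _ k := [isSub for @vertices k].
HB.instance Definition _ k := [Choice of simplex k by <:].

Lemma face_subproof k (s : simplex k.+1) (i : 'I_k.+2) :
  `[< aff_indep [ffun j => s (lift i j)] /\
      hull [ffun j => s (lift i j)] `<=` K >].
Proof.
have /asboolP[ind sK] := simplexP s.
pose x0 (c : 'I_k.+1 -> R) (j : 'I_k.+2) :=
  if unlift i j is Some l then c l else 0.
have x0i c : x0 c i = 0 by rewrite /x0 unlift_none.
have x0l c l : x0 c (lift i l) = c l by rewrite /x0 liftK.
have sum0 c : \sum_j x0 c j = \sum_l c l.
  by rewrite (bigD1_ord i)//= x0i add0r; apply: eq_bigr => l _; rewrite x0l.
have sums c : \sum_j x0 c j *: s j =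
    \sum_l c l *: [ffun j => s (lift i j)] l.
  rewrite (bigD1_ord i)//= x0i scale0r add0r; apply: eq_bigr => l _.
  by rewrite x0l ffunE.
apply/asboolP; split.
  move=> c c0 cq l; rewrite -(x0l c); apply: ind; first by rewrite sum0.
  by rewrite sums.
move=> x [w [w0 w1 xE]]; apply: sK; exists (x0 w); split.
- by move=> j; rewrite /x0; case: unlift.
- by rewrite sum0.
- by rewrite sums.
Qed.

Definition face k (s : simplex k.+1) (i : 'I_k.+2) : simplex k :=
  Simplex (face_subproof s i).

Definition edges k (s : simplex k) : 'M[R]_(k, d) :=
  \matrix_(i < k) (s (lift ord0 i) - s ord0).

(* The two simplexes span parallel k-planes and induce the same (resp. the
   opposite) orientation on them. *)
Definition same_orientation k (s t : simplex k) : Prop :=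
  exists2 A : 'M[R]_k, edges s = A *m edges t & 0 < \det A.

Definition opposite_orientation k (s t : simplex k) : Prop :=
  exists2 A : 'M[R]_k, edges s = A *m edges t & \det A < 0.

Definition nonoverlapping k (ss : seq (simplex k)) : Prop :=
  pairwise (fun s t : simplex k =>
    `[< hausdorff k (hull s `&` hull t) = 0%E >]) ss.

Definition subdivision k (s : simplex k) (ss : seq (simplex k)) : Prop :=
  [/\ nonoverlapping ss,
      hull s = \bigcup_(t in [set t | t \in ss]) hull t &
      forall t, t \in ss -> same_orientation t s].

End Simplexes.

Section PolyhedralChains.
Variables (R : realType) (d : nat) (K : set 'rV[R]_d) (G : zmodType) (k : nat).

Definition formal_sum : Type := seq (G * simplex K k).
HB.instance Definition _ := Choice.on formal_sum.

(* Two formal sums, overlaps being allowed, denote the same polyhedral chain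
   when they have a common refinement up to reversals of orientation and
   to the addition of coefficients on equal simplexes. *)
Inductive chain_eq : formal_sum -> formal_sum -> Prop :=
| chain_eq_refl s : chain_eq s s
| chain_eq_sym s t : chain_eq s t -> chain_eq t s
| chain_eq_trans t s u : chain_eq s t -> chain_eq t u -> chain_eq s u
| chain_eq_cat s s' t t' :
    chain_eq s s' -> chain_eq t t' -> chain_eq (s ++ t) (s' ++ t')
| chain_eq_catC s t : chain_eq (s ++ t) (t ++ s)
| chain_eq_zero (x : simplex K k) : chain_eq [:: (0, x)] [::]
| chain_eq_add g h x : chain_eq [:: (g, x); (h, x)] [:: (g + h, x)]
| chain_eq_reverse g (x y : simplex K k) : hull x = hull y -> opposite_orientation x y ->
    chain_eq [:: (g, x)] [:: (- g, y)]
| chain_eq_refine g x xs : subdivision x xs ->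
    chain_eq [:: (g, x)] [seq (g, y) | y <- xs].

Definition chain_eqb (s t : formal_sum) : bool := `[< chain_eq s t >].

Lemma chain_eqb_equiv : equiv_class_of chain_eqb.
Proof.
split=> [s|s t|t s u]; rewrite /chain_eqb.
- exact/asboolP/chain_eq_refl.
- by apply/asboolP/asboolP; exact: chain_eq_sym.
- by move=> /asboolP st /asboolP tu; apply/asboolP/(chain_eq_trans st tu).
Qed.

Canonical chain_equiv := EquivRelPack chain_eqb_equiv.
Canonical chain_encModRel := defaultEncModRel chain_eqb.

Definition polychain := {eq_quot chain_eqb}.
HB.instance Definition _ : EqQuotient formal_sum chain_eqb polychain :=
  EqQuotient.on polychain.
HB.instance Definition _ := Choice.on polychain.

Lemma polychain_eqP (s t : formal_sum) :
  \pi_polychain s = \pi_polychain t <-> chain_eq s t.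
Proof.
split=> [/eqP|st]; first by rewrite piE => /asboolP.
by apply/eqP; rewrite piE; apply/asboolP.
Qed.

Lemma repr_polychain (s : formal_sum) : chain_eq (repr (\pi_polychain s)) s.
Proof. by apply/polychain_eqP; rewrite reprK. Qed.

Definition opp_sum (s : formal_sum) : formal_sum :=
  [seq (- x.1, x.2) | x <- s].

Lemma chain_eq_opp s t : chain_eq s t -> chain_eq (opp_sum s) (opp_sum t).
Proof.
elim=> {s t} [s|s t _|t s u _ st _|s s' t t' _ ss _ tt|s t|x|g h x|g x y xy o|
  g x xs xxs]; rewrite /opp_sum ?map_cat /=.
- exact: chain_eq_refl.
- exact: chain_eq_sym.
- exact: chain_eq_trans st.
- exact: chain_eq_cat.
- exact: chain_eq_catC.
- by rewrite oppr0; exact: chain_eq_zero.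
- by rewrite opprD; exact: chain_eq_add.
- exact: chain_eq_reverse.
- by rewrite -map_comp; exact: chain_eq_refine.
Qed.

Lemma chain_eq_addN s : chain_eq (opp_sum s ++ s) [::].
Proof.
elim: s => [|[g x] s ih]; first exact: chain_eq_refl.
rewrite /= -cat1s -(cat1s _ s).
have sw : chain_eq (([:: (- g, x)] ++ opp_sum s) ++ ([:: (g, x)] ++ s))
                   (([:: (- g, x)] ++ [:: (g, x)]) ++ (opp_sum s ++ s)).
  rewrite -!catA; apply: chain_eq_cat; first exact: chain_eq_refl.
  rewrite !catA; apply: chain_eq_cat; last exact: chain_eq_refl.
  exact: chain_eq_catC.
apply: (chain_eq_trans sw).
rewrite -[[::] in X in chain_eq _ X]cats0; apply: chain_eq_cat ih.
apply: chain_eq_trans (chain_eq_add _ _ _) _; rewrite addNr.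
exact: chain_eq_zero.
Qed.

Definition chain_zero : polychain := \pi_polychain [::].
Definition chain_opp (P : polychain) : polychain :=
  \pi_polychain (opp_sum (repr P)).
Definition chain_add (P Q : polychain) : polychain :=
  \pi_polychain (repr P ++ repr Q).

Lemma chain_addE (s t : formal_sum) :
  chain_add (\pi_polychain s) (\pi_polychain t) = \pi_polychain (s ++ t).
Proof. by apply/polychain_eqP/chain_eq_cat; exact: repr_polychain. Qed.

Lemma chain_oppE (s : formal_sum) :
  chain_opp (\pi_polychain s) = \pi_polychain (opp_sum s).
Proof. by apply/polychain_eqP/chain_eq_opp; exact: repr_polychain. Qed.

Lemma chain_addA : associative chain_add.
Proof.
elim/quotP=> s _; elim/quotP=> t _; elim/quotP=> u _.
by rewrite (chain_addE t u) (chain_addE s t) (chain_addE s) chain_addE catA.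
Qed.

Lemma chain_addC : commutative chain_add.
Proof.
elim/quotP=> s _; elim/quotP=> t _; rewrite (chain_addE s) (chain_addE t).
exact/polychain_eqP/chain_eq_catC.
Qed.

Lemma chain_add0 : left_id chain_zero chain_add.
Proof. by elim/quotP=> s _; rewrite (chain_addE [::]). Qed.

Lemma chain_addN : left_inverse chain_zero chain_opp chain_add.
Proof.
elim/quotP=> s _; rewrite chain_oppE chain_addE.
exact/polychain_eqP/chain_eq_addN.
Qed.

HB.instance Definition _ := GRing.isZmodule.Build polychain
  chain_addA chain_addC chain_add0 chain_addN.

Lemma pi_cat (s t : formal_sum) :
  \pi_polychain (s ++ t) = \pi_polychain s + \pi_polychain t.
Proof. by rewrite -chain_addE. Qed.

Lemma pi_opp (s : formal_sum) :
  \pi_polychain (opp_sum s) = - \pi_polychain s.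
Proof. by rewrite -chain_oppE. Qed.

End PolyhedralChains.

Section Boundary.
Variables (R : realType) (d : nat) (K : set 'rV[R]_d) (G : zmodType) (k : nat).

Definition boundary (q : formal_sum K G k.+1) : formal_sum K G k :=
  flatten [seq [seq (if odd i then - x.1 else x.1, face x.2 i) |
                 i : 'I_k.+2 <- enum 'I_k.+2] | x <- q].

End Boundary.

Section FlatChains.
Variables (R : realType) (d : nat) (K : set 'rV[R]_d) (G : normedGroup R).

Definition sum_mass k (s : formal_sum K G k) : \bar R :=
  (\sum_(x <- s) (ng_norm x.1)%:E * hausdorff k (hull x.2))%E.

(* All nonoverlapping representatives have the same mass. *)
Definition poly_mass k (P : polychain K G k) : \bar R :=
  ereal_inf [set sum_mass s | s in [set s : formal_sum K G k |
    \pi_(polychain K G k) s = P /\ nonoverlapping [seq x.2 | x <- s]]].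

(* Q ranges over the polyhedral (k+1)-chains via its representatives. *)
Definition poly_flat k (P : polychain K G k) : \bar R :=
  ereal_inf [set (poly_mass (\pi_(polychain K G k.+1) q) +
                  poly_mass (P - \pi_(polychain K G k) (boundary q))%R)%E |
    q in [set: formal_sum K G k.+1]].

Definition flat_cauchy k (u : nat -> polychain K G k) : Prop :=
  forall e : R, 0 < e -> exists N, forall m n, (N <= m)%N -> (N <= n)%N ->
    (poly_flat (u m - u n)%R < e%:E)%E.

Definition flat_class k (u : nat -> polychain K G k) :
    set (nat -> polychain K G k) :=
  [set v | flat_cauchy v /\ poly_flat (u n - v n) @[n --> \oo] --> 0%E].

(* The completion: classes of poly_flat-Cauchy sequences of polyhedral chains. *)
Record flat_chain k := FlatChain {
  flat_chain_set :> set (nat -> polychain K G k);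
  flat_chainP : exists2 u, flat_cauchy u & flat_chain_set = flat_class u }.

Definition flat_chain_of k (u : nat -> polychain K G k) (cu : flat_cauchy u) :
  flat_chain k := FlatChain (ex_intro2 _ _ u cu erefl).

Definition flat_repr k (T : flat_chain k) : nat -> polychain K G k :=
  s2val (cid2 (flat_chainP T)).

Lemma flat_repr_cauchy k (T : flat_chain k) : flat_cauchy (flat_repr T).
Proof. exact: s2valP (cid2 (flat_chainP T)). Qed.

(* F(T - S) on the completion; the limit does not depend on the representing
   sequences. *)
Definition flat_dist k (T S : flat_chain k) : \bar R :=
  limn (fun n => poly_flat (flat_repr T n - flat_repr S n)).

Lemma flat_cauchy_cst k (P : polychain K G k) : flat_cauchy (fun=> P).
Proof.
move=> e e0; exists 0%N => m n _ _; rewrite subrr.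
have mass0 j : (poly_mass (0%R : polychain K G j) <= 0)%E.
  apply: ereal_inf_lbound; exists [::]; last by rewrite /sum_mass big_nil.
  by [].
apply: (@le_lt_trans _ _ 0%E); last by rewrite lte_fin.
apply: (@le_trans _ _ (poly_mass (0%R : polychain K G k.+1) +
                       poly_mass (0%R : polychain K G k))%E).
  apply: ereal_inf_lbound; exists [::] => //.
  by rewrite (_ : \pi_(polychain K G k) _ = 0)// subr0.
by rewrite -[leRHS]adde0 leeD.
Qed.

Definition flat_of_poly k (P : polychain K G k) : flat_chain k :=
  flat_chain_of (flat_cauchy_cst P).

Definition flat_mass k (T : flat_chain k) : \bar R :=
  ereal_inf [set limn_einf (fun n => poly_mass (P n)) |
    P in [set P : nat -> polychain K G k |
      flat_dist (flat_of_poly (P n)) T @[n --> \oo] --> 0%E]].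

End FlatChains.

Section InducedMap.
Variables (R : realType) (d : nat) (K : set 'rV[R]_d).
Local Notation phi := (@circle_proj R).
Local Notation RG := (real_group R).
Local Notation SG := (circle_group R).

Definition push_sum k (s : formal_sum K RG k) : formal_sum K SG k :=
  [seq (phi x.1 : SG, x.2) | x <- s].

Lemma chain_eq_push k (s t : formal_sum K RG k) :
  chain_eq s t -> chain_eq (push_sum s) (push_sum t).
Proof.
elim=> {s t} [s|s t _|t s u _ st _|s s' t t' _ ss _ tt|s t|x|g h x|g x y xy o|
  g x xs xxs]; rewrite /push_sum ?map_cat /=.
- exact: chain_eq_refl.
- exact: chain_eq_sym.
- exact: chain_eq_trans st.
- exact: chain_eq_cat.
- exact: chain_eq_catC.
- by rewrite raddf0; exact: chain_eq_zero.
- by rewrite raddfD; exact: chain_eq_add.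
- by rewrite raddfN; exact: chain_eq_reverse.
- by rewrite -map_comp; exact: (@chain_eq_refine _ _ _ SG).
Qed.

Definition poly_pi k (P : polychain K RG k) : polychain K SG k :=
  \pi_(polychain K SG k) (push_sum (repr P)).

Lemma poly_piE k (s : formal_sum K RG k) :
  poly_pi (\pi_(polychain K RG k) s) = \pi_(polychain K SG k) (push_sum s).
Proof. exact/polychain_eqP/chain_eq_push/repr_polychain. Qed.

Lemma poly_pi_is_zmod_morphism k : zmod_morphism (@poly_pi k).
Proof.
elim/quotP=> s _; elim/quotP=> t _; rewrite -pi_opp -pi_cat !poly_piE.
rewrite -pi_opp -pi_cat /push_sum /opp_sum map_cat -!map_comp.
congr \pi; congr (_ ++ _).
by apply: eq_map => x /=; rewrite raddfN.
Qed.

HB.instance Definition _ k :=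
  GRing.isZmodMorphism.Build (polychain K RG k) (polychain K SG k) (@poly_pi k)
    (@poly_pi_is_zmod_morphism k).

Lemma boundary_push k (q : formal_sum K RG k.+1) :
  boundary (push_sum q) = push_sum (boundary q).
Proof.
rewrite /boundary /push_sum map_flatten -!map_comp.
congr flatten; apply: eq_map => x /=; rewrite -map_comp.
by apply: eq_map => i /=; case: odd; rewrite ?raddfN.
Qed.

Lemma poly_mass_pi k (P : polychain K RG k) :
  (poly_mass (poly_pi P) <= poly_mass P)%E.
Proof.
apply: le_ereal_inf_tmp => _ [s [<- sn] <-].
apply: (@le_trans _ _ (sum_mass (push_sum s))).
  apply: ereal_inf_lbound; exists (push_sum s) => //; split.
    by rewrite poly_piE.
  by rewrite /push_sum -map_comp.
rewrite /sum_mass /push_sum big_map; apply: lee_sum => x _ /=.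
apply: lee_wpmul2r; first exact: hausdorff_ge0.
by rewrite lee_fin circle_norm_proj.
Qed.

Lemma poly_flat_pi k (P : polychain K RG k) :
  (poly_flat (poly_pi P) <= poly_flat P)%E.
Proof.
apply: le_ereal_inf_tmp => _ [q _ <-].
apply: (@le_trans _ _ (poly_mass (\pi_(polychain K SG k.+1) (push_sum q)) +
   poly_mass (poly_pi P -
     \pi_(polychain K SG k) (boundary (push_sum q)))%R)%E).
  by apply: ereal_inf_lbound; exists (push_sum q).
rewrite boundary_push -!poly_piE -raddfB.
by apply: leeD; exact: poly_mass_pi.
Qed.

Lemma flat_cauchy_pi k (u : nat -> polychain K RG k) :
  flat_cauchy u -> flat_cauchy (fun n => poly_pi (u n)).
Proof.
move=> cu e e0; have [N uN] := cu e e0; exists N => m n Nm Nn.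
by rewrite -raddfB (le_lt_trans (poly_flat_pi _))// uN.
Qed.

(* The extension by continuity of poly_pi: poly_pi does not increase poly_flat,
   so the class does not depend on the sequence chosen to represent T. *)
Definition flat_pi k (T : flat_chain K RG k) : flat_chain K SG k :=
  flat_chain_of (flat_cauchy_pi (flat_repr_cauchy T)).

End InducedMap.

(* Main.v *)
(* Take polyhedral chains P_j -> T of bounded mass with P_j - P_(j+1) = D q_j + r_j, where
   D is the boundary and the masses of the r_j are summable. Then
   B_n = D q_0 + ... + D q_(n-1) is a circle-valued cycle of bounded mass, and
   P_n = P_0 - B_n - (r_0 + ... + r_(n-1)). The chains P_0 and r_j lift to real chains of
   the same mass. A circle-valued cycle lifts to a real cycle of at most twice its mass:
   representatives of the coefficients in [0, 1] have an integral divergence, and moving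
   them along circulations supported on the edges with non-integral values rounds them to
   0 or 1 without changing the divergence or increasing a given linear cost. Real cycles of
   bounded mass are precompact for the flat norm: a partition of unity makes each of them
   homologous, through a 2-chain of small mass, to a cycle with bounded coefficients on the
   segments of a finite net. So the lifts of the P_n converge along a subsequence, and the
   limit is mapped to T. *)
From HB Require Import structures.
Require Import Defs.
From mathcomp Require Import all_boot all_order all_algebra perm.
From mathcomp Require Import all_classical all_reals all_analysis.
From mathcomp Require Import ring lra.
Set Implicit Arguments.
Unset Strict Implicit.
Unset Printing Implicit Defensive.
Import Order.TTheory GRing.Theory Num.Theory.
Import numFieldNormedType.Exports.
Local Open Scope classical_set_scope.
Local Open Scope ring_scope.

(** * Hausdorff measure *)

(** The [q_j] can be taken of summable mass as well, and lifting them to real 2-chains would give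
    real boundaries that converge in the flat norm. But the boundary of such a lift differs from a
    lift of the boundary by integer coefficients of uncontrolled mass, so the limit might have
    infinite mass. Hence the sum of the boundaries is lifted as a single 1-cycle. This bounds the
    masses, but the lifts for different [n] are unrelated, and compactness has to replace the lost
    Cauchy property. Compactness is available for cycles: pushing a chain onto a net leaves cones
    over its endpoints, which cancel in a cycle, whereas the boundaries of the [P_n] have no bound.
    This is why the fixed [P_0] and the [r_j], which are summable in mass, are split off. A second
    obstacle is that mass is an infimum over nonoverlapping representatives. Its subadditivity rests
    on common refinements, and for these the condition that overlaps are null sets is replaced by
    separation by a hyperplane, which survives further cutting. *)

Section EuclidNorm.
Variables (R : realType) (d : nat).
Implicit Types x y : 'rV[R]_d.

Lemma euclid_norm_ge0 x : 0 <= euclid_norm x.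
Proof. exact: sqrtr_ge0. Qed.

Lemma euclid_normZ (c : R) x : euclid_norm (c *: x) = `|c| * euclid_norm x.
Proof.
rewrite /euclid_norm -sqrtr_sqr -sqrtrM ?sqr_ge0// mulr_sumr.
by congr Num.sqrt; apply: eq_bigr => i _; rewrite mxE exprMn.
Qed.

Lemma normr_coord_le x i : `|x 0 i| <= euclid_norm x.
Proof.
rewrite -sqrtr_sqr ler_wsqrtr// (bigD1 i)//= lerDl.
by apply: sumr_ge0 => j _; exact: sqr_ge0.
Qed.

Lemma normr_coord_norm x i : `|x 0 i| <= `|x|.
Proof.
rewrite [leRHS]mx_normrE; exact: (le_bigmax _ (fun ij : 'I_1 * 'I_d => `|x ij.1 ij.2|) (0, i)).
Qed.

Lemma norm_ge_coords x (r : R) : 0 <= r -> (forall i, `|x 0 i| <= r) -> `|x| <= r.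
Proof.
move=> r0 h; rewrite [leLHS]mx_normrE; apply: bigmax_le => // -[i j] _ /=.
by rewrite (ord1 i).
Qed.

Lemma euclid_le_norm x : euclid_norm x <= d%:R * `|x|.
Proof.
rewrite -[leRHS]ger0_norm ?mulr_ge0// -sqrtr_sqr ler_wsqrtr//.
have h i : x 0 i ^+ 2 <= `|x| ^+ 2.
  by rewrite -real_normK ?num_real// lerXn2r ?nnegrE//; exact: normr_coord_norm.
apply: (@le_trans _ _ (\sum_(i < d) `|x| ^+ 2)); first exact: ler_sum.
rewrite sumr_const card_ord exprMn -[leLHS]mulr_natl.
apply: ler_wpM2r; first exact: sqr_ge0.
by rewrite -natrX ler_nat; case: (d) => // n; rewrite expnS expn1 leq_pmulr.
Qed.

End EuclidNorm.

Section HausdorffFacts.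
Variables (R : realType) (d : nat).
Implicit Types A B : set 'rV[R]_d.

Lemma diameter_le A (r : \bar R) :
  (forall x y, A x -> A y -> ((euclid_norm (x - y))%:E <= r)%E) ->
  (diameter A <= r)%E.
Proof. by move=> h; apply: ge_ereal_sup => _ [x Ax [y Ay <-]]; exact: h. Qed.

Lemma le_diameter A B : A `<=` B -> (diameter A <= diameter B)%E.
Proof.
move=> AB; apply: diameter_le => x y /AB Bx /AB By.
by apply: ereal_sup_ubound; exists x => //; exists y.
Qed.

Lemma euclid_le_diameter A x y :
  A x -> A y -> ((euclid_norm (x - y))%:E <= diameter A)%E.
Proof. by move=> Ax Ay; apply: ereal_sup_ubound; exists x => //; exists y. Qed.

Lemma hausdorff_gauge0 k : hausdorff_gauge k (set0 : set 'rV[R]_d) = 0%E.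
Proof. by rewrite /hausdorff_gauge; case: asboolP. Qed.

Lemma diameter_fin A (r : R) : A !=set0 -> (diameter A <= r%:E)%E ->
  diameter A = (fine (diameter A))%:E.
Proof.
move=> /diameter_ge0 A0 Ar; rewrite fineK// ge0_fin_numE//.
exact: le_lt_trans Ar (ltry _).
Qed.

Lemma hausdorff_gauge_le k A (r : R) : 0 <= r -> (diameter A <= r%:E)%E ->
  (hausdorff_gauge k A <= (ball_volume R k * (r / 2) ^+ k)%:E)%E.
Proof.
move=> r0 Ar; rewrite /hausdorff_gauge; case: asboolP => [_|/eqP/set0P A0].
  by rewrite lee_fin mulr_ge0 ?ball_volume_ge0// exprn_ge0// divr_ge0.
rewrite lee_fin ler_wpM2l ?ball_volume_ge0// lerXn2r ?nnegrE ?divr_ge0//.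
  exact/fine_ge0/diameter_ge0.
by rewrite ler_pM2r// -lee_fin -(diameter_fin A0 Ar).
Qed.

Lemma le_hausdorff_gauge k A B (r : R) : A `<=` B -> (diameter B <= r%:E)%E ->
  (hausdorff_gauge k A <= hausdorff_gauge k B)%E.
Proof.
move=> AB Br; have [A0|/set0P A0] := eqVneq A set0.
  by rewrite A0 hausdorff_gauge0 hausdorff_gauge_ge0.
have B0 : B !=set0 by case: A0 => x /AB; exists x.
have hB := diameter_fin B0 Br.
rewrite [leRHS]/hausdorff_gauge; case: asboolP => [/eqP|_].
  by move/set0P: B0 => /negbTE ->.
apply: hausdorff_gauge_le; first exact/fine_ge0/diameter_ge0.
by rewrite -hB; exact: le_diameter.
Qed.

Lemma le_hausdorff k A B : A `<=` B -> (hausdorff k A <= hausdorff k B)%E.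
Proof.
move=> AB; apply: ge_ereal_sup => _ [e e0 <-].
apply: (@le_trans _ _ (hausdorff_size k e B)).
  apply: ereal_inf_le_tmp => _ [U [Ue BU] <-]; exists U => //; split=> //.
  exact: subset_trans BU.
by apply: ereal_sup_ubound; exists e.
Qed.

Lemma hausdorff_size_le k (e e' : R) A : e <= e' ->
  (hausdorff_size k e' A <= hausdorff_size k e A)%E.
Proof.
move=> ee'; apply: ereal_inf_le_tmp => _ [U [Ue AU] <-]; exists U => //; split=> //.
by move=> i; apply: le_trans (Ue i) _; rewrite lee_fin.
Qed.

(** The finite list is prolonged to a sequence by empty sets, which have gauge 0 in every
    dimension. *)
Lemma hausdorff_size_cover k (e r : R) A (s : seq (set 'rV[R]_d)) :
  0 <= r <= e ->
  A `<=` [set x | exists2 U, U \in s & U x] ->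
  (forall U, U \in s -> (diameter U <= r%:E)%E) ->
  (hausdorff_size k e A <=
     ((size s)%:R * (ball_volume R k * (r / 2) ^+ k))%:E)%E.
Proof.
move=> /andP[r0 re] As sr.
apply: ge_ereal_inf; exists (\sum_(0 <= i <oo) hausdorff_gauge k (nth set0 s i))%E.
  exists (nth set0 s) => //; split=> [i|x /As[U /(nthP set0)[i _ <-] Ux]]; last by exists i.
  have [si|si] := leqP (size s) i.
    by rewrite nth_default//; apply: diameter_le.
  by apply: le_trans (sr _ (mem_nth _ si)) _; rewrite lee_fin.
rewrite (nneseries_split 0 (size s)); last by move=> *; exact: hausdorff_gauge_ge0.
rewrite add0n eseries0 ?adde0; last first.
  by move=> i si _; rewrite nth_default// hausdorff_gauge0.
rewrite mulr_natl -[in leRHS](card_ord (size s)) -sumr_const -sumEFin big_mkord.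
apply: lee_sum => i _; apply: hausdorff_gauge_le => //.
exact/sr/mem_nth.
Qed.

(** Pulling a cover of the image back through the homothety of centre [c] and ratio [l] divides
    diameters by [l]. The lemma compares a simplex with a shrunk copy. *)
Lemma hausdorff_contract k (c : 'rV[R]_d) (l : R) A : 0 < l ->
  ((l ^+ k)%:E * hausdorff k A <=
     hausdorff k [set (c + l *: (x - c))%R | x in A])%E.
Proof.
move=> l0; set phi := fun x : 'rV[R]_d => c + l *: (x - c); set B := [set _ | _ in _].
have phiB x y : euclid_norm (phi x - phi y) = l * euclid_norm (x - y).
  have -> : phi x - phi y = l *: (x - y).
    rewrite /phi /= opprD addrACA subrr add0r -scalerBr; congr (_ *: _).
    by rewrite opprB addrA subrK.
  by rewrite euclid_normZ gtr0_norm.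
have lk0 : 0 < l ^+ k by rewrite exprn_gt0.
rewrite -lee_pdivlMl//; apply: ge_ereal_sup => _ [e e0 <-].
rewrite lee_pdivlMl//.
apply: (@le_trans _ _ (hausdorff_size k (l * e) B)); last first.
  by apply: ereal_sup_ubound; exists (l * e) => //=; rewrite mulr_gt0.
apply: le_ereal_inf_tmp => _ [U [Ue BU] <-].
have dV i : (diameter (phi @^-1` U i) <= (l^-1)%:E * diameter (U i))%E.
  apply: diameter_le => x y Ux Uy; rewrite lee_pdivlMl// -EFinM -phiB.
  exact: euclid_le_diameter.
apply: (@le_trans _ _ ((l ^+ k)%:E * \sum_(0 <= i <oo) hausdorff_gauge k (phi @^-1` U i)))%E.
  rewrite lee_pmul2l//; apply: ereal_inf_lbound; exists (fun i => phi @^-1` U i) => //.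
  split=> [i|x Ax].
    apply: le_trans (dV i) _; rewrite lee_pdivrMl// -EFinM; exact: Ue.
  by have [|i _ Ui] := BU (phi x); [exists x|exists i].
rewrite -nneseriesZl; last by move=> *; exact: hausdorff_gauge_ge0.
apply: lee_nneseries => i _.
  by move=> _; rewrite mule_ge0 ?hausdorff_gauge_ge0// lee_fin ltW.
have [V0|/set0P V0] := eqVneq (phi @^-1` U i) set0.
  by rewrite V0 hausdorff_gauge0 mule0 hausdorff_gauge_ge0.
have U0 : U i !=set0 by case: V0 => x Ux; exists (phi x).
have dU := diameter_fin U0 (Ue i).
have := @hausdorff_gauge_le k (phi @^-1` U i) (l^-1 * fine (diameter (U i))).
rewrite EFinM -dU => /(_ _ (dV i)) h.
rewrite -lee_pdivlMl//; apply: le_trans (h _) _.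
  by rewrite mulr_ge0 ?invr_ge0 ?(ltW l0)//; exact/fine_ge0/diameter_ge0.
rewrite [in leRHS]/hausdorff_gauge; case: asboolP => [/eqP|_].
  by move/set0P: U0 => /negbTE ->.
by rewrite -EFinM lee_fin -mulrA exprMn exprVn mulrCA.
Qed.

Definition pos_dist A B := exists2 e : R, 0 < e &
  forall x y, A x -> B y -> e <= euclid_norm (x - y).

(** Once the sets of a cover have diameter below the gap [e], none of them meets both [A] and [B],
    so a cover of the union splits into a cover of [A] and one of [B]. *)
Lemma hausdorff_pos_dist k A B : pos_dist A B ->
  (hausdorff k.+1 A + hausdorff k.+1 B <= hausdorff k.+1 (A `|` B))%E.
Proof.
move=> [e e0 AB].
have sizeD (f : R) : 0 < f -> f < e -> (hausdorff_size k.+1 f A + hausdorff_size k.+1 f B <=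
    hausdorff_size k.+1 f (A `|` B))%E.
  move=> f0 fe; apply: le_ereal_inf_tmp => _ [U [Uf ABU] <-].
  pose V (C : set 'rV[R]_d) i := [set x | U i x /\ (exists2 y, C y & U i y)].
  have VU C i : V C i `<=` U i by move=> x [].
  have h C : C `<=` A `|` B -> (hausdorff_size k.+1 f C <=
      \sum_(0 <= i <oo) hausdorff_gauge k.+1 (V C i))%E.
    move=> CAB; apply: ereal_inf_lbound; exists (V C) => //; split=> [i|x Cx].
      exact: le_trans (le_diameter (VU C i)) (Uf i).
    by have [i _ Ui] := ABU _ (CAB _ Cx); exists i => //; split=> //; exists x.
  apply: le_trans (leeD (h A _) (h B _)) _; [by move=> x; left|by move=> x; right|].
  rewrite -nneseriesD; try by move=> *; exact: hausdorff_gauge_ge0.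
  apply: lee_nneseries => i _.
    by move=> _; rewrite adde_ge0// hausdorff_gauge_ge0.
  have [VA0|/set0P[x [Ux [x' Ax' Ux']]]] := eqVneq (V A i) set0.
    rewrite VA0 hausdorff_gauge0 add0e; exact: le_hausdorff_gauge (VU _ _) (Uf i).
  have -> : V B i = set0.
    apply/seteqP; split=> // y [Uy [y' By' Uy']].
    have := AB _ _ Ax' By'; rewrite leNgt => /negP[].
    apply: le_lt_trans fe; rewrite -lee_fin; apply: le_trans (Uf i).
    exact: euclid_le_diameter.
  rewrite hausdorff_gauge0 adde0; exact: le_hausdorff_gauge (VU _ _) (Uf i).
have [->|fin] := eqVneq (hausdorff k.+1 (A `|` B)) +oo%E; first exact: leey.
have finC C : C `<=` A `|` B -> hausdorff k.+1 C \is a fin_num.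
  move=> /(le_hausdorff k.+1) h; rewrite ge0_fin_numE ?hausdorff_ge0//.
  by apply: le_lt_trans h _; rewrite lt_neqAle fin leey.
have fA := finC A (fun x Ax => or_introl Ax); have fB := finC B (fun x Bx => or_intror Bx).
apply/lee_addgt0Pr => g g0; have g2 : 0 < g / 2 by rewrite divr_gt0.
have [_ [a a0 <-] ha] := ub_ereal_sup_adherent g2 fA.
have [_ [b b0 <-] hb] := ub_ereal_sup_adherent g2 fB.
pose f := Num.min (Num.min a b) (e / 2).
have f0 : 0 < f by rewrite !lt_min a0 b0 divr_gt0.
have fe : f < e by rewrite gt_min ltr_pdivrMr// ltr_pMr// ltrDl ltr01 orbT.
have fa : f <= a by rewrite !ge_min lexx.
have fb : f <= b by rewrite !ge_min lexx orbT.
have le1 : (hausdorff k.+1 A <= hausdorff_size k.+1 f A + (g / 2)%:E)%E.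
  rewrite -leeBlDr//; apply: le_trans (ltW ha) _; exact: hausdorff_size_le.
have le2 : (hausdorff k.+1 B <= hausdorff_size k.+1 f B + (g / 2)%:E)%E.
  rewrite -leeBlDr//; apply: le_trans (ltW hb) _; exact: hausdorff_size_le.
apply: le_trans (leeD le1 le2) _; rewrite addeACA -EFinD -splitr leeD2r//.
by apply: le_trans (sizeD f f0 fe) _; apply: ereal_sup_ubound; exists f.
Qed.

Lemma hausdorff_sum_pos_dist k (T : eqType) (F : T -> set 'rV[R]_d) (s : seq T) A :
  (forall x, x \in s -> F x `<=` A) ->
  pairwise (fun x y => `[< pos_dist (F x) (F y) >]) s ->
  (\sum_(x <- s) hausdorff k.+1 (F x) <= hausdorff k.+1 A)%E.
Proof.
move=> sA ps; suff : (\sum_(x <- s) hausdorff k.+1 (F x) <=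
    hausdorff k.+1 (\bigcup_(x in [set` s]) F x))%E.
  by move/le_trans; apply; apply: le_hausdorff => y [x xs]; exact: sA.
elim: s ps {sA} => [|x s ih]; first by rewrite big_nil hausdorff_ge0.
rewrite pairwise_cons big_cons => /andP[/allP xs /ih{}ih].
apply: (@le_trans _ _ (hausdorff k.+1 (F x) +
    hausdorff k.+1 (\bigcup_(x in [set` s]) F x))%E); first by rewrite leeD2l.
apply: le_trans (hausdorff_pos_dist _ _) _.
  elim: s xs {ih} => [|y s ih] xs; first by exists 1 => // ? ? ? [].
  have /asboolP[e e0 h] := xs y (mem_head _ _).
  have [z zs|f f0 h'] := ih _; first by apply: xs; rewrite inE zs orbT.
  exists (Num.min e f) => [|u v Fu [w]]; first by rewrite lt_min e0.
  rewrite /= inE ge_min => /orP[/eqP-> /(h _ _ Fu) ->//|ws Fw].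
  by rewrite (h' u v) ?orbT//; exists w.
apply: le_hausdorff => y [Fy|[z zs Fz]]; first by exists x => //=; rewrite mem_head.
by exists z => //=; rewrite inE zs orbT.
Qed.

End HausdorffFacts.

(** * Measure of parallelepipeds from above and of segments from below *)

Section HausdorffBounds.
Variables (R : realType) (d : nat).
Implicit Types A B : set 'rV[R]_d.

(** Cutting the edge [e i] into [N i] parts shorter than [1 / n] gives cells of diameter at most
    [k / n] in the sup norm, hence [d * k / n] in the Euclidean norm. Their number is at most the
    product of the [n * |e i| + 1], and [1 / n <= eta] absorbs the summand 1. The slack [eta] keeps
    the bound meaningful when some [e i] is 0. *)
Lemma hausdorff_box k (p : 'rV[R]_d) (e : 'I_k -> 'rV[R]_d) A (eta : R) :
  0 < eta ->
  (forall x, A x -> exists2 u : 'I_k -> R, (forall i, 0 <= u i <= 1) &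
     x = p + \sum_i u i *: e i) ->
  (hausdorff k A <= (ball_volume R k * (d%:R * k%:R / 2) ^+ k *
     \prod_i (`|e i| + eta))%:E)%E.
Proof.
move=> eta0 Ae; apply: ge_ereal_sup => _ [delta /= delta0 <-].
pose n := (Num.trunc (Num.max eta^-1 (d%:R * k%:R / delta))).+1.
have := truncnS_gt (Num.max eta^-1 (d%:R * k%:R / delta)).
rewrite -/n gt_max => /andP[n1 n2].
have n0 : 0 < n%:R :> R by rewrite ltr0n.
have n_eta : n%:R^-1 <= eta.
  by rewrite -[leRHS]invrK lef_pV2 ?posrE ?invr_gt0//; apply: ltW.
have n_delta : d%:R * (k%:R / n%:R) <= delta.
  by rewrite mulrA ler_pdivrMr// [delta * _]mulrC -ler_pdivrMr// ltW.
pose N i := (Num.trunc (n%:R * `|e i|)).+1.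
have N0 i : 0 < (N i)%:R :> R by rewrite ltr0n.
have Nlt i : n%:R * `|e i| < (N i)%:R by exact: truncnS_gt.
have Nle i : (N i)%:R <= n%:R * `|e i| + 1.
  by rewrite /N -natr1 lerD2r truncn_le mulr_ge0.
pose M := (\sum_i N i)%N.
have NM i : (N i <= M)%N by rewrite /M (bigD1 i)//= leq_addr.
pose F (i : 'I_k) : pred 'I_M.+1 := [pred j : 'I_M.+1 | (j < N i)%N].
pose U (f : {ffun 'I_k -> 'I_M.+1}) := [set x | exists2 u : 'I_k -> R,
  (forall i, (f i)%:R <= u i * (N i)%:R <= (f i)%:R + 1) & x = p + \sum_i u i *: e i].
pose s := [seq U f | f <- enum (family F)].
have kn0 : 0 <= k%:R / n%:R :> R by exact: divr_ge0.
apply: (@le_trans _ _ ((size s)%:R * (ball_volume R k * (d%:R * (k%:R / n%:R) / 2) ^+ k))%:E).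
  apply: hausdorff_size_cover; first by rewrite n_delta mulr_ge0.
  (* The parameter [u i = 1] belongs to the last cell, hence the cap at [(N i).-1]. *)
  - move=> x /Ae[u u01 xE]; pose f :=
    [ffun i => inord (minn (Num.trunc (u i * (N i)%:R)) (N i).-1)] : {ffun 'I_k -> 'I_M.+1}.
    have fE i : f i = minn (Num.trunc (u i * (N i)%:R)) (N i).-1 :> nat.
      by rewrite ffunE inordK// ltnS (leq_trans (geq_minr _ _))// (leq_trans (leq_pred _))//.
    exists (U f); first by apply: map_f; rewrite mem_enum; apply/familyP => i;
      rewrite inE fE gtn_min ltnSn orbT.
    exists u => // i; rewrite fE; have /andP[u0 u1] := u01 i.
    have uN0 : 0 <= u i * (N i)%:R by rewrite mulr_ge0// ltW.
    apply/andP; split.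
      by apply: le_trans (_ : (Num.trunc (u i * (N i)%:R))%:R <= _);
        rewrite ?truncn_le// ler_nat geq_minl.
    rewrite natr1; case: (leqP (Num.trunc (u i * (N i)%:R)) (N i).-1) => _;
      first exact/ltW/truncnS_gt.
    by rewrite -[leRHS]mul1r ler_pM2r.
  - move=> _ /mapP[f _ ->]; apply: diameter_le => x y [u uf ->] [v vf ->].
    rewrite lee_fin; apply: le_trans (euclid_le_norm _) _; rewrite ler_wpM2l//.
    rewrite opprD addrACA subrr add0r -sumrB.
    apply: le_trans (ler_norm_sum _ _ _) _.
    apply: (@le_trans _ _ (\sum_(i < k) n%:R^-1)); last first.
      by rewrite sumr_const card_ord -[leLHS]mulr_natl.
    apply: ler_sum => i _; rewrite -scalerBl normrZ.
    have h : `|u i - v i| * (N i)%:R <= 1.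
      have /andP[h1 h2] := uf i; have /andP[h3 h4] := vf i.
      rewrite -[X in _ * X]gtr0_norm// -normrM mulrBl ler_norml.
      by apply/andP; split; lra.
    rewrite -[leRHS]mul1r ler_pdivlMr// -mulrA [_ * n%:R]mulrC.
    apply: le_trans h; rewrite ler_wpM2l//; exact/ltW/Nlt.
rewrite lee_fin size_map -cardE card_family.
have -> : foldr muln 1 [seq #|F x| | x : 'I_k] = (\prod_i N i)%N.
  rewrite -[RHS]big_enum /= /image_mem; elim: (enum _) => [|i l /= ->]; first by rewrite big_nil.
  rewrite big_cons; congr (_ * _)%N.
  have NM1 : (N i <= M.+1)%N by exact: leqW.
  rewrite -[RHS]card_ord -(@fintype.card_image _ _ (widen_ord NM1)); last first.
    by move=> a b /(congr1 val) /= /val_inj.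
  apply: eq_card => j; rewrite [LHS]inE /=; apply/idP/fintype.imageP => [jN|[a _ ->]];
    last by rewrite /= ltn_ord.
  by exists (Ordinal jN) => //; exact: val_inj.
have -> : d%:R * (k%:R / n%:R) / 2 = (d%:R * k%:R / 2) * n%:R^-1 :> R by rewrite mulrA mulrAC.
rewrite exprMn mulrCA -!mulrA ler_wpM2l ?ball_volume_ge0//.
rewrite mulrCA ler_wpM2l ?exprn_ge0 ?mulr_ge0 ?divr_ge0//.
have -> : n%:R^-1 ^+ k = \prod_(i < k) n%:R^-1 :> R by rewrite prodr_const card_ord.
rewrite natr_prod -big_split/=.
apply: ler_prod => i _; rewrite mulr_ge0 ?invr_ge0//= ler_pdivrMr// mulrDl mulrC.
apply: le_trans (Nle i) _; rewrite [_ * `|_|]mulrC lerD2l.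
by rewrite -ler_pdivrMr// mul1r.
Qed.

(** The [i]-th coordinates of a covering set [U j] lie in the interval of radius [D j], its
    diameter, around the coordinate of any chosen point. These intervals cover the one between
    [a 0 i] and [b 0 i], and Lebesgue measure is subadditive. The gauge of [U j] is [D j] and the
    interval has length [2 * D j], hence the factor 2. *)
Lemma coord_dist_le_hausdorff1 (i : 'I_d) (a b : 'rV[R]_d) A : a 0 i != b 0 i ->
  (forall t, 0 <= t <= 1 -> A (a + t *: (b - a))) ->
  (`|b 0 i - a 0 i|%:E <= 2%:E * hausdorff 1 A)%E.
Proof.
move=> ab Aab; pose x0 := Num.min (a 0 i) (b 0 i); pose x1 := Num.max (a 0 i) (b 0 i).
have x01 : x0 < x1 by rewrite /x0 /x1; case: (ltgtP (a 0 i) (b 0 i)) ab.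
have x10 : x1 - x0 = `|b 0 i - a 0 i|.
  rewrite /x0 /x1; case: (ltgtP (a 0 i) (b 0 i)) ab => // h _.
    by rewrite gtr0_norm// subr_gt0.
  by rewrite distrC gtr0_norm// subr_gt0.
apply: (@le_trans _ _ (2%:E * hausdorff_size 1 1 A))%E; last first.
  by apply: lee_wpmul2l; rewrite ?lee_fin//; apply: ereal_sup_ubound; exists 1 => /=.
rewrite muleC -lee_pdivrMr//; apply: le_ereal_inf_tmp => _ [U [Ue AU] <-].
rewrite lee_pdivrMr// muleC -nneseriesZl; last by move=> *; exact: hausdorff_gauge_ge0.
pose D j := fine (diameter (U j)).
pose y j : R := (xget 0 (U j)) 0 i.
pose I j : set R := if `[< U j = set0 >] then set0 else `[y j - D j, y j + D j]%classic.
apply: (@le_trans _ _ (\sum_(0 <= j <oo) lebesgue_measure (I j)))%E; last first.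
  apply: lee_nneseries => j _; first by move=> _; exact: measure_ge0.
  rewrite /I /hausdorff_gauge; case: asboolP => [_|/eqP/set0P U0]; first by rewrite measure0 mule0.
  have D0 : 0 <= D j by exact/fine_ge0/diameter_ge0.
  rewrite lebesgue_measure_itv/= lte_fin; case: ifPn => _.
    rewrite -EFinD -EFinM lee_fin /= expr1 -/(D j); lra.
  by rewrite -EFinM lee_fin /= expr1 -/(D j); lra.
rewrite -x10 -[X in (X <= _)%E](_ : lebesgue_measure `[x0, x1]%classic = _); last first.
  by rewrite lebesgue_measure_itv/= lte_fin x01 -EFinD.
apply: measure_sigma_subadditive.
- move=> j; rewrite /I; case: asboolP => _; first exact: measurable0.
  exact: measurable_itv.
- exact: measurable_itv.
move=> z /=; rewrite in_itv/= => /andP[z0 z1].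
pose t := (z - a 0 i) / (b 0 i - a 0 i).
have ba : b 0 i - a 0 i != 0 by rewrite subr_eq0 eq_sym.
have zE : z = (a + t *: (b - a)) 0 i by rewrite !mxE -mulrA mulVf// mulr1 addrC subrK.
have t01 : 0 <= t <= 1.
  move: z0 z1; rewrite /x0 /x1 /t; case: (ltgtP (a 0 i) (b 0 i)) ab => // h _ z0 z1.
    by rewrite ler_pdivlMr ?subr_gt0// ler_pdivrMr ?subr_gt0// mul0r mul1r subr_ge0 z0 lerD2r.
  by rewrite ler_ndivlMr ?subr_lt0// ler_ndivrMr ?subr_lt0// mul0r mul1r subr_le0 z1 lerD2r.
have [j _ Uj] := AU _ (Aab t t01); exists j => //.
have U0 : U j !=set0 by eexists; exact: Uj.
rewrite /I; case: asboolP => [/eqP|_]; first by move/set0P: U0 => /negbTE ->.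
rewrite /= in_itv/= -ler_distl zE /y.
have -> (u v : 'rV[R]_d) : u 0 i - v 0 i = (u - v) 0 i by rewrite !mxE.
apply: le_trans (normr_coord_le _ _) _; rewrite -lee_fin /D -(diameter_fin U0 (Ue j)).
by apply: euclid_le_diameter => //; apply: xgetPex; exists (a + t *: (b - a)).
Qed.

Lemma norm_le_hausdorff1 (a b : 'rV[R]_d) A :
  (forall t, 0 <= t <= 1 -> A (a + t *: (b - a))) ->
  (`|b - a|%:E <= 2%:E * hausdorff 1 A)%E.
Proof.
move=> Aab; have [->|] := eqVneq `|b - a| 0.
  by rewrite mule_ge0 ?hausdorff_ge0.
move=> ba; have /mx_norm_neq0[[j i]] : mx_norm (b - a) != 0 by [].
rewrite (ord1 j) => /= ij; have : `|b - a| = `|b 0 i - a 0 i|.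
  by rewrite [LHS]ij !mxE.
move=> ->; apply: coord_dist_le_hausdorff1 => //.
apply: contraNneq ba => e; apply/eqP; rewrite [LHS]ij !mxE.
by rewrite e subrr normr0.
Qed.

End HausdorffBounds.

(** * Affine functionals and simplexes *)

Section AffineFunctionals.
Variables (R : realType) (d : nat).
Implicit Types (x y : 'rV[R]_d) (h : 'cV[R]_(1 + d)).

(** With a leading coordinate 1, affine functions become column vectors of size [1 + d], affine
    combinations become matrix products, and affine independence becomes freeness of the rows of
    [vertex_mx]. *)
Definition homog_coord x : 'rV[R]_(1 + d) := row_mx 1%:M x.

Definition aff_eval h x : R := (homog_coord x *m h) 0 0.

Definition vertex_mx n (p : 'I_n -> 'rV[R]_d) : 'M[R]_(n, 1 + d) :=
  \matrix_(i < n) homog_coord (p i).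

Lemma mulmx_vertex_mx n (p : 'I_n -> 'rV[R]_d) (w : 'rV[R]_n) :
  w *m vertex_mx p = row_mx (\sum_i w 0 i)%:M (\sum_i w 0 i *: p i).
Proof.
rewrite mulmx_sum_row; under eq_bigr do rewrite rowK.
apply/rowP => j; rewrite summxE; case: (splitP j) => l jl.
  have -> : j = lshift d l by exact: val_inj.
  rewrite row_mxEl !mxE (ord1 l) eqxx mulr1n.
  by apply: eq_bigr => i _; rewrite mxE row_mxEl mxE eqxx mulr1.
have -> : j = rshift 1 l by exact: val_inj.
rewrite row_mxEr summxE; apply: eq_bigr => i _.
by rewrite mxE [in RHS]mxE row_mxEr.
Qed.

Lemma homog_coord_sum n (p : 'I_n -> 'rV[R]_d) (w : 'I_n -> R) : \sum_i w i = 1 ->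
  homog_coord (\sum_i w i *: p i) = (\row_i w i) *m vertex_mx p.
Proof.
move=> w1; rewrite mulmx_vertex_mx /homog_coord.
by congr row_mx; [rewrite -w1; congr _%:M|]; apply: eq_bigr => i _; rewrite mxE.
Qed.

Lemma aff_evalE h x : aff_eval h x = h (lshift d 0) 0 + \sum_i x 0 i * h (rshift 1 i) 0.
Proof.
rewrite /aff_eval mxE big_split_ord /= big_ord1; congr (_ + _).
  by rewrite row_mxEl mxE eqxx mul1r.
by apply: eq_bigr => i _; rewrite row_mxEr.
Qed.

Lemma aff_eval_sum n (p : 'I_n -> 'rV[R]_d) (w : 'I_n -> R) h : \sum_i w i = 1 ->
  aff_eval h (\sum_i w i *: p i) = \sum_i w i * aff_eval h (p i).
Proof.
move=> w1; rewrite /aff_eval homog_coord_sum// -mulmxA mxE; apply: eq_bigr => i _.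
by rewrite mxE; congr (_ * _); rewrite -[in RHS](rowK (fun i => homog_coord (p i))) -row_mul
  [RHS]mxE.
Qed.

Lemma aff_evalN h x : aff_eval (- h) x = - aff_eval h x.
Proof. by rewrite /aff_eval mulmxN mxE. Qed.

Lemma aff_eval_lin (a b : R) h h' x :
  aff_eval (a *: h + b *: h') x = a * aff_eval h x + b * aff_eval h' x.
Proof. by rewrite /aff_eval mulmxDr -!scalemxAr !mxE. Qed.

Lemma aff_eval_lipschitz h : exists2 C, 0 < C &
  forall x y, `|aff_eval h x - aff_eval h y| <= C * euclid_norm (x - y).
Proof.
exists (1 + \sum_i `|h (rshift 1 i) 0|); first by rewrite ltr_wpDr// sumr_ge0.
move=> x y; rewrite !aff_evalE opprD addrACA subrr add0r -sumrB.
apply: le_trans (ler_norm_sum _ _ _) _; rewrite mulrDl mul1r mulr_suml.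
rewrite -[leLHS]add0r lerD ?euclid_norm_ge0//; apply: ler_sum => i _.
rewrite -mulrBl normrM mulrC ler_wpM2l//.
by apply: le_trans (normr_coord_le _ i); rewrite !mxE.
Qed.

Lemma row_free_vertex_mx n (p : 'I_n -> 'rV[R]_d) : aff_indep p <-> row_free (vertex_mx p).
Proof.
split=> [ip|fp c c0 cp i].
  apply: inj_row_free => v; rewrite mulmx_vertex_mx => v0.
  apply/rowP => i; rewrite mxE; apply: (ip (fun i => v 0 i)).
    by have /(congr1 lsubmx) := v0; rewrite row_mxKl linear0 => /matrixP/(_ 0 0); rewrite !mxE eqxx.
  by have /(congr1 rsubmx) := v0; rewrite row_mxKr linear0.
have : (\row_i c i) *m vertex_mx p = 0.
  rewrite mulmx_vertex_mx; under eq_bigr do rewrite mxE; rewrite c0.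
  by under eq_bigr do rewrite mxE; rewrite cp raddf0 row_mx0.
by rewrite -[RHS](mul0mx 1 (vertex_mx p)) => /(row_free_inj fp)/rowP/(_ i); rewrite !mxE.
Qed.

Lemma hull_vertex n (p : 'I_n -> 'rV[R]_d) i : hull p (p i).
Proof.
exists (fun j => (j == i)%:R); split=> [j||]; first by case: (_ == _).
  by rewrite (bigD1 i)//= eqxx big1 ?addr0// => j /negbTE ->.
by rewrite (bigD1 i)//= eqxx scale1r big1 ?addr0// => j /negbTE ->; rewrite scale0r.
Qed.

Lemma hull_sub n m (p : 'I_n -> 'rV[R]_d) (q : 'I_m -> 'rV[R]_d) :
  (forall i, hull q (p i)) -> hull p `<=` hull q.
Proof.
move=> /choice[W WE] _ [w [w0 w1 ->]].
exists (fun j => \sum_i w i * W i j); split=> [j||].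
- by apply: sumr_ge0 => i _; rewrite mulr_ge0//; case: (WE i).
- rewrite exchange_big /= -[RHS]w1; apply: eq_bigr => i _.
  by rewrite -mulr_sumr; case: (WE i) => _ -> _; rewrite mulr1.
rewrite (eq_bigr (fun i => \sum_j (w i * W i j) *: q j)); last first.
  move=> i _; case: (WE i) => _ _ ->; rewrite scaler_sumr.
  by apply: eq_bigr => j _; rewrite scalerA.
by rewrite exchange_big /=; apply: eq_bigr => j _; rewrite scaler_suml.
Qed.

Lemma aff_eval_hull_ge0 n (p : 'I_n -> 'rV[R]_d) h x :
  (forall i, 0 <= aff_eval h (p i)) -> hull p x -> 0 <= aff_eval h x.
Proof.
move=> hp [w [w0 w1 ->]]; rewrite aff_eval_sum//.
by apply: sumr_ge0 => i _; rewrite mulr_ge0.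
Qed.

Lemma aff_eval_hull_le0 n (p : 'I_n -> 'rV[R]_d) h x :
  (forall i, aff_eval h (p i) <= 0) -> hull p x -> aff_eval h x <= 0.
Proof.
move=> hp px; rewrite -oppr_ge0 -aff_evalN; apply: aff_eval_hull_ge0 px => i.
by rewrite aff_evalN oppr_ge0.
Qed.

Lemma aff_eval_col n (A : 'M[R]_(1 + d, n)) j x : aff_eval (col j A) x = (homog_coord x *m A) 0 j.
Proof. by rewrite /aff_eval [LHS]mxE [RHS]mxE; apply: eq_bigr => i _; rewrite [col _ _ _ _]mxE. Qed.

Lemma aff_eval_col_vertex n m (p : 'I_m -> 'rV[R]_d) (A : 'M[R]_(1 + d, n)) i j :
  aff_eval (col j A) (p i) = (vertex_mx p *m A) i j.
Proof.
by rewrite aff_eval_col [LHS]mxE [RHS]mxE; apply: eq_bigr => l _; rewrite [vertex_mx _ _ _]mxE.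
Qed.

(** The columns of a right inverse of the vertex matrix are the barycentric coordinates, extended to
    affine functions on the whole space. *)
Lemma barycentric n (p : 'I_n -> 'rV[R]_d) : aff_indep p ->
  exists b : 'I_n -> 'cV[R]_(1 + d), forall i j, aff_eval (b i) (p j) = (i == j)%:R.
Proof.
move=> /row_free_vertex_mx/row_freeP[B BE]; exists (fun i => col i B) => i j.
by rewrite aff_eval_col_vertex BE mxE eq_sym.
Qed.

(** The simplex may have lower dimension than the space, so the inequalities for the barycentric
    coordinates are accompanied by the equations of the affine span, the columns of [E], each
    written as two inequalities. *)
Lemma hull_halfspaces n (p : 'I_n -> 'rV[R]_d) : aff_indep p ->
  exists hs : seq 'cV[R]_(1 + d), forall x,
    hull p x <-> (forall h, h \in hs -> 0 <= aff_eval h x).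
Proof.
move=> /row_free_vertex_mx/row_freeP[B BE].
pose E := B *m vertex_mx p - 1%:M.
pose hs := [seq col i B | i <- enum 'I_n] ++ ([seq col j E | j <- enum 'I_(1 + d)] ++
  [seq - col j E | j <- enum 'I_(1 + d)]).
have pB i j : aff_eval (col i B) (p j) = (i == j)%:R.
  by rewrite aff_eval_col_vertex BE mxE eq_sym.
have pE i j : aff_eval (col j E) (p i) = 0.
  by rewrite aff_eval_col_vertex mulmxBr mulmxA BE mul1mx mulmx1 subrr !mxE.
exists hs => x; split=> [xp h|hx].
  rewrite !mem_cat => /or3P[] /mapP[i _ ->]; apply: (aff_eval_hull_ge0 _ xp) => j.
  - by rewrite pB; case: (_ == _).
  - by rewrite pE.
  - by rewrite aff_evalN pE oppr0.
pose w := homog_coord x *m B.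
have wE : homog_coord x = w *m vertex_mx p.
  apply/rowP => j; apply/eqP; rewrite eq_sym -subr_eq0.
  have -> : (w *m vertex_mx p) 0 j - homog_coord x 0 j = aff_eval (col j E) x.
    by rewrite aff_eval_col mulmxBr mulmx1 mulmxA !mxE.
  rewrite eq_le; apply/andP; split.
    rewrite -oppr_ge0 -aff_evalN; apply: hx; rewrite !mem_cat.
    by apply/or3P/Or33/map_f; rewrite mem_enum.
  by apply: hx; rewrite !mem_cat; apply/or3P/Or32/map_f; rewrite mem_enum.
move: wE; rewrite mulmx_vertex_mx => /eq_row_mx[w1 xE].
exists (fun i => w 0 i); split=> //.
  move=> i; have -> : w 0 i = aff_eval (col i B) x by rewrite aff_eval_col.
  by apply: hx; rewrite !mem_cat; apply/or3P/Or31/map_f; rewrite mem_enum.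
by have := congr1 (fun A : 'M[R]_1 => A 0 0) w1; rewrite !mxE eqxx /= !mulr1n => <-.
Qed.

End AffineFunctionals.

(** Adding all columns to the first and subtracting the first row from the others makes the first
    column (1, 0, ..., 0). For a matrix of barycentric weights the remaining block expresses the
    edges of one simplex by those of the other, so the determinant of the weights decides the
    orientation. *)
Lemma det_row_sums1 (R : comNzRingType) k (W : 'M[R]_(1 + k)) :
  (forall i, \sum_j W i j = 1) ->
  \det W = \det (drsubmx W - const_mx 1 *m ursubmx W).
Proof.
move=> W1; have WC : W *m (const_mx 1 : 'cV_(1 + k)) = const_mx 1.
  by apply/colP => i; rewrite !mxE -[RHS](W1 i); apply: eq_bigr => j _; rewrite mxE mulr1.
pose L : 'M[R]_(1 + k) := block_mx 1%:M 0 (- const_mx 1) 1%:M.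
pose U : 'M[R]_(1 + k) := block_mx 1%:M 0 (const_mx 1) 1%:M.
have -> : \det W = \det (L *m (W *m U)).
  by rewrite !det_mulmx !det_lblock !det1 !mulr1 !mul1r.
rewrite -{1}(submxK W) !mulmx_block !mul0mx !mulmx0 !mul1mx !mulmx1 !add0r !addr0.
move: WC; rewrite -{1}(submxK W) -col_mx_const mul_block_col => /eq_col_mx[].
have -> : const_mx 1 = 1%:M :> 'M[R]_1 by apply/matrixP => i j; rewrite !mxE !ord1.
rewrite !mulmx1 => -> ->; rewrite mulmx1 addNr mulNmx [- _ + _]addrC.
by rewrite det_ublock det1 mul1r.
Qed.

Lemma sub_hull_weights (R : realType) d n m (p : 'I_n -> 'rV[R]_d) (q : 'I_m -> 'rV[R]_d) :
  hull p `<=` hull q ->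
  exists W : 'M[R]_(n, m), [/\ forall i j, 0 <= W i j, forall i, \sum_j W i j = 1 &
    forall i, p i = \sum_j W i j *: q j].
Proof.
move=> pq; have /choice[W WE] : forall i, exists w : 'I_m -> R,
    [/\ forall i, 0 <= w i, \sum_i w i = 1 & p i = \sum_i w i *: q i].
  by move=> i; exact/pq/hull_vertex.
exists (\matrix_(i, j) W i j); split=> [i j|i|i].
- by rewrite mxE; case: (WE i).
- by case: (WE i) => _ <- _; apply: eq_bigr => j _; rewrite mxE.
- by case: (WE i) => _ _ ->; apply: eq_bigr => j _; rewrite mxE.
Qed.

Lemma vertex_mx_weights (R : realType) d n m (p : 'I_n -> 'rV[R]_d) (q : 'I_m -> 'rV[R]_d)
    (W : 'M[R]_(n, m)) : (forall i, \sum_j W i j = 1) ->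
  (forall i, p i = \sum_j W i j *: q j) -> vertex_mx p = W *m vertex_mx q.
Proof.
move=> W1 pE; apply/row_matrixP => i; rewrite rowK row_mul pE homog_coord_sum//.
Qed.

Lemma aff_eval_vertex_mx (R : realType) d n (p : 'I_n -> 'rV[R]_d) h i :
  aff_eval h (p i) = (vertex_mx p *m h) i 0.
Proof. by rewrite -aff_eval_col_vertex col_id. Qed.

Lemma barycentric_recenter (R : realType) d n (p : 'I_n.+1 -> 'rV[R]_d) (w : 'I_n.+1 -> R) i :
  \sum_j w j = 1 ->
  \sum_j w j *: p j = p i + \sum_j w (lift i j) *: (p (lift i j) - p i).
Proof.
move=> w1; under [in RHS]eq_bigr do rewrite scalerBr.
rewrite sumrB addrCA addrC (bigD1_ord i)//=; congr (_ + _).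
by rewrite -scaler_suml -[X in X - _]scale1r -scalerBl -w1 (bigD1_ord i)//= addrK.
Qed.

Section Simplexes.
Variables (R : realType) (d : nat) (K : set 'rV[R]_d).

Lemma simplex_indep k (s : simplex K k) : aff_indep s.
Proof. by case: s => s /= /asboolP[]. Qed.

Lemma simplex_sub k (s : simplex K k) : hull s `<=` K.
Proof. by case: s => s /= /asboolP[]. Qed.

Lemma edges_weights k (s t : simplex K k) (W : 'M[R]_k.+1) :
  (forall i, \sum_j W i j = 1) -> (forall i, s i = \sum_j W i j *: t j) ->
  exists2 A : 'M[R]_k, edges s = A *m edges t & \det A = \det W.
Proof.
move=> W1 sE; exists (drsubmx (W : 'M[R]_(1 + k)) - const_mx 1 *m ursubmx (W : 'M[R]_(1 + k))).
  have rl (i : 'I_k) : rshift 1 i = lift ord0 i by exact: val_inj.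
  have l0 : lshift k (0 : 'I_1) = ord0 by exact: val_inj.
  have AE i j : (drsubmx (W : 'M[R]_(1 + k)) - const_mx 1 *m ursubmx (W : 'M[R]_(1 + k))) i j =
      W (lift ord0 i) (lift ord0 j) - W ord0 (lift ord0 j).
    by rewrite !mxE big_ord1 !mxE mul1r !rl l0.
  apply/row_matrixP => i; rewrite rowK row_mul mulmx_sum_row.
  under eq_bigr do rewrite rowK mxE AE.
  rewrite !sE -sumrB; under [LHS]eq_bigr do rewrite -scalerBl.
  rewrite big_ord_recl /=.
  under [in RHS]eq_bigr do rewrite scalerBr.
  rewrite sumrB addrC; congr (_ + _); rewrite -scaler_suml -scaleNr; congr (_ *: _).
  apply/eqP; rewrite -addr_eq0.
  have := W1 (lift ord0 i); rewrite -(W1 ord0) => /eqP; rewrite -subr_eq0 -sumrB.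
  by rewrite big_ord_recl.
by rewrite -det_row_sums1.
Qed.

Lemma sub_simplex_weights k (s t : simplex K k) : hull s `<=` hull t ->
  exists W : 'M[R]_k.+1, [/\ forall i j, 0 <= W i j, forall i, \sum_j W i j = 1,
    forall i, s i = \sum_j W i j *: t j & W \in unitmx].
Proof.
move=> /sub_hull_weights[W [W0 W1 sE]]; exists W; split=> //.
have /row_free_vertex_mx := @simplex_indep _ s.
rewrite (vertex_mx_weights W1 sE) -row_free_unit /row_free => /eqP sr.
by rewrite eqn_leq rank_leq_row /= -{1}sr mxrankM_maxl.
Qed.

Lemma simplex_of_weights k (t : simplex K k) (W : 'M[R]_k.+1) :
  (forall i j, 0 <= W i j) -> (forall i, \sum_j W i j = 1) -> W \in unitmx ->
  exists2 s : simplex K k, forall i, s i = \sum_j W i j *: t j & hull s `<=` hull t.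
Proof.
move=> W0 W1 Wu; pose p := [ffun i => \sum_j W i j *: t j].
have pE i : p i = \sum_j W i j *: t j by rewrite ffunE.
have pt : hull p `<=` hull t by apply: hull_sub => i; exists (W i).
have ps : `[< aff_indep p /\ hull p `<=` K >].
  apply/asboolP; split; last exact: subset_trans (@simplex_sub _ t).
  apply/row_free_vertex_mx; rewrite (vertex_mx_weights W1 pE) /row_free.
  rewrite mxrankMfree; last exact/row_free_vertex_mx/simplex_indep.
  by rewrite -[_ == _]/(row_free W) row_free_unit.
by exists (Simplex ps).
Qed.

(** The matrix of weights is invertible: simplexes of equal dimension, one inside the other, have
    the same affine span. *)
Lemma aff_eval_sub_eq0 k (s t : simplex K k) h : hull s `<=` hull t ->
  (forall i, aff_eval h (s i) = 0) -> forall i, aff_eval h (t i) = 0.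
Proof.
move=> /sub_simplex_weights[W [_ W1 sE Wu]] s0 i.
rewrite aff_eval_vertex_mx; have : W *m (vertex_mx t *m h) = 0.
  rewrite mulmxA -(vertex_mx_weights W1 sE); apply/colP => j.
  by rewrite -aff_eval_vertex_mx s0 mxE.
by move/(congr1 (mulmx (invmx W))); rewrite mulKmx// mulmx0 => ->; rewrite mxE.
Qed.

Lemma same_orientation_trans k (s t u : simplex K k) :
  same_orientation s t -> same_orientation t u -> same_orientation s u.
Proof.
move=> [A stE A0] [B tuE B0]; exists (A *m B); first by rewrite stE tuE mulmxA.
by rewrite det_mulmx mulr_gt0.
Qed.

Lemma same_orientation_refl k (s : simplex K k) : same_orientation s s.
Proof. by exists 1%:M; rewrite ?mul1mx// det1. Qed.

(** A hyperplane with the two simplexes on different sides; one of them may lie inside it, but not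
    both. Unlike a null intersection, this is inherited by subsimplexes of the same dimension
    through a purely linear argument. *)
Definition weakly_separated k (s t : simplex K k) : Prop := exists h : 'cV[R]_(1 + d),
  [/\ forall i, 0 <= aff_eval h (s i), forall i, aff_eval h (t i) <= 0 &
   (exists i, aff_eval h (s i) != 0) \/ (exists i, aff_eval h (t i) != 0)].

Lemma separated_sym k (s t : simplex K k) : weakly_separated s t -> weakly_separated t s.
Proof.
move=> [h [hs ht hn]]; exists (- h); split=> [i|i|].
- by rewrite aff_evalN oppr_ge0.
- by rewrite aff_evalN oppr_le0.
- by case: hn => -[i hi]; [right|left]; exists i; rewrite aff_evalN oppr_eq0.
Qed.

Lemma separated_sub k (s t s' t' : simplex K k) :
  hull s' `<=` hull s -> hull t' `<=` hull t -> weakly_separated s t -> weakly_separated s' t'.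
Proof.
move=> ss tt [h [hs ht hn]]; exists h; split=> [i|i|].
- exact: aff_eval_hull_ge0 hs (ss _ (hull_vertex _ _)).
- exact: aff_eval_hull_le0 ht (tt _ (hull_vertex _ _)).
- case: hn => -[i /eqP hi]; [left|right]; apply: contrapT => /forallNP n; apply: hi.
    by apply: (aff_eval_sub_eq0 ss) => j; apply/eqP; apply: contrapT => /negP; exact: n.
  by apply: (aff_eval_sub_eq0 tt) => j; apply/eqP; apply: contrapT => /negP; exact: n.
Qed.

Lemma hausdorff_simplex_lty k (s : simplex K k) : (hausdorff k (hull s) < +oo)%E.
Proof.
apply: le_lt_trans (hausdorff_box (p := s ord0) (e := fun j => s (lift ord0 j) - s ord0) ltr01 _)
  (ltry _).
move=> _ [w [w0 w1 ->]]; exists (fun j => w (lift ord0 j)).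
  move=> j; rewrite w0/= -w1 (bigD1 (lift ord0 j))//= lerDl; exact: sumr_ge0.
by rewrite -barycentric_recenter.
Qed.

(** The set lies in a parallelepiped one of whose edges, the one towards the vertex [i0], is
    replaced by 0. The bound of [hausdorff_box] is then proportional to [eta], which tends to 0. *)
Lemma hausdorff_face_eq0 k (s : simplex K k.+1) (i0 : 'I_k.+2) (A : set 'rV[R]_d) :
  (forall x, A x -> exists w : 'I_k.+2 -> R,
     [/\ forall i, 0 <= w i, \sum_i w i = 1, x = \sum_i w i *: s i & w i0 = 0]) ->
  hausdorff k.+1 A = 0%E.
Proof.
move=> Aw; apply/eqP; rewrite eq_le hausdorff_ge0 andbT.
pose i1 := lift i0 ord0; pose e (j : 'I_k.+1) :=
  if lift i1 j == i0 then 0 else s (lift i1 j) - s i1.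
have [j0 ij0] : exists j0, lift i1 j0 = i0.
  have /unlift_some[j jE _] : i1 != i0 by rewrite eq_sym neq_lift.
  by exists j.
pose C := ball_volume R k.+1 * (d%:R * k.+1%:R / 2) ^+ k.+1 * \prod_(j | j != j0) (`|e j| + 1).
have C0 : 0 <= C.
  apply: mulr_ge0.
    apply: mulr_ge0; first exact: ball_volume_ge0.
    by rewrite exprn_ge0// divr_ge0// mulr_ge0.
  by apply: prodr_ge0 => j _; rewrite addr_ge0.
have H (eta : R) : 0 < eta -> eta <= 1 -> (hausdorff k.+1 A <= (C * eta)%:E)%E.
  move=> eta0 eta1; apply: le_trans (hausdorff_box (p := s i1) (e := e) eta0 _) _.
    move=> x /Aw[w [w0 w1 xE wi0]]; exists (fun j => w (lift i1 j)).
      move=> j; rewrite w0/= -w1 (bigD1 (lift i1 j))//= lerDl; exact: sumr_ge0.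
    have -> : \sum_j w (lift i1 j) *: e j = \sum_j w (lift i1 j) *: (s (lift i1 j) - s i1).
      apply: eq_bigr => j _; rewrite /e; case: eqP => // ->.
      by rewrite wi0 !scale0r.
    by rewrite -barycentric_recenter.
  rewrite lee_fin /C -[leRHS]mulrA ler_wpM2l//.
    apply: mulr_ge0; first exact: ball_volume_ge0.
    by rewrite exprn_ge0// divr_ge0// mulr_ge0.
  rewrite (bigD1 j0)//= {1}/e ij0 eqxx normr0 add0r mulrC ler_wpM2r ?(ltW eta0)//.
  by apply: ler_prod => j _; rewrite addr_ge0 ?(ltW eta0)//= lerD2l.
apply/lee_addgt0Pr => g g0; rewrite add0e.
have C1 : 0 < C + 1 by rewrite ltr_wpDl.
apply: le_trans (H (Num.min 1 (g / (C + 1))) _ _) _.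
- by rewrite lt_min ltr01 divr_gt0.
- by rewrite ge_min lexx.
- rewrite lee_fin; apply: (@le_trans _ _ (C * (g / (C + 1)))).
    by rewrite ler_wpM2l// ge_min lexx orbT.
  by rewrite mulrCA ler_piMr// ?(ltW g0)// ler_pdivrMr// mul1r lerDl.
Qed.

(** The intersection lies on the hyperplane, where points of [s] have weight 0 at each vertex of [s]
    off the hyperplane; so it lies in a proper face. The two simplexes are exchanged if only [t] has
    such a vertex. *)
Lemma separated_null k (s t : simplex K k.+1) : weakly_separated s t ->
  hausdorff k.+1 (hull s `&` hull t) = 0%E.
Proof.
wlog : s t / exists h : 'cV[R]_(1 + d), [/\ forall i, 0 <= aff_eval h (s i),
    forall i, aff_eval h (t i) <= 0 & exists i, aff_eval h (s i) != 0].
  move=> wl st; have [h [h1 h2 [h3|h3]]] := st; first by apply: wl => //; exists h.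
  rewrite setIC; apply: wl; last exact: separated_sym.
  exists (- h); split=> [i|i|]; rewrite ?aff_evalN ?oppr_ge0 ?oppr_le0//.
  by case: h3 => i hi; exists i; rewrite aff_evalN oppr_eq0.
move=> [h [hs ht [i0 hi0]]] _.
apply: (@hausdorff_face_eq0 _ s i0) => x [[w [w0 w1 xE]] tx]; exists w; split=> //.
have := aff_eval_hull_le0 ht tx; rewrite xE aff_eval_sum// => le0.
have : w i0 * aff_eval h (s i0) <= 0.
  apply: le_trans le0; rewrite (bigD1 i0)//= lerDl.
  by apply: sumr_ge0 => i _; rewrite mulr_ge0.
rewrite pmulr_lle0; last by rewrite lt_neqAle eq_sym hi0 hs.
by move=> wi0; apply/eqP; rewrite eq_le wi0 w0.
Qed.

End Simplexes.

(** Bernoulli's inequality [1 - l ^+ n <= n%:R * (1 - l)] makes the limit as [l] tends to 1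
    explicit. *)
Lemma ler_of_exprn_mul (R : realType) n (s a : R) : 0 <= s ->
  (forall l : R, 0 < l < 1 -> l ^+ n * s <= a) -> s <= a.
Proof.
move=> s0 H; apply/ler_addgt0Pr => e e0.
have bern (l : R) : 0 < l < 1 -> 1 - l ^+ n <= n%:R * (1 - l).
  move=> /andP[l0 l1]; elim: n {H} => [|n ih]; first by rewrite expr0 subrr mul0r.
  have ln : l ^+ n <= 1 by rewrite exprn_ile1// ltW.
  rewrite exprS -natr1 mulrDl mul1r; have : (1 - l) * (1 - l ^+ n) >= 0.
    by rewrite mulr_ge0// subr_ge0// ltW.
  lra.
have sn1 : 0 < s * n%:R + 1 by rewrite ltr_wpDl// mulr_ge0.
pose eta := Num.min 2^-1 (e / (s * n%:R + 1)).
have eta0 : 0 < eta by rewrite lt_min invr_gt0 ltr0n/= divr_gt0.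
have eta2 : eta <= 2^-1 by rewrite ge_min lexx.
have l01 : 0 < 1 - eta < 1 by apply/andP; split; lra.
have := H _ l01; have := bern _ l01; rewrite opprB addrCA subrr addr0 => h1 h2.
have h3 : s * (1 - (1 - eta) ^+ n) <= s * (n%:R * eta) by rewrite ler_wpM2l.
have h4 : s * (n%:R * eta) <= e.
  apply: (@le_trans _ _ ((s * n%:R + 1) * eta)); first by rewrite mulrA ler_wpM2r ?lerDl// ltW.
  by rewrite mulrC -ler_pdivlMr// ge_min lexx orbT.
lra.
Qed.

Lemma aff_eval_conv (R : realType) d h (c z : 'rV[R]_d) (l : R) :
  aff_eval h (c + l *: (z - c)) = (1 - l) * aff_eval h c + l * aff_eval h z.
Proof.
rewrite /aff_eval.
have -> : homog_coord (c + l *: (z - c)) = (1 - l) *: homog_coord c + l *: homog_coord z.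
  rewrite /homog_coord !scale_row_mx add_row_mx -scalerDl subrK scale1r; congr row_mx.
  by rewrite scalerBr scalerBl scale1r addrA addrAC.
by rewrite mulmxDl -!scalemxAl [LHS]mxE; congr (_ + _); rewrite [LHS]mxE.
Qed.

Lemma pos_dist_sym (R : realType) d (A B : set 'rV[R]_d) : pos_dist A B -> pos_dist B A.
Proof.
move=> [e e0 AB]; exists e => // x y Bx Ay.
by rewrite -opprB -scaleN1r euclid_normZ normrN1 mul1r; exact: AB.
Qed.

(** * Common refinements *)

Section Refinement.
Variables (R : realType) (d : nat) (K : set 'rV[R]_d).

Definition barycenter k (x : simplex K k) : 'rV[R]_d := \sum_i k.+1%:R^-1 *: x i.

Definition shrink k (l : R) (x : simplex K k) : set 'rV[R]_d :=
  [set barycenter x + l *: (z - barycenter x) | z in hull x].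

Lemma sum_barycenter_weights k : \sum_(i < k.+1) k.+1%:R^-1 = 1 :> R.
Proof. by rewrite sumr_const card_ord -[LHS]mulr_natl mulfV. Qed.

Lemma shrink_sub k (l : R) (x : simplex K k) : 0 < l < 1 -> shrink l x `<=` hull x.
Proof.
move=> /andP[l0 l1] _ [_ [w [w0 w1 ->]] <-].
exists (fun i => (1 - l) * k.+1%:R^-1 + l * w i); split=> [i||].
- by rewrite addr_ge0// mulr_ge0 ?invr_ge0 ?subr_ge0 ?(ltW l0) ?(ltW l1).
- by rewrite big_split /= -!mulr_sumr sum_barycenter_weights w1 !mulr1 subrK.
- under [RHS]eq_bigr do rewrite scalerDl -!scalerA.
  by rewrite big_split /= -scaler_sumr -[X in _ = _ + X]scaler_sumr scalerBr scalerBl scale1r addrA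
    addrAC.
Qed.

(** A function that is nonnegative at the vertices and positive at one of them is positive at the
    barycenter. On the shrunk copy it is then at least [1 - l] times that value, while it is
    nonpositive on the other simplex; being Lipschitz, it forces a gap. *)
Lemma separated_shrink k (l : R) (x y : simplex K k) : 0 < l < 1 ->
  weakly_separated x y -> pos_dist (shrink l x) (shrink l y).
Proof.
move=> l01; have h u v : (exists h : 'cV[R]_(1 + d),
    [/\ forall i, 0 <= aff_eval h ((u : simplex K k) i),
        forall i, aff_eval h ((v : simplex K k) i) <= 0 &
        exists i, aff_eval h (u i) != 0]) -> pos_dist (shrink l u) (shrink l v).
  move=> [h [hu hv [i0 hi0]]]; have [C C0 hC] := aff_eval_lipschitz h.
  have /andP[l0 l1] := l01.
  have m0 : 0 < aff_eval h (barycenter u).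
    rewrite aff_eval_sum ?sum_barycenter_weights// (bigD1 i0)//=.
    rewrite ltr_wpDr//; first by apply: sumr_ge0 => i _; rewrite mulr_ge0 ?invr_ge0.
    by rewrite mulr_gt0 ?invr_gt0 ?ltr0n// lt_neqAle eq_sym hi0 hu.
  exists (C^-1 * ((1 - l) * aff_eval h (barycenter u))).
    by rewrite mulr_gt0 ?invr_gt0// mulr_gt0// subr_gt0.
  move=> a b [z uz <-] /(shrink_sub l01) vb; rewrite ler_pdivrMl//.
  apply: le_trans (hC _ _); apply: le_trans (ler_norm _).
  have hb := aff_eval_hull_le0 hv vb; have hz := aff_eval_hull_ge0 hu uz.
  rewrite aff_eval_conv -addrA lerDl; have : 0 <= l * aff_eval h z by rewrite mulr_ge0// ltW.
  lra.
move=> xy; have [g [gx gy [gn|gn]]] := xy; first by apply: h; exists g.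
apply/pos_dist_sym/h; exists (- g); split=> [i|i|].
- by rewrite aff_evalN oppr_ge0.
- by rewrite aff_evalN oppr_le0.
- by case: gn => i gi; exists i; rewrite aff_evalN oppr_eq0.
Qed.

(** Separated simplexes may touch, so additivity at positive distance is applied to their shrunk
    copies, whose measures are at least [l ^+ k.+1] times the original ones; then [l] tends to 1. No
    measurability of the hulls enters. *)
Lemma hausdorff_sum_separated k (xs : seq (simplex K k.+1)) (A : set 'rV[R]_d) :
  (forall x, x \in xs -> hull x `<=` A) ->
  pairwise (fun x y => `[< weakly_separated x y >]) xs ->
  (\sum_(x <- xs) hausdorff k.+1 (hull x) <= hausdorff k.+1 A)%E.
Proof.
move=> xsA pxs; pose s := \sum_(x <- xs) fine (hausdorff k.+1 (hull x)).
have sE : (\sum_(x <- xs) hausdorff k.+1 (hull x) = s%:E)%E.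
  rewrite -sumEFin; apply: eq_bigr => x _; rewrite fineK// ge0_fin_numE ?hausdorff_ge0//.
  exact: hausdorff_simplex_lty.
have s0 : 0 <= s by rewrite -lee_fin -sE; apply: sume_ge0 => x _; exact: hausdorff_ge0.
rewrite sE; have [->|Afin] := eqVneq (hausdorff k.+1 A) +oo%E; first exact: leey.
have AE : hausdorff k.+1 A = (fine (hausdorff k.+1 A))%:E.
  by rewrite fineK// ge0_fin_numE ?hausdorff_ge0// lt_neqAle Afin leey.
rewrite AE lee_fin; apply: (@ler_of_exprn_mul _ k.+1) => // l l01.
have /andP[l0 l1] := l01.
rewrite -lee_fin -AE EFinM -sE ge0_sume_distrr; last by move=> x _; exact: hausdorff_ge0.
apply: (@le_trans _ _ (\sum_(x <- xs) hausdorff k.+1 (shrink l x))%E).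
  by apply: lee_sum => x _; exact: hausdorff_contract.
apply: (@hausdorff_sum_pos_dist _ _ k _ (fun x : simplex K k.+1 => shrink l x)).
  by move=> x xs'; apply: subset_trans (shrink_sub l01) (xsA _ xs').
apply: sub_pairwise pxs => x y /asboolP xy; exact/asboolP/separated_shrink.
Qed.

(** A [subdivision] whose pieces are separated instead of merely having null intersections, so that
    the pieces can be cut again. *)
Definition refines k (t : simplex K k) (xs : seq (simplex K k)) : Prop :=
  [/\ hull t = \bigcup_(x in [set x | x \in xs]) hull x,
      forall x, x \in xs -> same_orientation x t &
      pairwise (fun x y => `[< weakly_separated x y >]) xs].

Lemma refines_hull_sub k (t : simplex K k) xs x : refines t xs -> x \in xs -> hull x `<=` hull t.
Proof. by move=> [-> _ _] xs' z xz; exists x. Qed.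

Lemma refines_refl k (t : simplex K k) : refines t [:: t].
Proof.
split=> //; last by move=> x; rewrite inE => /eqP ->; exact: same_orientation_refl.
apply/seteqP; split=> [z tz|z [x /=]]; first by exists t => //=; rewrite inE.
by rewrite inE => /eqP ->.
Qed.

Lemma pairwise_separated_flatten k (xs : seq (simplex K k)) f :
  pairwise (fun x y => `[< weakly_separated x y >]) xs ->
  (forall x, x \in xs -> refines x (f x)) ->
  pairwise (fun x y => `[< weakly_separated x y >]) (flatten [seq f x | x <- xs]).
Proof.
elim: xs => //= x xs ih /andP[/allP xxs /ih{}ih] h; rewrite pairwise_cat; apply/and3P; split.
- apply/allrelP => y z yx /flatten_mapP[w wxs zw]; apply/asboolP.
  apply: (@separated_sub _ _ _ _ x w); last exact/asboolP/xxs.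
    by apply: refines_hull_sub yx; apply: h; rewrite mem_head.
  by apply: refines_hull_sub zw; apply: h; rewrite inE wxs orbT.
- by case: (h x (mem_head _ _)).
- by apply: ih => y yxs; apply: h; rewrite inE yxs orbT.
Qed.

Lemma refines_flatten k (t : simplex K k) xs f : refines t xs ->
  (forall x, x \in xs -> refines x (f x)) -> refines t (flatten [seq f x | x <- xs]).
Proof.
move=> [tE to tp] h; split.
- rewrite tE; apply/seteqP; split=> z.
    move=> [x /= xs' xz]; have [fx _ _] := h _ xs'; move: xz; rewrite fx => -[y /= yx yz].
    by exists y => //=; apply/flatten_mapP; exists x.
  move=> [y /= /flatten_mapP[x xs' yx] yz]; exists x => //=.
  exact: (refines_hull_sub (h _ xs') yx).
- move=> y /flatten_mapP[x xs' yx]; apply: same_orientation_trans (to _ xs').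
  by case: (h _ xs') => _ + _; apply.
- exact: pairwise_separated_flatten.
Qed.

Lemma det_replace_row n (j : 'I_n) (r : 'I_n -> R) :
  \det (\matrix_(a, b) (if a == j then r b else (a == b)%:R)) = r j.
Proof.
set W := \matrix_(a, b) _; rewrite (expand_det_row _ j).
have WE b : W j b * cofactor W j b = r b * (b == j)%:R.
  rewrite {1}/W mxE eqxx; congr (_ * _).
  have -> : cofactor W j b = cofactor 1%:M j b.
    rewrite /cofactor; congr (_ * \det _); apply/matrixP => a c; rewrite !mxE.
    by rewrite [_ == j]eq_sym (negbTE (neq_lift _ _)).
  have := congr1 (fun A : 'M[R]_n => A b j) (adj1 R n).
  by rewrite mxE mxE.
by rewrite (bigD1 j)//= WE eqxx mulr1 big1 ?addr0// => b /negbTE bj; rewrite WE bj mulr0.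
Qed.

Lemma move_vertex k (t : simplex K k) j (r : 'I_k.+1 -> R) :
  (forall l, 0 <= r l) -> \sum_l r l = 1 -> 0 < r j ->
  exists s : simplex K k, [/\ s j = \sum_l r l *: t l, forall l, l != j -> s l = t l,
    hull s `<=` hull t & same_orientation s t].
Proof.
move=> r0 r1 rj; pose W : 'M[R]_k.+1 := \matrix_(a, b) (if a == j then r b else (a == b)%:R).
have W1 i : \sum_j W i j = 1.
  under eq_bigr do rewrite mxE; case: eqP => // _.
  rewrite (bigD1 i)//= eqxx big1 ?addr0// => l; rewrite eq_sym => /negbTE -> //.
have Wdet : \det W = r j by exact: det_replace_row.
have [|||s sE st] := @simplex_of_weights _ _ _ k t W.
- by move=> a b; rewrite mxE; case: eqP => // _; exact: ler0n.
- by [].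
- by rewrite unitmxE Wdet unitfE gt_eqF.
exists s; split=> //.
- by rewrite sE; apply: eq_bigr => l _; rewrite mxE eqxx.
- move=> l /negbTE lj; rewrite sE (bigD1 l)//= big1 ?addr0 ?mxE ?lj ?eqxx ?scale1r//.
  by move=> b; rewrite mxE lj eq_sym => /negbTE ->; rewrite scale0r.
- by have [A sA Adet] := edges_weights W1 sE; exists A => //; rewrite Adet Wdet.
Qed.

(** Eliminating [p j] in favour of [q j] puts the weight [w j / b] on [q j] and leaves
    [w i - w j * a / b] on [p i], which is nonnegative in this half. *)
Lemma hull_bisect_half n (p q : 'I_n -> 'rV[R]_d) i j (a b : R) (w : 'I_n -> R) :
  i != j -> 0 < a -> 0 < b -> a + b = 1 ->
  q j = a *: p i + b *: p j -> (forall l, l != j -> q l = p l) ->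
  (forall l, 0 <= w l) -> \sum_l w l = 1 -> w j * a <= w i * b ->
  hull q (\sum_l w l *: p l).
Proof.
move=> ij a0 b0 ab qj ql w0 w1 wij; have ji : j != i by rewrite eq_sym.
exists (fun l => if l == j then w j / b else if l == i then w i - w j * a / b else w l); split.
- move=> l; case: eqP => [_|_]; first by rewrite divr_ge0// ltW.
  by case: eqP => // _; rewrite subr_ge0 ler_pdivrMr.
- rewrite -[RHS]w1 (bigD1 j)//= (bigD1 i)//= [RHS](bigD1 j)//= [in RHS](bigD1 i)//=.
  rewrite !eqxx (negbTE ij) !addrA; congr (_ + _); last first.
    by apply: eq_bigr => l /andP[/negbTE -> /negbTE ->].
  have -> : a = 1 - b by lra.
  by field; rewrite gt_eqF.
- rewrite (bigD1 j)//= (bigD1 i)//= [RHS](bigD1 j)//= [in RHS](bigD1 i)//=.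
  rewrite !eqxx (negbTE ij) !addrA; congr (_ + _); last first.
    by apply: eq_bigr => l /andP[lj /negbTE ->]; rewrite (negbTE lj) ql.
  rewrite qj ql// scalerDr !scalerA scalerBl addrAC.
  rewrite divfK ?gt_eqF// [w j / b * a]mulrAC addrAC [X in _ = X + _]addrC.
  by rewrite -addrA; congr (_ + _); rewrite addrCA subrr addr0.
Qed.

Lemma bisect k (t : simplex K k) i j (a b : R) : i != j -> 0 < a -> 0 < b -> a + b = 1 ->
  exists s1 s2 : simplex K k, [/\ s1 j = a *: t i + b *: t j, forall l, l != j -> s1 l = t l,
    s2 i = a *: t i + b *: t j, forall l, l != i -> s2 l = t l &
    refines t [:: s1; s2]].
Proof.
move=> ij a0 b0 ab; have ji : j != i by rewrite eq_sym.
pose r l : R := if l == i then a else if l == j then b else 0.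
have rt (V : lmodType R) (f : 'I_k.+1 -> V) : \sum_l r l *: f l = a *: f i + b *: f j.
  rewrite (bigD1 i)//= (bigD1 j)//= /r !eqxx (negbTE ji) big1 ?addr0//
    => l /andP[/negbTE -> /negbTE ->].
  by rewrite scale0r.
have r0 l : 0 <= r l by rewrite /r; case: eqP => _; [exact: ltW|case: eqP => // _; exact: ltW].
have r1 : \sum_l r l = 1.
  transitivity (\sum_l r l *: (1 : R^o)); first by apply: eq_bigr => l _; exact/esym/mulr1.
  by rewrite rt -[RHS]ab; congr (_ + _); exact: mulr1.
have ri : r i = a by rewrite /r eqxx.
have rj : r j = b by rewrite /r eqxx (negbTE ji).
have [|s1 [s1j s1l s1t s1o]] := move_vertex t (j := j) r0 r1; first by rewrite rj.
have [|s2 [s2i s2l s2t s2o]] := move_vertex t (j := i) r0 r1; first by rewrite ri.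
rewrite rt in s1j; rewrite rt in s2i.
exists s1, s2; split=> //; split.
- apply/seteqP; split=> z.
    move=> [w [w0 w1 ->]]; case: (lerP (w j * a) (w i * b)) => wij.
      exists s1; first by rewrite /= mem_head.
      exact: (hull_bisect_half ij a0 b0 ab s1j s1l w0 w1 wij).
    exists s2; first by rewrite /= !inE eqxx orbT.
    by apply: (hull_bisect_half ji b0 a0 _ _ s2l w0 w1 (ltW wij)); rewrite addrC.
  by move=> [x /=]; rewrite !inE => /orP[] /eqP ->; [exact: s1t|exact: s2t].
- by move=> x; rewrite !inE => /orP[] /eqP ->.
rewrite /= !andbT; apply/asboolP.
have [c cE] := barycentric (@simplex_indep _ _ _ _ t).
have ab1 : \sum_(l : bool) (if l then a else b) = 1 by rewrite big_bool.
(* [h] is [b] at [t i], [- a] at [t j] and 0 at the other vertices, so it vanishes at the cut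
   point. *)
pose h := b *: c i + (- a) *: c j.
have hE l : aff_eval h (t l) = b * (i == l)%:R - a * (j == l)%:R.
  by rewrite aff_eval_lin !cE mulNr.
have hm : aff_eval h (a *: t i + b *: t j) = 0.
  rewrite -rt aff_eval_sum//; have := rt R^o (fun l => aff_eval h (t l)) => ->.
  rewrite !hE !eqxx (negbTE ij) (negbTE ji) /GRing.scale /=; ring.
exists h; split.
- move=> l; have [->|lj] := eqVneq l j; first by rewrite s1j hm.
  rewrite s1l// hE [j == l]eq_sym (negbTE lj) mulr0 subr0 mulr_ge0 ?(ltW b0)//.
- move=> l; have [->|li] := eqVneq l i; first by rewrite s2i hm.
  rewrite s2l// hE [i == l]eq_sym (negbTE li) mulr0 sub0r oppr_le0 mulr_ge0 ?(ltW a0)//.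
- left; exists i; rewrite s1l// hE eqxx (negbTE ji) mulr0 subr0 mulr1.
  by rewrite gt_eqF.
Qed.

End Refinement.

(** * Cutting simplexes by hyperplanes *)

Section Cuts.
Variables (R : realType) (d : nat) (K : set 'rV[R]_d).

Definition one_sided k (h : 'cV[R]_(1 + d)) (x : simplex K k) : Prop :=
  (forall i, 0 <= aff_eval h (x i)) \/ (forall i, aff_eval h (x i) <= 0).

Lemma one_sided_sub k h (x y : simplex K k) : hull y `<=` hull x ->
  one_sided h x -> one_sided h y.
Proof.
move=> yx [hx|hx]; [left|right] => i.
  exact: aff_eval_hull_ge0 hx (yx _ (hull_vertex _ _)).
exact: aff_eval_hull_le0 hx (yx _ (hull_vertex _ _)).
Qed.

(** Induction on the number of vertices off the hyperplane: an edge between vertices of opposite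
    signs is bisected where it crosses the hyperplane, and each half has fewer such vertices. *)
Lemma cut_hyperplane k h (t : simplex K k) :
  exists xs, refines t xs /\ forall x, x \in xs -> one_sided h x.
Proof.
have [n] := ubnP #|[pred i | aff_eval h (t i) != 0]|; elim: n t => // n ih t; rewrite ltnS => tn.
have [ht|nht] := pselect (one_sided h t).
  by exists [:: t]; split=> [|x]; [exact: refines_refl|rewrite inE => /eqP ->].
have [j hj] : exists j, aff_eval h (t j) < 0.
  apply: contrapT => /forallNP n0; apply: nht; left => i; rewrite leNgt; exact/negP.
have [i hi] : exists i, 0 < aff_eval h (t i).
  apply: contrapT => /forallNP n0; apply: nht; right => i; rewrite leNgt; exact/negP.
have ij : i != j by apply: contraTneq hi => ->; rewrite -leNgt ltW.
pose c := aff_eval h (t i) - aff_eval h (t j).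
have c0 : 0 < c by rewrite subr_gt0 (lt_trans hj).
pose a := - aff_eval h (t j) / c; pose b := aff_eval h (t i) / c.
have a0 : 0 < a by rewrite divr_gt0// oppr_gt0.
have b0 : 0 < b by rewrite divr_gt0.
have ab : a + b = 1 by rewrite -mulrDl addrC mulfV// gt_eqF.
have [s1 [s2 [s1j s1l s2i s2l ts]]] := bisect t ij a0 b0 ab.
have hm : aff_eval h (a *: t i + b *: t j) = 0.
  have -> : a *: t i + b *: t j = t j + a *: (t i - t j).
    have -> : b = 1 - a by lra.
    by rewrite scalerBr scalerBl scale1r addrCA.
  by rewrite aff_eval_conv /a; have := gt_eqF c0; rewrite /c => cn; field; rewrite cn.
have card_lt (s : simplex K k) l : aff_eval h (t l) != 0 -> aff_eval h (s l) = 0 ->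
    (forall m, m != l -> s m = t m) -> (#|[pred i : 'I_k.+1 | aff_eval h (s i) != 0%R]| < n)%N.
  move=> tl sl st; apply: leq_trans tn; apply: proper_card; apply/properP; split.
    apply/fintype.subsetP => m; rewrite !inE; have [->|ml] := eqVneq m l; first by rewrite sl eqxx.
    by rewrite st.
  by exists l; rewrite !inE// sl eqxx.
have [|xs1 [r1 x1]] := ih s1.
  by apply: (card_lt s1 j); rewrite ?s1j// lt_eqF.
have [|xs2 [r2 x2]] := ih s2.
  by apply: (card_lt s2 i); rewrite ?s2i// gt_eqF.
pose f s := if s == s1 then xs1 else xs2.
have fr x : x \in [:: s1; s2] -> refines x (f x) /\ forall y, y \in f x -> one_sided h y.
  by rewrite /f !inE; case: eqP => [->//|_ /= /eqP ->].
exists (flatten [seq f x | x <- [:: s1; s2]]); split.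
  by apply: refines_flatten ts _ => x /fr[].
by move=> x /flatten_mapP[y /fr[_ h']]; exact: h'.
Qed.

Lemma cut_hyperplanes k (hs : seq 'cV[R]_(1 + d)) (t : simplex K k) :
  exists xs, refines t xs /\ forall x h, x \in xs -> h \in hs -> one_sided h x.
Proof.
elim: hs t => [|h hs ih] t; first by exists [:: t]; split=> //; exact: refines_refl.
have /choice[f fP] := @cut_hyperplane k h.
have [xs [txs xhs]] := ih t.
exists (flatten [seq f x | x <- xs]); split.
  by apply: refines_flatten txs _ => x _; case: (fP x).
move=> y g /flatten_mapP[x xxs yf]; rewrite inE => /orP[/eqP ->|ghs].
  by case: (fP x) => _; apply.
apply: one_sided_sub (xhs _ _ xxs ghs); case: (fP x) => fx _; exact: refines_hull_sub yf.
Qed.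

(** [t] is cut by all hyperplanes that bound some [l]. A piece with a vertex outside [l] violates
    one of the inequalities of [l] there, and being on one side of that hyperplane it is separated
    from [l]. *)
Lemma cut_simplex k (ls : seq (simplex K k)) (t : simplex K k) :
  exists xs, refines t xs /\ forall x l, x \in xs -> l \in ls ->
    hull x `<=` hull l \/ weakly_separated x l.
Proof.
have /choice[hs hsP] : forall l : simplex K k, exists hs : seq 'cV[R]_(1 + d), forall x,
    hull l x <-> (forall h, h \in hs -> 0 <= aff_eval h x).
  by move=> l; exact/hull_halfspaces/simplex_indep.
have [xs [txs xhs]] := cut_hyperplanes (flatten [seq hs l | l <- ls]) t.
exists xs; split=> // x l xxs lls.
have os h : h \in hs l -> one_sided h x.
  by move=> hl; apply: xhs xxs _; apply/flatten_mapP; exists l.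
have [xl|] := pselect (forall i, hull l (x i)); first by left; exact: hull_sub.
move=> /existsNP[i] /hsP /existsNP[h] /not_implyP[hl hi]; right.
have hi0 : aff_eval h (x i) < 0 by rewrite ltNge; exact/negP.
apply: separated_sym; exists h; split.
- by move=> j; apply: (iffLR (hsP l _) (hull_vertex _ _)).
- by case: (os h hl) => // /(_ i).
- by right; exists i; rewrite lt_eqF.
Qed.

Lemma segment_avoids k (t : simplex K k) (x b : 'rV[R]_d) : ~ hull t x ->
  exists2 l0, 0 < l0 & forall l, 0 < l < l0 -> ~ hull t (x + l *: (b - x)).
Proof.
have [hs hsP] := hull_halfspaces (@simplex_indep _ _ _ _ t).
move=> /hsP /existsNP[h] /not_implyP[hl /negP]; rewrite -ltNge => hx.
pose c := `|aff_eval h b| + `|aff_eval h x| + 1.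
have c0 : 0 < c by rewrite ltr_wpDl// addr_ge0.
exists (Num.min 1 (- aff_eval h x / c)); first by rewrite lt_min ltr01 divr_gt0// oppr_gt0.
move=> l /andP[l0]; rewrite lt_min ltr_pdivlMr// => /andP[l1 lc] /hsP /(_ h hl).
rewrite aff_eval_conv; apply/negP; rewrite -ltNge.
have h1 : l * aff_eval h b <= l * `|aff_eval h b| by rewrite ler_wpM2l ?(ltW l0)// ler_norm.
have h2 : - (l * aff_eval h x) <= l * `|aff_eval h x|.
  by rewrite -mulrN ler_wpM2l ?(ltW l0)// -normrN ler_norm.
rewrite /c !mulrDr mulr1 in lc; lra.
Qed.

(** A point missed by finitely many simplexes can be moved a little towards the barycenter of [t]
    and is still missed, but now has positive weights. *)
Lemma hull_cover_interior k (t : simplex K k) (xs : seq (simplex K k)) :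
  (forall w : 'I_k.+1 -> R, (forall i, 0 < w i) -> \sum_i w i = 1 ->
     exists2 x, x \in xs & hull x (\sum_i w i *: t i)) ->
  hull t `<=` \bigcup_(x in [set x | x \in xs]) hull x.
Proof.
move=> cov y ty; apply: contrapT => ny.
have nx x : x \in xs -> ~ hull x y by move=> xxs xy; apply: ny; exists x.
have [l0 l00 hl0] : exists2 l0, 0 < l0 & forall x l, x \in xs -> 0 < l < l0 ->
    ~ hull x (y + l *: (barycenter t - y)).
  elim: xs nx {cov ny} => [|x xs ih] nx; first by exists 1.
  have [|l1 l10 h1] := ih; first by move=> z zxs; apply: nx; rewrite inE zxs orbT.
  have [l2 l20 h2] := segment_avoids (barycenter t) (nx x (mem_head _ _)).
  exists (Num.min l1 l2) => [|z l]; first by rewrite lt_min l10.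
  rewrite lt_min inE => /orP[/eqP ->|zxs] /and3P[h3 h4 h5]; first by apply: h2; rewrite h3.
  by apply: h1; rewrite ?h3.
have [w [w0 w1 yE]] := ty; pose l := Num.min 2^-1 (l0 / 2).
have l_gt0 : 0 < l by rewrite lt_min invr_gt0 ltr0n/= divr_gt0.
have ll0 : l < l0 by rewrite gt_min ltr_pdivrMr// ltr_pMr// ltrDl ltr01 orbT.
have l1 : l < 1 by rewrite gt_min invf_lt1// ltrDl ltr01.
have [||x xxs] := cov (fun i => (1 - l) * w i + l * k.+1%:R^-1).
- move=> i; rewrite ltr_wpDl ?mulr_ge0 ?subr_ge0 ?(ltW l1)//.
  by rewrite mulr_gt0// invr_gt0 ltr0n.
- by rewrite big_split /= -!mulr_sumr w1 sum_barycenter_weights !mulr1 subrK.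
have -> : \sum_i ((1 - l) * w i + l * k.+1%:R^-1) *: t i = y + l *: (barycenter t - y).
  under eq_bigr do rewrite scalerDl -!scalerA.
  by rewrite big_split /= -scaler_sumr -[X in _ + X = _]scaler_sumr -yE scalerBr scalerBl scale1r
    addrA addrAC.
by apply: hl0; rewrite ?l_gt0.
Qed.

Lemma swap_vertices k (x : simplex K k.+1) : exists x' : simplex K k.+1,
  [/\ hull x' = hull x, opposite_orientation x' x & opposite_orientation x x'].
Proof.
pose s : {perm 'I_k.+2} := tperm ord0 (lift ord0 ord0).
have s1 : (s : bool) = true by rewrite odd_tperm.
have W1 i : \sum_j (perm_mx s : 'M[R]_k.+2) i j = 1.
  rewrite (bigD1 (s i))//= big1 ?addr0 ?mxE ?mxE ?eqxx//.
  by move=> j js; rewrite !mxE eq_sym (negbTE js).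
have [|||x' xE x'x] := @simplex_of_weights _ _ _ k.+1 x (perm_mx s).
- by move=> i j; rewrite !mxE; exact: ler0n.
- by [].
- exact: unitmx_perm.
have xs i : x' i = x (s i).
  rewrite xE (bigD1 (s i))//= big1 ?addr0 ?mxE ?mxE ?eqxx ?scale1r//.
  by move=> j js; rewrite !mxE eq_sym (negbTE js) scale0r.
have W' (u v : simplex K k.+1) : (forall i, u i = v (s i)) -> opposite_orientation u v.
  move=> uv; have [|A uA detA] := @edges_weights _ _ _ _ u v (perm_mx s) W1.
    move=> i; rewrite uv (bigD1 (s i))//= big1 ?addr0 ?mxE ?mxE ?eqxx ?scale1r//.
    by move=> j js; rewrite !mxE eq_sym (negbTE js) scale0r.
  by exists A => //; rewrite detA det_perm s1 expr1 ltrN10.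
exists x'; split; last 2 first.
- exact: W'.
- by apply: W' => i; rewrite xs tpermK.
apply/seteqP; split=> //; apply: hull_sub => i.
by rewrite -(tpermK ord0 (lift ord0 ord0) i) -xs; exact: hull_vertex.
Qed.

End Cuts.

Section NormedGroup.
Variables (R : realType) (G : normedGroup R).

Lemma ng_norm0 : ng_norm (0 : G) = 0.
Proof. exact/ng_norm_eq0. Qed.

Lemma ng_norm_ge0 (g : G) : 0 <= ng_norm g.
Proof.
have := ng_normD g (- g); rewrite subrr ng_norm0 ng_normN; lra.
Qed.

End NormedGroup.

(** * Mass and flat norm of sums of polyhedral chains *)

Section CommonRefinement.
Local Open Scope quotient_scope.
Variables (R : realType) (d : nat) (K : set 'rV[R]_d) (G : normedGroup R).

Definition cell k (g : G) (x : simplex K k) : polychain K G k := \pi_(polychain K G k) [:: (g, x)].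

Lemma pi_sum k (s : formal_sum K G k) : \pi_(polychain K G k) s = \sum_(e <- s) cell e.1 e.2.
Proof.
elim: s => [|[g x] s ih]; first by rewrite big_nil.
by rewrite -cat1s pi_cat ih big_cons.
Qed.

Lemma cellD k (g h : G) (x : simplex K k) : cell (g + h) x = cell g x + cell h x.
Proof. by rewrite -pi_cat; apply/polychain_eqP/chain_eq_sym/chain_eq_add. Qed.

Lemma cell0 k (x : simplex K k) : cell 0 x = 0.
Proof. exact/polychain_eqP/chain_eq_zero. Qed.

(** The pieces of a subdivision must carry the orientation of [t]. The boolean records whether two
    vertices of [x] had to be exchanged, that is, whether the coefficient changes sign. *)
Lemma orient_sub k (t x : simplex K k.+1) : hull x `<=` hull t ->
  exists bx' : bool * simplex K k.+1, [/\ hull bx'.2 = hull x, same_orientation bx'.2 t &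
    forall g : G, cell g bx'.2 = cell (if bx'.1 then - g else g) x].
Proof.
move=> xt; have [W [W0 W1 xE Wu]] := sub_simplex_weights xt.
have [A xA Adet] := edges_weights W1 xE.
have : \det A != 0 by rewrite Adet -unitfE -unitmxE.
case: (ltgtP (\det A) 0) => // [A0|A0] _; last by exists (false, x); split=> //; exists A.
have [x' [hx' o' _]] := swap_vertices x; exists (true, x'); split=> //=.
  have [B xB B0] := o'; exists (B *m A); first by rewrite xB xA mulmxA.
  by rewrite det_mulmx nmulr_rgt0.
by move=> g; apply/polychain_eqP; exact: chain_eq_reverse.
Qed.

Lemma refines_subdivision k (t : simplex K k.+1) xs : refines t xs -> subdivision t xs.
Proof.
move=> [h o p]; split=> //; apply: sub_pairwise p => x y /asboolP xy.
exact/asboolP/separated_null.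
Qed.

Lemma cell_subdivision k g (t : simplex K k) xs : subdivision t xs ->
  cell g t = \sum_(x <- xs) cell g x.
Proof.
move=> txs; rewrite -(big_map (fun x => (g, x)) xpredT (fun e => cell e.1 e.2)) -pi_sum.
exact/polychain_eqP/chain_eq_refine.
Qed.

Notation separated_seq xs := (pairwise (fun x y => `[< weakly_separated x y >]) xs).

(* The pieces of the cells of L lying in t, together with the pieces of t lying
   in no cell of L, subdivide t. *)
Lemma add_simplex k (g : G) (t : simplex K k.+1) (L : formal_sum K G k.+1) :
  separated_seq [seq e.2 | e <- L] ->
  exists L' : formal_sum K G k.+1, [/\ separated_seq [seq e.2 | e <- L'],
    cell g t + \pi_(polychain K G k.+1) L = \pi_(polychain K G k.+1) L' &
    (sum_mass L' <= (ng_norm g)%:E * hausdorff k.+1 (hull t) + sum_mass L)%E].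
Proof.
set ls := [seq e.2 | e <- L] => sepL.
have /choice[f fP] : forall l : simplex K k.+1, exists xs, refines l xs /\ forall x,
    x \in xs -> hull x `<=` hull t \/ weakly_separated x t.
  move=> l; have [xs [lxs h]] := cut_simplex [:: t] l; exists xs; split=> // x xxs.
  by apply: h; rewrite ?mem_head.
have fr l : refines l (f l) by case: (fP l).
have [ts [tts tsP]] := cut_simplex ls t.
have /choice[orn ornP] : forall x : simplex K k.+1, exists bx' : bool * simplex K k.+1,
    hull x `<=` hull t -> [/\ hull bx'.2 = hull x, same_orientation bx'.2 t &
    forall g : G, cell g bx'.2 = cell (if bx'.1 then - g else g) x].
  move=> x; have [xt|xt] := pselect (hull x `<=` hull t); last by exists (true, x).
  by have [bx' h] := orient_sub xt; exists bx'.
pose inside (x : simplex K k.+1) := `[< hull x `<=` hull t >].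
pose P := flatten [seq f l | l <- ls].
pose E := [seq x <- ts | all (fun l => `[< weakly_separated x l >]) ls].
pose D := [seq x <- P | inside x].
have Ets x : x \in E -> x \in ts by rewrite mem_filter => /andP[].
have sepPE : separated_seq (P ++ E).
  rewrite pairwise_cat; apply/and3P; split.
  - apply/allrelP => x y /flatten_mapP[l lls xl]; rewrite mem_filter => /andP[/allP yl _].
    apply/asboolP/separated_sym; apply: separated_sub (asboolP _ (yl l lls)) => //.
    exact: refines_hull_sub (fr l) xl.
  - by apply: pairwise_separated_flatten.
  - by apply: pairwise_filter; case: tts.
have sepDE : separated_seq (D ++ E).
  apply: subseq_pairwise sepPE; apply: cat_subseq => //; exact: filter_subseq.
have insD x : x \in D -> hull x `<=` hull t by rewrite mem_filter => /andP[/asboolP].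
pose S := [seq (orn x).2 | x <- D] ++ E.
have subS : subdivision t S.
  apply: refines_subdivision; split.
  - apply/seteqP; split; last first.
      move=> z [x /=]; rewrite mem_cat => /orP[/mapP[y yD ->]|/Ets xts].
        by have yt := insD _ yD; case: (ornP y yt) => -> _ _; exact: yt.
      exact: refines_hull_sub tts xts z.
    (* At a point with positive weights, a function that is nonpositive on [t] and not identically 0
       there is strictly negative. So a piece of a cell that contains [z] is not separated from [t],
       and lies inside it. *)
    apply: hull_cover_interior => w w0 w1; set z := \sum_i _.
    have tz : hull t z by exists w; split=> // i; exact/ltW/w0.
    have [+ _ _] := tts => tE; move: (tz); rewrite tE => -[x /= xts xz].
    have [xE|] := boolP (x \in E); first by exists x; rewrite // mem_cat xE orbT.
    rewrite mem_filter xts andbT => /allPn[l lls /asboolP nsep].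
    have [xl|//] := tsP x l xts lls.
    have [lE _ _] := fr l; move: (xl _ xz); rewrite lE => -[y /= yl yz].
    have [yt|[h [hy ht hn]]] := (fP l).2 y yl.
      exists (orn y).2; last by case: (ornP y yt) => ->.
      rewrite mem_cat; apply/orP; left; apply/mapP; exists y => //.
      rewrite mem_filter; apply/andP; split; first exact/asboolP.
      by apply/flatten_mapP; exists l.
    (* If h vanished on t, then on x, on l and on y. *)
    exfalso; have hzy := aff_eval_hull_ge0 hy yz.
    have [ht0|] := pselect (forall i, aff_eval h (t i) = 0).
      have hx0 i : aff_eval h (x i) = 0.
        have : hull t (x i) by apply: (refines_hull_sub tts xts); exact: hull_vertex.
        move=> [v [_ v1 ->]]; rewrite aff_eval_sum// big1// => j _.
        by rewrite ht0 mulr0.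
      have hl0 := aff_eval_sub_eq0 xl hx0.
      have hy0 i : aff_eval h (y i) = 0.
        have : hull l (y i) by apply: (refines_hull_sub (fr l) yl); exact: hull_vertex.
        move=> [v [_ v1 ->]]; rewrite aff_eval_sum// big1// => j _.
        by rewrite hl0 mulr0.
      by case: hn => -[i]; rewrite ?ht0 ?hy0 eqxx.
    move=> /existsNP[i /eqP hi].
    have : aff_eval h z < 0.
      rewrite aff_eval_sum// (bigD1 i)//= -[ltRHS]addr0 ltr_leD//.
        by rewrite pmulr_rlt0// lt_neqAle hi ht.
      by apply: sumr_le0 => j _; rewrite mulr_ge0_le0// ltW.
    by rewrite ltNge hzy.
  - move=> x; rewrite mem_cat => /orP[/mapP[y yD ->]|/Ets xts].
      by have yt := insD _ yD; case: (ornP y yt).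
    by case: tts => _ + _; apply.
  - rewrite pairwise_cat pairwise_map; move: sepDE; rewrite pairwise_cat => /and3P[h1 h2 h3].
    apply/and3P; split=> //.
      apply/allrelP => _ y /mapP[x xD ->] yE; have /allrelP/(_ x y xD yE)/asboolP xy := h1.
      apply/asboolP; apply: separated_sub xy => //.
      by have [-> _ _] := ornP x (insD x xD).
    apply: (@sub_in_pairwise _ (mem D)) h2; last exact/allP.
    move=> x y xD yD /asboolP xy.
    apply/asboolP; apply: separated_sub xy.
      by have [-> _ _] := ornP x (insD x xD).
    by have [-> _ _] := ornP y (insD y yD).
(* The coefficient that [t] contributes on the piece [x], with the sign of the orientation of [x]
   relative to [t]. *)
pose sg x := if inside x then (if (orn x).1 then - g else g) else 0.
pose L' : formal_sum K G k.+1 :=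
  [seq (e.1 + sg x, x) | e <- L, x <- f e.2] ++ [seq (g, x) | x <- E].
have sg_norm x : ng_norm (sg x) <= if inside x then ng_norm g else 0.
  by rewrite /sg; case: ifP => _; [case: ifP; rewrite ?ng_normN|rewrite ng_norm0].
have L'E : [seq e.2 | e <- L'] = P ++ E.
  rewrite map_cat -!map_comp /=; congr (_ ++ _); last by rewrite map_id_in.
  rewrite map_allpairs /= /P /ls -map_comp; congr flatten; apply: eq_map => e /=.
  by rewrite map_id.
exists L'; split; first by rewrite L'E.
  rewrite !pi_sum (cell_subdivision _ subS) !big_cat /= !big_map big_allpairs_dep /=.
  rewrite addrAC; congr (_ + _).
  rewrite big_seq; under eq_bigr => x xD do rewrite (let: And3 _ _ h := ornP x (insD x xD) in h).
  rewrite -big_seq big_filter big_flatten /= !big_map -big_split /=.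
  apply: eq_bigr => e _; rewrite (cell_subdivision _ (refines_subdivision (fr e.2))).
  rewrite big_mkcond -big_split /=; apply: eq_bigr => x _.
  by rewrite addrC cellD /sg; case: ifP => //; rewrite cell0.
have HF x : (0 <= hausdorff k.+1 (hull (x : simplex K k.+1)))%E by exact: hausdorff_ge0.
rewrite /sum_mass big_cat /= big_map big_allpairs_dep /=.
apply: (@le_trans _ _ (\sum_(e <- L) ((ng_norm e.1)%:E * \sum_(x <- f e.2) hausdorff k.+1 (hull x) +
    \sum_(x <- f e.2 | inside x) (ng_norm g)%:E * hausdorff k.+1 (hull x)) +
    \sum_(x <- E) (ng_norm g)%:E * hausdorff k.+1 (hull x)))%E.
  rewrite leeD2r//; apply: lee_sum => e _.
  rewrite ge0_sume_distrr// [X in (_ <= _ + X)%E]big_mkcond -big_split /=.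
  apply: lee_sum => x _; apply: (@le_trans _ _
    (((ng_norm e.1)%:E + (ng_norm (sg x))%:E) * hausdorff k.+1 (hull x))%E).
    by rewrite -EFinD lee_wpmul2r// lee_fin ng_normD.
  rewrite ge0_muleDl ?lee_fin ?ng_norm_ge0// leeD2l//.
  apply: (@le_trans _ _ ((if inside x then ng_norm g else 0)%:E * hausdorff k.+1 (hull x))%E).
    by rewrite lee_wpmul2r// lee_fin.
  by case: ifP => //; rewrite mul0e.
(* The pieces of a cell have at most its measure in total, and the pieces in [D] and [E] together
   have at most the measure of [t]. *)
rewrite big_split /= -addeA [leRHS]addeC leeD//.
  apply: lee_sum => e _; rewrite lee_wpmul2l ?lee_fin ?ng_norm_ge0//.
  apply: hausdorff_sum_separated => [x xe|]; first exact: refines_hull_sub (fr e.2) xe.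
  by case: (fr e.2).
have -> : (\sum_(e <- L) \sum_(x <- f e.2 | inside x) (ng_norm g)%:E * hausdorff k.+1 (hull x) =
    \sum_(x <- D) (ng_norm g)%:E * hausdorff k.+1 (hull x))%E.
  by rewrite /D /P big_filter big_flatten /= !big_map.
rewrite -big_cat /= -ge0_sume_distrr// lee_wpmul2l ?lee_fin ?ng_norm_ge0//.
apply: hausdorff_sum_separated => // x; rewrite mem_cat => /orP[/insD//|/Ets].
exact: refines_hull_sub.
Qed.

Lemma common_refinement k (s : formal_sum K G k.+1) :
  exists s' : formal_sum K G k.+1, [/\ separated_seq [seq e.2 | e <- s'],
    \pi_(polychain K G k.+1) s = \pi_(polychain K G k.+1) s' & (sum_mass s' <= sum_mass s)%E].
Proof.
elim: s => [|[g t] s [s' [s1 s2 s3]]]; first by exists [::].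
have [L' [h1 h2 h3]] := add_simplex g t s1; exists L'; split=> //.
  by rewrite -cat1s pi_cat s2.
by apply: le_trans h3 _; rewrite [leRHS]/sum_mass big_cons leeD2l.
Qed.

(** By definition [poly_mass] is bounded by [sum_mass] of nonoverlapping representatives; a common
    refinement extends the bound to all representatives. Subadditivity of the mass then follows by
    concatenation. *)
Lemma poly_mass_le k (s : formal_sum K G k.+1) :
  (poly_mass (\pi_(polychain K G k.+1) s) <= sum_mass s)%E.
Proof.
have [s' [s1 s2 s3]] := common_refinement s; apply: le_trans s3.
apply: ereal_inf_lbound; exists s' => //; split=> //.
by apply: sub_pairwise s1 => x y /asboolP xy; exact/asboolP/separated_null.
Qed.

Lemma sum_mass_nil k : sum_mass ([::] : formal_sum K G k) = 0%E.
Proof. by rewrite /sum_mass big_nil. Qed.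

Lemma poly_mass0 k : (poly_mass (0%R : polychain K G k.+1) <= 0)%E.
Proof. by rewrite -(sum_mass_nil k.+1); exact: poly_mass_le. Qed.

Lemma sum_mass_ge0 k (s : formal_sum K G k) : (0 <= sum_mass s)%E.
Proof. by apply: sume_ge0 => e _; rewrite mule_ge0 ?hausdorff_ge0// lee_fin ng_norm_ge0. Qed.

Lemma sum_mass_lty k (s : formal_sum K G k) : (sum_mass s < +oo)%E.
Proof.
rewrite /sum_mass; apply: lte_sum_pinfty => e _.
rewrite -(@fineK _ (hausdorff k (hull e.2))) ?ltry//.
by rewrite ge0_fin_numE ?hausdorff_ge0// hausdorff_simplex_lty.
Qed.

Lemma poly_mass_ge0 k (P : polychain K G k) : (0 <= poly_mass P)%E.
Proof. by apply: le_ereal_inf_tmp => _ [s _ <-]; exact: sum_mass_ge0. Qed.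

Lemma poly_mass_lty k (P : polychain K G k.+1) : (poly_mass P < +oo)%E.
Proof. by rewrite -(reprK P); apply: le_lt_trans (poly_mass_le _) (sum_mass_lty _). Qed.

Lemma poly_massD k (P Q : polychain K G k.+1) :
  (poly_mass (P + Q)%R <= poly_mass P + poly_mass Q)%E.
Proof.
have fin (S : polychain K G k.+1) : poly_mass S \is a fin_num.
  by rewrite ge0_fin_numE ?poly_mass_ge0// poly_mass_lty.
apply/lee_addgt0Pr => e e0; have e2 : 0 < e / 2 by rewrite divr_gt0.
have [_ [s [<- _] <-] hs] := lb_ereal_inf_adherent e2 (fin P).
have [_ [t [<- _] <-] ht] := lb_ereal_inf_adherent e2 (fin Q).
rewrite -pi_cat; apply: le_trans (poly_mass_le _) _.
rewrite /sum_mass big_cat /= [e]splitr EFinD addeACA; exact: leeD (ltW hs) (ltW ht).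
Qed.

Lemma poly_massN k (P : polychain K G k) : poly_mass (- P) = poly_mass P.
Proof.
have le (Q : polychain K G k) : (poly_mass (- Q)%R <= poly_mass Q)%E.
  apply: le_ereal_inf_tmp => _ [s [<- sn] <-]; apply: ereal_inf_lbound.
  exists (opp_sum s); first by split; [rewrite Defs.pi_opp|rewrite /opp_sum -map_comp].
  by rewrite /sum_mass big_map; apply: eq_bigr => e _ /=; rewrite ng_normN.
by apply/eqP; rewrite eq_le le -{1}[P]opprK le.
Qed.

Lemma boundary_cat k (p q : formal_sum K G k.+1) : boundary (p ++ q) = boundary p ++ boundary q.
Proof. by rewrite /boundary map_cat flatten_cat. Qed.

Lemma boundary_opp k (q : formal_sum K G k.+1) : boundary (opp_sum q) = opp_sum (boundary q).
Proof.
rewrite /boundary /opp_sum map_flatten -!map_comp; congr flatten; apply: eq_map => e /=.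
by rewrite -map_comp; apply: eq_map => i /=; case: ifP.
Qed.

Lemma poly_flat_ge0 k (P : polychain K G k) : (0 <= poly_flat P)%E.
Proof. by apply: le_ereal_inf_tmp => _ [q _ <-]; rewrite adde_ge0 ?poly_mass_ge0. Qed.

Lemma poly_flat_le k (P : polychain K G k.+1) (q : formal_sum K G k.+2) :
  (poly_flat P <= sum_mass q + poly_mass (P - \pi_(polychain K G k.+1) (boundary q))%R)%E.
Proof.
apply: (@le_trans _ _ (poly_mass (\pi_(polychain K G k.+2) q) +
  poly_mass (P - \pi_(polychain K G k.+1) (boundary q))%R)%E).
  by apply: ereal_inf_lbound; exists q.
by rewrite leeD2r// poly_mass_le.
Qed.

Lemma poly_flat_le_mass k (P : polychain K G k.+1) : (poly_flat P <= poly_mass P)%E.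
Proof.
apply: le_trans (poly_flat_le _ [::]) _; rewrite sum_mass_nil add0e.
by rewrite pi_sum big_nil subr0.
Qed.

Lemma poly_flat_fin k (P : polychain K G k.+1) : poly_flat P \is a fin_num.
Proof.
rewrite ge0_fin_numE ?poly_flat_ge0//; apply: le_lt_trans (poly_flat_le_mass P) _.
exact: poly_mass_lty.
Qed.

Lemma poly_flatN k (P : polychain K G k) : poly_flat (- P) = poly_flat P.
Proof.
have le (Q : polychain K G k) : (poly_flat (- Q)%R <= poly_flat Q)%E.
  apply: le_ereal_inf_tmp => _ [q _ <-]; apply: ereal_inf_lbound; exists (opp_sum q) => //.
  by rewrite Defs.pi_opp poly_massN boundary_opp Defs.pi_opp -opprD poly_massN.
by apply/eqP; rewrite eq_le le -{1}[P]opprK le.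
Qed.

Lemma poly_flatD k (P Q : polychain K G k.+1) :
  (poly_flat (P + Q)%R <= poly_flat P + poly_flat Q)%E.
Proof.
apply/lee_addgt0Pr => e e0; have e2 : 0 < e / 2 by rewrite divr_gt0.
have [_ [p _ <-] hp] := lb_ereal_inf_adherent e2 (poly_flat_fin P).
have [_ [q _ <-] hq] := lb_ereal_inf_adherent e2 (poly_flat_fin Q).
apply: le_trans (_ : _ <= (poly_mass (\pi_(polychain K G k.+2) p) +
  poly_mass (P - \pi_(polychain K G k.+1) (boundary p))%R) +
  (poly_mass (\pi_(polychain K G k.+2) q) +
    poly_mass (Q - \pi_(polychain K G k.+1) (boundary q))%R))%E _; last first.
  rewrite [e]splitr EFinD [leRHS]addeACA; exact: leeD (ltW hp) (ltW hq).
apply: (@le_trans _ _ (poly_mass (\pi_(polychain K G k.+2) (p ++ q)) +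
  poly_mass (P + Q - \pi_(polychain K G k.+1) (boundary (p ++ q)))%R)%E).
  by apply: ereal_inf_lbound; exists (p ++ q).
rewrite boundary_cat !pi_cat opprD addrACA addeACA.
by apply: leeD; exact: poly_massD.
Qed.

Lemma poly_flat0 k : poly_flat (0 : polychain K G k.+1) = 0%E.
Proof.
apply/eqP; rewrite eq_le poly_flat_ge0 andbT.
exact: le_trans (poly_flat_le_mass _) (poly_mass0 _).
Qed.

End CommonRefinement.

(** * Rounding of circulations *)

Section IntegralRounding.
Variables (R : realType) (E V : finType) (hd tl : E -> V).
Hypothesis hd_tl : forall e, hd e != tl e.

Let inc e v : R := (hd e == v)%:R - (tl e == v)%:R.

(* A vertex incident to an edge of E' meets at least two of them, so |V'| <= |E'|
   for the set V' of these vertices, whereas the incidence matrix has rank less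
   than |V'|. *)
Lemma circulation_on_fractional_edges (theta : E -> R) (E' : {set E}) : E' != finset.set0 ->
  (forall e, (e \in E') = (theta e \isn't a Num.int)) ->
  (forall v, \sum_e inc e v * theta e \is a Num.int) ->
  exists z : E -> R, [/\ exists e, z e != 0, forall e, e \notin E' -> z e = 0 &
    forall v, \sum_e inc e v * z e = 0].
Proof.
move=> /finset.set0Pn[e0 e0E'] E'P divP.
pose V' := [set v | [exists e in E', (hd e == v) || (tl e == v)]]%SET.
have hdV e : e \in E' -> hd e \in V'.
  by move=> eE; rewrite finset.in_set; apply/existsP; exists e; rewrite eE eqxx.
have tlV e : e \in E' -> tl e \in V'.
  by move=> eE; rewrite finset.in_set; apply/existsP; exists e; rewrite eE eqxx orbT.
(* If [e] were the only edge of [E'] at [v], the other terms of the divergence at [v] would be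
   integers, and so would [theta e]. *)
have deg v : v \in V' -> (2 <= \sum_(e in E') ((hd e == v) + (tl e == v)))%N.
  rewrite finset.in_set => /existsP[e /andP[eE ev]].
  rewrite (bigD1 e)//=; have -> : ((hd e == v) + (tl e == v) = 1)%N.
    move: ev; have := hd_tl e; case: (hd e =P v) => [->|_] /=; last by move=> _ ->.
    by rewrite eq_sym => /negbTE ->.
  rewrite addSn ltnS add0n lt0n; apply/negP => /eqP h.
  have h0 f : f \in E' -> f != e -> inc f v = 0.
    move=> fE fe; move/eqP: h; rewrite sum_nat_eq0 => /forallP/(_ f); rewrite fE fe /= addn_eq0.
    by rewrite /inc !eqb0 => /andP[/negbTE -> /negbTE ->]; rewrite subrr.
  have := eE; rewrite E'P => /negP; apply.
  have inc1 : inc e v = 1 \/ inc e v = -1.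
    move: ev (hd_tl e); rewrite /inc; case: (hd e =P v) => [->|_] /=.
      by rewrite eq_sym => _ /negbTE ->; left; rewrite subr0.
    by move=> -> _; right; rewrite sub0r.
  have := divP v; rewrite (bigD1 e)//= addrC => dv.
  have so : \sum_(i | i != e) inc i v * theta i \is a Num.int.
    apply: rpred_sum => f fe; case: (boolP (f \in E')) => fE; first by rewrite h0// mul0r rpred0.
    rewrite rpredM//; first by rewrite rpredB// natr_int.
    by move: fE; rewrite E'P negbK.
  have : inc e v * theta e \is a Num.int.
    by rewrite -[X in X \is a _](addKr (\sum_(i | i != e) inc i v * theta i)) rpredD// rpredN.
  by case: inc1 => ->; rewrite ?mul1r// mulN1r rpredN.
have VE : (#|V'| <= #|E'|)%N.
  rewrite -(leq_pmul2r (isT : (0 < 2)%N)) -!sum_nat_const.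
  apply: (@leq_trans (\sum_(v in V') \sum_(e in E') ((hd e == v) + (tl e == v)))%N).
    exact: leq_sum.
  rewrite exchange_big /=.
  have le1 w : (\sum_(v in V') (w == v) <= 1)%N.
    rewrite -big_mkcondr /= sum1_card -(card1 w); apply/subset_leq_card/fintype.subsetP => v.
    by rewrite !inE eq_sym => /andP[].
  by apply: leq_sum => e _; rewrite big_split /=; exact: (leq_add (le1 _) (le1 _)).
pose A : 'M[R]_(#|E'|, #|V'|) := \matrix_(i, j) inc (enum_val i) (enum_val j).
have sumV (v : V) : v \in V' -> \sum_(j < #|V'|) (v == enum_val j)%:R = 1 :> R.
  move=> vV; rewrite (bigD1 (enum_rank_in vV v))//= enum_rankK_in// eqxx big1 ?addr0// => j jv.
  case: eqP => // vj; case/eqP: jv; apply: enum_val_inj.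
  by rewrite (enum_rankK_in vV vV).
have A1 : A *m (const_mx 1 : 'cV_#|V'|) = 0.
  apply/colP => i; rewrite !mxE; under eq_bigr do rewrite !mxE mulr1.
  by rewrite sumrB !sumV ?subrr// ?hdV ?tlV// enum_valP.
have V0 : (0 < #|V'|)%N by apply/card_gt0P; exists (hd e0); exact: hdV.
have rA : (\rank A < #|V'|)%N.
  have := mulmx0_rank_max A1; have : (0 < \rank (const_mx 1%R : 'cV[R]_#|V'|))%N.
    rewrite lt0n mxrank_eq0; apply/eqP => /colP/(_ (Ordinal V0)); rewrite !mxE.
    by apply/eqP; exact: oner_neq0.
  by move=> h1 h2; apply: leq_trans h2; rewrite -addn1 leq_add2l.
(* A nonzero vector of the left kernel, extended by 0 outside [E'], is the desired circulation. *)
have : kermx A != 0 by rewrite -mxrank_eq0 mxrank_ker subn_eq0 -ltnNge (leq_trans rA).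
move=> /rowV0Pn[u /sub_kermxP uA /rV0Pn[i ui]].
exists (fun e => \sum_i u 0 i * (enum_val i == e)%:R); split.
- exists (enum_val i); rewrite (bigD1 i)//= eqxx mulr1 big1 ?addr0// => j ji.
  by rewrite (inj_eq enum_val_inj) (negbTE ji) mulr0.
- move=> e eE; apply: big1 => j _; case: eqP => [je|_]; last by rewrite mulr0.
  by move: eE; rewrite -je enum_valP.
move=> v; under eq_bigr do rewrite mulr_sumr.
rewrite exchange_big /=; transitivity (\sum_j u 0 j * inc (enum_val j) v).
  apply: eq_bigr => j _; rewrite (bigD1 (enum_val j))//= eqxx mulr1 mulrC big1 ?addr0// => e ej.
  by rewrite eq_sym (negbTE ej) !mulr0.
have [vV|vV] := boolP (v \in V').
  have := congr1 (fun B : 'rV[R]_#|V'| => B 0 (enum_rank_in vV v)) uA; rewrite !mxE => {2}<-.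
  by apply: eq_bigr => j _; rewrite !mxE enum_rankK_in.
apply: big1 => j _; have jE := enum_valP j.
have -> : inc (enum_val j) v = 0; last by rewrite mulr0.
rewrite /inc; case: eqP => [hv|_]; first by move: vV; rewrite -hv hdV.
by case: eqP => [hv|_]; [move: vV; rewrite -hv tlV|rewrite subrr].
Qed.

(** Induction on the number of non-integral values. Along a circulation [z] of nonpositive cost,
    integral values stay fixed because [z] vanishes there; the motion stops when the first of the
    others reaches 0 or 1. *)
Lemma integral_rounding (c theta : E -> R) : (forall e, 0 <= theta e <= 1) ->
  (forall v, \sum_e inc e v * theta e \is a Num.int) ->
  exists nu : E -> bool, (forall v, \sum_e inc e v * (nu e)%:R = \sum_e inc e v * theta e) /\
    \sum_e c e * (nu e)%:R <= \sum_e c e * theta e.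
Proof.
have [n] := ubnP #|[set e | theta e \isn't a Num.int]%SET|; elim: n theta => // n ih theta.
rewrite ltnS => thn th01 divP; set E' := [set e | _]%SET in thn.
have E'P e : (e \in E') = (theta e \isn't a Num.int) by rewrite finset.in_set.
have int01 (x : R) : 0 <= x <= 1 -> x \is a Num.int -> x = (x == 1)%:R.
  move=> /andP[x0 x1] /intrP[m xm]; move: x0 x1; rewrite xm ler0z -[1]/(1%:~R) ler_int eqr_int.
  by case: m {xm} => [[|[|m]]|m].
have [E0|E0] := eqVneq E' finset.set0.
  have thE e : theta e = (theta e == 1)%:R.
    by apply: int01 => //; apply: contraFT (finset.in_set0 e); rewrite -E'P E0.
  by exists (fun e => theta e == 1); split=> [v|]; [|rewrite le_eqVlt; apply/orP; left; apply/eqP];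
    apply: eq_bigr => e _; rewrite -thE.
have [z [z0 zE' zdiv] cz] : exists2 z : E -> R, [/\ exists e, z e != 0,
    forall e, e \notin E' -> z e = 0 & forall v, \sum_e inc e v * z e = 0] & \sum_e c e * z e <= 0.
  have [z [z0 zE' zdiv]] := circulation_on_fractional_edges E0 E'P divP.
  case: (lerP (\sum_e c e * z e) 0) => cz; first by exists z.
  exists (fun e => - z e); [split=> [|e /zE' ->|v]|].
  - by case: z0 => e ze; exists e; rewrite oppr_eq0.
  - by rewrite oppr0.
  - by under eq_bigr do rewrite mulrN; rewrite sumrN zdiv oppr0.
  - by under eq_bigr do rewrite mulrN; rewrite sumrN oppr_le0 ltW.
have [e1 ze1] := z0.
(* The time at which [theta e + t * z e] reaches 1 if [z e] is positive and 0 if it is negative. It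
   is minimized over the edges with [z e != 0], so no value leaves [0, 1] before the time of
   [e2]. *)
pose t e := if 0 < z e then (1 - theta e) / z e else - theta e / z e.
have [e2 ze2 te2] : exists2 e2, z e2 != 0 & forall e, z e != 0 -> t e2 <= t e.
  by case: (@Order.TotalTheory.arg_minP _ _ _ e1 (fun e => z e != 0) t ze1) => e2 h1 h2; exists e2.
have th0 e : e \in E' -> 0 < theta e < 1.
  rewrite E'P => h; have /andP[h0 h1] := th01 e.
  rewrite !lt_neqAle h0 h1 !andbT; apply/andP; split; apply: contraNneq h => h.
    by rewrite -h int_num0.
  by rewrite h int_num1.
have tpos e : z e != 0 -> 0 < t e.
  move=> ze; have /th0/andP[h0 h1] : e \in E' by apply: contraNT ze => /zE' ->.
  rewrite /t; case: ifPn => [zp|]; first by rewrite divr_gt0// subr_gt0.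
  by rewrite -leNgt => zn; rewrite ltr_ndivlMr ?mul0r ?oppr_lt0// lt_neqAle ze.
pose theta' e := theta e + t e2 * z e.
have th'01 e : 0 <= theta' e <= 1.
  have [ze|ze] := eqVneq (z e) 0; first by rewrite /theta' ze mulr0 addr0.
  have := te2 _ ze; have := tpos _ ze2; have /andP[h0 h1] := th01 e; rewrite /theta' /t.
  set s := if _ then _ else (- theta e2 / z e2); case: ifPn => [zp|].
    move=> s0; rewrite ler_pdivlMr// => hs; apply/andP; split; last by lra.
    by rewrite addr_ge0// mulr_ge0 ?(ltW s0) ?(ltW zp).
  rewrite -leNgt => zn; have zn' : z e < 0 by rewrite lt_neqAle ze.
  move=> s0; rewrite ler_ndivlMr// => hs; apply/andP; split; first by lra.
  by rewrite -[leRHS]addr0 lerD// mulr_ge0_le0 ?(ltW s0).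
have th'2 : theta' e2 \is a Num.int.
  rewrite /theta' /t; case: ifPn => zp; rewrite divfK//.
    by rewrite addrC subrK int_num1.
  by rewrite subrr int_num0.
have divE v : \sum_e inc e v * theta' e = \sum_e inc e v * theta e.
  under eq_bigr do rewrite mulrDr mulrCA; rewrite big_split /= -mulr_sumr zdiv mulr0 addr0//.
have [||nu [nudiv nuc]] := ih theta' _ th'01.
- apply: leq_trans thn; apply: proper_card; apply/properP; split.
    apply/fintype.subsetP => e; rewrite !finset.in_set; apply: contraNN => the.
    by rewrite /theta' zE' ?mulr0 ?addr0// E'P negbK.
  exists e2; first by apply: contraNT ze2 => /zE' ->.
  by rewrite finset.in_set negbK.
- by move=> v; rewrite divE.
exists nu; split=> [v|]; first by rewrite nudiv divE.
apply: le_trans nuc _; under eq_bigr do rewrite mulrDr mulrCA.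
by rewrite big_split /= -mulr_sumr gerDl mulr_ge0_le0// ltW// tpos.
Qed.

End IntegralRounding.

(** * Intervals subdividing the unit interval *)

Section IntervalPartition.
Variables (R : realType) (I : eqType) (G : zmodType).

Lemma sum_exclusive (P : pred I) (xs : seq I) (g : G) :
  pairwise (fun s t => ~~ (P s && P t)) xs -> has P xs ->
  \sum_(t <- xs) (if P t then g else 0) = g.
Proof.
elim: xs => //= x xs ih /andP[/allP xxs /ih{}ih]; rewrite big_cons.
have [Px _|Px /= /ih ->] := boolP (P x); last by rewrite add0r.
rewrite big_seq big1 ?addr0// => y /xxs; rewrite Px /=.
by case: (P y).
Qed.

Variables (a b : I -> R) (xs : seq I).
Hypothesis ab : forall t, t \in xs -> [/\ 0 <= a t, a t < b t & b t <= 1].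
Hypothesis disj : pairwise (fun s t => ~~ (Num.max (a s) (a t) < Num.min (b s) (b t))) xs.
Hypothesis cover : forall u, 0 <= u <= 1 -> exists2 t, t \in xs & a t <= u <= b t.

Lemma sum_left_interval u (g : G) : 0 <= u <= 1 ->
  \sum_(t <- xs) (if (a t < u) && (u <= b t) then g else 0) = if 0 < u then g else 0.
Proof.
move=> /andP[u0 u1]; case: ifPn => [up|]; last first.
  rewrite -leNgt => un; rewrite big_seq big1// => t txs; case: ifP => // /andP[au _].
  by have [a0 _ _] := ab txs; have := lt_le_trans au un; rewrite ltNge a0.
apply: sum_exclusive.
  apply: sub_pairwise disj => s t; apply: contraNN => /andP[/andP[h1 h2] /andP[h3 h4]].
  rewrite gt_max !lt_min; apply/andP; split; apply/andP; split.
  - exact: lt_le_trans h2.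
  - exact: lt_le_trans h4.
  - exact: lt_le_trans h2.
  - exact: lt_le_trans h4.
(* [m] bounds all right ends below [u]. An interval containing the midpoint of [m] and [u] has a
   right end greater than [m], hence not below [u], so it contains [u] too. *)
have [m mu mb] : exists2 m, 0 <= m < u & forall t, t \in xs -> b t < u -> b t <= m.
  elim: (xs) => [|t ts [m /andP[m0 mu] mb]]; first by exists 0; rewrite ?lexx.
  have [btu|btu] := ltP (b t) u; last first.
    exists m; rewrite ?m0// => s; rewrite inE => /orP[/eqP ->|]; last exact: mb.
    by rewrite ltNge btu.
  exists (Num.max m (b t)); first by rewrite le_max m0 gt_max mu.
  move=> s; rewrite inE le_max => /orP[/eqP ->|sts /(mb _ sts) -> //].
  by rewrite lexx orbT.
have /andP[m0 mu'] := mu.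
have mu01 : 0 <= (m + u) / 2 <= 1 by apply/andP; split; lra.
have [t txs /andP[h1 h2]] := cover mu01.
apply/hasP; exists t => //; apply/andP; split; first lra.
by rewrite leNgt; apply/negP => /(mb _ txs); lra.
Qed.

End IntervalPartition.

(** The indicator of ]a, b] minus that of [a, b[ is 1 at [b], -1 at [a] and 0 elsewhere. Intervals
    of the first kind partition ]0, 1]; the second kind is reduced to the first by the reflection of
    [0, 1]. *)
Lemma interval_partition (R : realType) (I : eqType) (G : zmodType) (a b : I -> R) (xs : seq I) :
  (forall t, t \in xs -> [/\ 0 <= a t, a t < b t & b t <= 1]) ->
  pairwise (fun s t => ~~ (Num.max (a s) (a t) < Num.min (b s) (b t))) xs ->
  (forall u, 0 <= u <= 1 -> exists2 t, t \in xs & a t <= u <= b t) ->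
  forall u (g : G), 0 <= u <= 1 ->
  \sum_(t <- xs) ((if b t == u then g else 0) - (if a t == u then g else 0)) =
  (if 1 == u then g else 0) - (if 0 == u then g else 0).
Proof.
move=> ab disj cover u g /andP[u0 u1].
have left_sum := sum_left_interval ab disj cover g (u := u).
have right_sum : \sum_(t <- xs) (if (1 - b t < 1 - u) && (1 - u <= 1 - a t) then g else 0) =
    if 0 < 1 - u then g else 0.
  apply: (@sum_left_interval _ _ _ (fun t => 1 - b t) (fun t => 1 - a t)).
  - by move=> t /ab[h1 h2 h3]; split; lra.
  - apply: sub_pairwise disj => s t; apply: contraNN; rewrite !gt_max !lt_min.
    by move=> /andP[/andP[h1 h2] /andP[h3 h4]]; rewrite !ltrD2l !ltrN2 in h1 h2 h3 h4;
      rewrite h1 h2 h3 h4.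
  - move=> v v01; have [|t txs tv] := cover (1 - v); first by move: v01 => /andP[? ?]; apply/andP;
    split; lra.
    by exists t => //; move: tv => /andP[? ?]; apply/andP; split; lra.
  - by apply/andP; split; lra.
transitivity (\sum_(t <- xs) ((if (a t < u) && (u <= b t) then g else 0) -
    (if (1 - b t < 1 - u) && (1 - u <= 1 - a t) then g else 0))).
  rewrite big_seq [RHS]big_seq; apply: eq_bigr => t /ab[h1 h2 h3].
  rewrite ltrD2l ltrN2 lerD2l lerN2 [b t == u]eq_sym.
  case: (ltgtP u (b t)) => hb /=; case: (ltgtP (a t) u) => ha //=; rewrite ?subr0 ?subrr//;
    exfalso; lra.
rewrite sumrB right_sum left_sum ?u0// subr_gt0 [1 == u]eq_sym [RHS]addrC.
case: (ltgtP u 1) u1 => // hu _; case: (ltgtP 0 u) u0 => // hu' _;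
  rewrite ?subrr ?subr0 ?oppr0 ?sub0r ?add0r ?addr0//.
by move: hu'; rewrite hu => /eqP; rewrite eq_sym oner_eq0.
Qed.

Lemma sum_ord2 (V : nmodType) (F : 'I_2 -> V) : \sum_i F i = F ord0 + F ord_max.
Proof. by rewrite big_ord_recl big_ord1; congr (_ + F _); exact: val_inj. Qed.

(** * Boundaries of 1-chains and lifting of circle-valued cycles *)

Section OneChainBoundary.
Variables (R : realType) (d : nat) (K : set 'rV[R]_d).
Implicit Types s t : simplex K 1.

Lemma aff_eval_add_scale h (x y z : 'rV[R]_d) (l : R) :
  aff_eval h (x + l *: (y - z)) = aff_eval h x + l * (aff_eval h y - aff_eval h z).
Proof.
rewrite !aff_evalE opprD addrACA subrr add0r -sumrB mulr_sumr -addrA -big_split/=.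
by congr (_ + _); apply: eq_bigr => i _; rewrite !mxE; ring.
Qed.

Lemma segment_coord s : exists h : 'cV[R]_(1 + d), [/\ aff_eval h (s ord0) = 0,
  aff_eval h (s ord_max) = 1,
  forall x, hull s x -> 0 <= aff_eval h x <= 1 &
  forall x, hull s x -> x = s ord0 + aff_eval h x *: (s ord_max - s ord0)].
Proof.
have [c cE] := barycentric (@simplex_indep _ _ _ _ s); exists (c ord_max).
have h0 : aff_eval (c ord_max) (s ord0) = 0 by rewrite cE.
have h1 : aff_eval (c ord_max) (s ord_max) = 1 by rewrite cE eqxx.
have hx (w : 'I_2 -> R) : \sum_i w i = 1 -> aff_eval (c ord_max) (\sum_i w i *: s i) = w ord_max.
  by move=> w1; rewrite aff_eval_sum// sum_ord2 h0 h1 mulr0 add0r mulr1.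
split=> // x [w [w0 w1 ->]]; rewrite hx//.
  by rewrite w0 -w1 (bigD1 ord_max)//= lerDl sumr_ge0.
move: w1; rewrite !sum_ord2 => w1.
have -> : w ord0 = 1 - w ord_max by rewrite -w1 addrK.
by rewrite scalerBr scalerBl scale1r addrA addrAC.
Qed.

Lemma segment_point s (l : R) : 0 <= l <= 1 -> hull s (s ord0 + l *: (s ord_max - s ord0)).
Proof.
move=> /andP[l0 l1]; exists (fun i => if i == ord0 then 1 - l else l); split.
- by move=> i; case: ifP => // _; rewrite subr_ge0.
- by rewrite sum_ord2 /= subrK.
rewrite sum_ord2 /=.
by rewrite scalerBr scalerBl scale1r addrA addrAC.
Qed.

Lemma edges1 s t (A : 'M[R]_1) : edges s = A *m edges t ->
  s ord_max = s ord0 + A 0 0 *: (t ord_max - t ord0).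
Proof.
move=> /row_matrixP/(_ ord0); rewrite row_mul !rowK.
have -> : lift ord0 ord0 = ord_max :> 'I_2 by exact: val_inj.
move=> /eqP; rewrite subr_eq addrC => /eqP ->; congr (_ + _).
rewrite mulmx_sum_row big_ord1 rowK mxE; congr (_ *: (_ - _)).
by congr (t _); exact: val_inj.
Qed.

Lemma segment_neq s : s ord0 != s ord_max.
Proof.
have [h [h0 h1 _ _]] := segment_coord s; apply/eqP => e.
by move: h1; rewrite -e h0 => /eqP; rewrite eq_sym oner_eq0.
Qed.

(** The affine coordinate along [t] decreases along [s]; as the hulls agree, it runs from 1 to 0. *)
Lemma opposite_vertices s t : hull s = hull t -> opposite_orientation s t ->
  s ord_max = t ord0 /\ s ord0 = t ord_max.
Proof.
move=> st [A /edges1 sA detA]; rewrite det_mx11 in detA.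
have [h [h0 h1 h01 hK]] := segment_coord t.
have th i : hull t (s i) by rewrite -st; exact: hull_vertex.
have sE : aff_eval h (s ord_max) = aff_eval h (s ord0) + A 0 0.
  by rewrite sA aff_eval_add_scale h0 h1 subr0 mulr1.
have mono x : hull s x -> aff_eval h (s ord_max) <= aff_eval h x <= aff_eval h (s ord0).
  have [g' [g0 g1 g01 gK]] := segment_coord s.
  move=> sx; rewrite (gK _ sx) aff_eval_add_scale sE addrAC subrr add0r.
  have /andP[l0 l1] := g01 _ sx; set l := aff_eval g' x in l0 l1 *.
  rewrite lerD2l gerDl mulr_ge0_le0 ?(ltW detA)// andbT -{1}[A 0 0]mul1r.
  by rewrite ler_wnM2r// ltW.
have s1 : aff_eval h (s ord_max) = 0.
  apply/eqP; rewrite eq_le; have /andP[-> _] := h01 _ (th ord_max); rewrite andbT.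
  have : hull s (t ord0) by rewrite st; exact: hull_vertex.
  by move=> /mono/andP[]; rewrite h0.
have s0 : aff_eval h (s ord0) = 1.
  apply/eqP; rewrite eq_le; have /andP[_ ->] := h01 _ (th ord0).
  have : hull s (t ord_max) by rewrite st; exact: hull_vertex.
  by move=> /mono/andP[_]; rewrite h1.
split; first by rewrite (hK _ (th ord_max)) s1 scale0r addr0.
by rewrite (hK _ (th ord0)) s0 scale1r addrC subrK.
Qed.

Variable G : zmodType.

(** The coefficient of the boundary at the point [v]. It is invariant under [chain_eq], so that
    being a cycle can be tested on any representative, without 0-dimensional chains. *)
Definition bd_at (v : 'rV[R]_d) (s : formal_sum K G 1) : G :=
  \sum_(e <- s) ((if e.2 ord_max == v then e.1 else 0) - (if e.2 ord0 == v then e.1 else 0)).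

Lemma bd_at_reverse v g s t : hull s = hull t -> opposite_orientation s t ->
  bd_at v [:: (g, s)] = bd_at v [:: (- g, t)].
Proof.
move=> st o; have [E1 E0] := opposite_vertices st o.
rewrite /bd_at !big_seq1 /= E0 E1.
by do 2 case: ifP => _; rewrite ?subr0 ?sub0r ?opprK ?oppr0 ?subrr ?addr0 ?add0r ?addNr.
Qed.

(** The affine coordinate along [s] turns the pieces into intervals whose right ends are the images
    of [ord_max], by equality of orientations. A common part of positive length would have positive
    measure by [norm_le_hausdorff1], so [interval_partition] applies. *)
Lemma bd_at_subdivision v g s xs : subdivision s xs ->
  bd_at v [:: (g, s)] = bd_at v [seq (g, t) | t <- xs].
Proof.
move=> [nov sE so]; have [h [h0 h1 h01 hK]] := segment_coord s.
rewrite /bd_at big_map big_seq1 /=.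
have ts t i : t \in xs -> hull s (t i).
  by move=> txs; rewrite sE; exists t => //; exact: hull_vertex.
have injh x y : hull s x -> hull s y -> (x == y) = (aff_eval h x == aff_eval h y).
  by move=> sx sy; apply/eqP/eqP => [->//|xy]; rewrite (hK _ sx) (hK _ sy) xy.
have [sv|nsv] := pselect (hull s v); last first.
  have nv x : hull s x -> (x == v) = false by move=> sx; apply/eqP => xv; apply: nsv; rewrite -xv.
  rewrite !nv ?subrr; [|exact: hull_vertex..].
  by rewrite big_seq big1// => t txs; rewrite !nv ?subrr//; exact: ts.
pose a t := aff_eval h (t ord0); pose b t := aff_eval h (t ord_max).
have abt t : t \in xs -> [/\ 0 <= a t, a t < b t & b t <= 1].
  move=> txs; have /andP[a0 _] := h01 _ (ts t ord0 txs).
  have /andP[_ b1] := h01 _ (ts t ord_max txs); split=> //.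
  have [A /edges1 tA detA] := so t txs; rewrite det_mx11 in detA.
  by rewrite /b tA aff_eval_add_scale h0 h1 subr0 mulr1 ltrDl.
have tP t x : t \in xs -> hull t x -> a t <= aff_eval h x <= b t.
  move=> txs tx; have [g' [_ _ g01 gK]] := segment_coord t.
  have /andP[l0 l1] := g01 _ tx; rewrite (gK _ tx) aff_eval_add_scale -/(a t) -/(b t).
  have [_ ab _] := abt _ txs; rewrite lerDl mulr_ge0 ?subr_ge0 ?(ltW ab)//=.
  by rewrite -lerBrDl ler_piMl// subr_ge0 ltW.
have tP' t u : t \in xs -> a t <= u <= b t -> hull t (s ord0 + u *: (s ord_max - s ord0)).
  move=> txs /andP[au ub]; have [_ ab _] := abt _ txs.
  have ba0 : 0 < b t - a t by rewrite subr_gt0.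
  have l01 : 0 <= (u - a t) / (b t - a t) <= 1.
    by rewrite divr_ge0 ?subr_ge0// ?(ltW ab)//= ler_pdivrMr// mul1r lerD2r.
  have := segment_point t l01; congr hull.
  rewrite {1 2}(hK _ (ts t ord0 txs)) (hK _ (ts t ord_max txs)) -/(a t) -/(b t).
  rewrite opprD addrACA subrr add0r -scalerBl scalerA divfK ?gt_eqF//.
  by rewrite -addrA -scalerDl addrCA subrr addr0.
have sv01 := h01 _ sv.
rewrite (injh (s ord_max)) ?(injh (s ord0)) ?h0 ?h1//; try exact: hull_vertex.
rewrite -(@interval_partition _ _ _ a b xs abt _ _ _ g sv01).
- rewrite big_seq [RHS]big_seq; apply: eq_bigr => t txs.
  by rewrite !injh//; exact: ts.
- apply: (@sub_in_pairwise _ (mem xs)) nov; last exact/allP.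
  move=> x y xxs yxs /asboolP Hxy; apply/negP.
  set m := Num.max _ _; set M := Num.min _ _ => mM.
  have := @norm_le_hausdorff1 _ _ (s ord0 + m *: (s ord_max - s ord0))
    (s ord0 + M *: (s ord_max - s ord0))
    (hull x `&` hull y).
  rewrite Hxy mule0 opprD addrACA subrr add0r -scalerBl => H.
  suff : (`|(M - m) *: (s ord_max - s ord0)|%:E <= 0 :> \bar R)%E.
    rewrite lee_fin normr_le0 scaler_eq0 subr_eq0 gt_eqF//= subr_eq0 eq_sym.
    by rewrite (negbTE (segment_neq s)).
  apply: H => l /andP[l0 l1]; rewrite -addrA scalerA -scalerDl.
  have hm : m <= m + l * (M - m) by rewrite lerDl mulr_ge0// subr_ge0 ltW.
  have hM : m + l * (M - m) <= M by rewrite -lerBrDl ler_piMl// subr_ge0 ltW.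
  split; apply: tP' => //; apply/andP; split.
  - by apply: le_trans hm; rewrite le_max lexx.
  - by apply: le_trans hM _; rewrite ge_min lexx.
  - by apply: le_trans hm; rewrite le_max lexx orbT.
  - by apply: le_trans hM _; rewrite ge_min lexx orbT.
- move=> u u01; have : hull s (s ord0 + u *: (s ord_max - s ord0)) by exact: segment_point.
  move=> su; move: (su); rewrite sE => -[t /= txs tu]; exists t => //.
  by have := tP _ _ txs tu; rewrite aff_eval_add_scale h0 h1 subr0 mulr1 add0r.
Qed.

Lemma bd_at_cat v (p q : formal_sum K G 1) : bd_at v (p ++ q) = bd_at v p + bd_at v q.
Proof. by rewrite /bd_at big_cat. Qed.

Lemma bd_at_chain_eq v (p q : formal_sum K G 1) : chain_eq p q -> bd_at v p = bd_at v q.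
Proof.
elim=> {p q} [//|//|p q r _ -> _ ->//|p p' q q' _ pp _ qq|p q|x|g h x|g x y|g x xs].
- by rewrite !bd_at_cat pp qq.
- by rewrite !bd_at_cat addrC.
- by rewrite /bd_at big_seq1 big_nil /= !if_same subrr.
- rewrite /bd_at big_cons !big_seq1 /=.
  by rewrite addrACA -opprD; congr (_ - _); case: ifP; rewrite ?addr0.
- exact: bd_at_reverse.
- exact: bd_at_subdivision.
Qed.

Lemma bd_at_boundary v (q : formal_sum K G 2) : bd_at v (boundary q) = 0.
Proof.
elim: q => [|[g x] q ih]; first by rewrite /bd_at /boundary big_nil.
have -> : boundary ((g, x) :: q) = boundary [:: (g, x)] ++ boundary q.
  by rewrite /boundary /= cats0.
rewrite bd_at_cat ih addr0 /bd_at /boundary /= cats0 big_map big_enum /=.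
rewrite !big_ord_recl big_ord0 /= !ffunE addr0.
have -> : x (lift ord0 ord_max) = x ord_max by congr (x _); exact: val_inj.
have -> : x (lift ord0 ord0) = x (inord 1) by congr (x _); apply: val_inj; rewrite /= inordK.
have -> : x (lift (lift ord0 ord0) ord_max) = x ord_max by congr (x _); exact: val_inj.
have -> : x (lift (lift ord0 ord0) ord0) = x ord0 by congr (x _); exact: val_inj.
have -> : x (lift (lift ord0 (lift ord0 ord0)) ord_max) = x (inord 1).
  by congr (x _); apply: val_inj; rewrite /= inordK.
have -> : x (lift (lift ord0 (lift ord0 ord0)) ord0) = x ord0 by congr (x _); exact: val_inj.
have ifN (b : bool) : (if b then - g else 0) = - (if b then g else 0) by case: b; rewrite ?oppr0.
rewrite !ifN opprK [X in _ + X]addrACA subrr addr0 addrACA subrr add0r addNr//.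
Qed.

End OneChainBoundary.

(** * Lifts of coefficients from the circle to the line *)

Section CircleLifts.
Variables (R : realType) (d : nat) (K : set 'rV[R]_d).
Local Notation RG := (real_group R).
Local Notation SG := (circle_group R).

Lemma circle_proj_eq0 (x : R) : circle_proj x = 0 <-> x \is a Num.int.
Proof.
rewrite -[0](raddf0 (@circle_proj R)) circle_proj_eqP subr0.
by split=> [[m ->]|/intrP[m ->]]; [exact: intr_int|exists m].
Qed.

Lemma circle_proj_frac (g : circle R) : circle_proj (Defs.frac (repr g)) = g.
Proof.
rewrite -[RHS]circle_projK; apply/circle_proj_eqP.
by exists (- Num.floor (repr g)); rewrite /Defs.frac addrC addKr intrN.
Qed.

Lemma lift_formal_sum k (s : formal_sum K SG k) : exists s' : formal_sum K RG k,
  push_sum s' = s /\ sum_mass s' = sum_mass s.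
Proof.
have /choice[f fP] : forall g : circle R, exists x, circle_proj x = g /\ `|x| = circle_norm g.
  by move=> g; have [x h1 h2] := circle_norm_lift g; exists x.
exists [seq (f e.1 : RG, e.2) | e <- s]; split.
  by rewrite /push_sum -map_comp map_id_in// => -[g x] _ /=; rewrite (fP g).1.
by rewrite /sum_mass big_map; apply: eq_bigr => e _ /=; rewrite (fP e.1).2.
Qed.

(* With theta in [0, 1] representing the coefficient of an edge, the lift
   theta - nu with nu in {0, 1} has norm theta + (1 - 2 theta) nu, which is linear
   in nu; at nu = theta it equals 2 theta (1 - theta) <= 2 min(theta, 1 - theta). *)
Lemma lift_cycle (s : formal_sum K SG 1) : (forall v, bd_at v s = 0) ->
  exists s' : formal_sum K RG 1, [/\ push_sum s' = s, forall v, bd_at v s' = 0 &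
    (sum_mass s' <= 2%:E * sum_mass s)%E].
Proof.
move=> s0; pose t := in_tuple s; pose n := size s.
pose pt i (e : SG * simplex K 1) : 'rV[R]_d := e.2 i.
(* The graph to which the rounding is applied has the positions in [s] as edges and the endpoints of
   the segments as vertices. *)
pose pts := [seq pt ord0 e | e <- s] ++ [seq pt ord_max e | e <- s].
have tl_pts (i : 'I_n) : (tnth t i).2 ord0 \in pts.
  by rewrite mem_cat; apply/orP; left; apply/mapP; exists (tnth t i) => //; exact: mem_tnth.
have hd_pts (i : 'I_n) : (tnth t i).2 ord_max \in pts.
  by rewrite mem_cat; apply/orP; right; apply/mapP; exists (tnth t i) => //; exact: mem_tnth.
pose tl i : seq_sub pts := SeqSub (tl_pts i); pose hd i : seq_sub pts := SeqSub (hd_pts i).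
have hd_tl i : hd i != tl i by rewrite -val_eqE /= eq_sym segment_neq.
pose theta (i : 'I_n) : R := Defs.frac (repr (tnth t i).1).
have th01 i : 0 <= theta i <= 1 by have /andP[-> /ltW ->] := frac_itv (repr (tnth t i).1).
have thE i : circle_proj (theta i) = (tnth t i).1 by exact: circle_proj_frac.
have sumE (F : SG * simplex K 1 -> \bar R) : (\sum_(e <- s) F e = \sum_(i < n) F (tnth t i))%E.
  by rewrite big_tnth.
have bdE (A : zmodType) (v : seq_sub pts) (y : 'I_n -> A) :
    bd_at (val v) [seq (y i, (tnth t i).2) | i <- enum 'I_n] =
    \sum_i ((if hd i == v then y i else 0) - (if tl i == v then y i else 0)).
  by rewrite /bd_at big_map big_enum.
have mulb (b : bool) (x : R) : b%:R * x = if b then x else 0 by case: b; rewrite ?mul1r ?mul0r.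
have divP v : \sum_i ((hd i == v)%:R - (tl i == v)%:R) * theta i \is a Num.int.
  apply/circle_proj_eq0; rewrite raddf_sum -[RHS](s0 (val v)).
  have sE : s = [seq ((tnth t i).1, (tnth t i).2) | i <- enum 'I_n].
    rewrite -[LHS](map_tnth_enum t); apply: eq_map => i; exact: surjective_pairing.
  rewrite [in RHS]sE bdE; apply: eq_bigr => i _.
  rewrite mulrBl raddfB !mulb -thE.
  by congr (_ - _); case: ifP => //; rewrite raddf0.
pose H (i : 'I_n) := fine (hausdorff 1 (hull (tnth t i).2)).
have HE i : hausdorff 1 (hull (tnth t i).2) = (H i)%:E.
  by rewrite fineK// ge0_fin_numE ?hausdorff_ge0// hausdorff_simplex_lty.
have H0 i : 0 <= H i by exact/fine_ge0/hausdorff_ge0.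
have [nu [nudiv nuc]] := integral_rounding hd_tl (fun i => H i * (1 - 2 * theta i)) th01 divP.
pose y i : RG := theta i - (nu i)%:R.
exists [seq (y i, (tnth t i).2) | i <- enum 'I_n]; split.
- rewrite /push_sum -map_comp -[RHS](map_tnth_enum t); apply: eq_map => i /=.
  have nu0 : circle_proj (nu i)%:R = 0 :> circle R.
    by apply/circle_proj_eq0; case: (nu i); rewrite ?int_num1 ?int_num0.
  have -> : circle_proj (y i) = (tnth t i).1.
    transitivity (circle_proj (theta i) - circle_proj (nu i)%:R);
      first exact: (raddfB (@circle_proj R)).
    by rewrite nu0 subr0 thE.
  by rewrite -surjective_pairing.
- move=> v; have [vp|vp] := boolP (v \in pts).
    rewrite (bdE _ (SeqSub vp)) (eq_bigr
      (fun i => ((hd i == SeqSub vp)%:R - (tl i == SeqSub vp)%:R) * theta i -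
        ((hd i == SeqSub vp)%:R - (tl i == SeqSub vp)%:R) * (nu i)%:R)); last first.
      by move=> i _; rewrite -mulrBr mulrBl !mulb.
    by rewrite sumrB nudiv subrr.
  rewrite /bd_at big_map big1// => i _ /=.
  case: eqP => [hv|_]; first by move: vp; rewrite -hv hd_pts.
  by case: eqP => [hv|_]; [move: vp; rewrite -hv tl_pts|rewrite subrr].
have -> : sum_mass s = (\sum_i H i * Num.min (theta i) (1 - theta i))%:E.
  rewrite /sum_mass sumE -sumEFin; apply: eq_bigr => i _.
  by rewrite HE -EFinM mulrC.
have -> : sum_mass [seq (y i, (tnth t i).2) | i <- enum 'I_n] = (\sum_i H i * `|y i|)%:E.
  rewrite /sum_mass big_map big_enum /= -sumEFin; apply: eq_bigr => i _.
  by rewrite HE -EFinM mulrC.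
rewrite -EFinM lee_fin.
have -> : \sum_i H i * `|y i| = \sum_i H i * theta i + \sum_i H i * (1 - 2 * theta i) * (nu i)%:R.
  rewrite -big_split /=; apply: eq_bigr => i _; rewrite -mulrA -mulrDr; congr (_ * _).
  have /andP[h0 h1] := th01 i; rewrite /y; case: (nu i).
    have -> : true%:R = 1 :> R by [].
    by rewrite ler0_norm ?subr_le0//; lra.
  by rewrite subr0 ger0_norm// mulr0 addr0.
apply: le_trans (lerD (lexx _) nuc) _; rewrite -big_split mulr_sumr /=; apply: ler_sum => i _.
have /andP[h0 h1] := th01 i; rewrite -mulrA -mulrDr mulrCA ler_wpM2l//.
have h2 : 0 <= theta i * theta i by rewrite mulr_ge0.
have h3 : 0 <= (1 - theta i) * (1 - theta i) by rewrite mulr_ge0 ?subr_ge0.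
by case: (lerP (theta i) (1 - theta i)) => _; lra.
Qed.

End CircleLifts.

(** * Segments and triangles *)

Section SegmentsTriangles.
Variables (R : realType) (d : nat) (K : set 'rV[R]_d).
Hypothesis K_convex : convex_set K.
Local Open Scope quotient_scope.

Lemma convex_conv (x y : 'rV[R]_d) (l : R) : K x -> K y -> 0 <= l <= 1 -> K (x + l *: (y - x)).
Proof.
move=> Kx Ky /andP[l0 l1].
have := K_convex (Itv01 l0 l1) (mem_set Ky) (mem_set Kx); rewrite inE; congr K.
transitivity (l *: y + (1 - l) *: x); first by [].
by rewrite scalerBr scalerBl scale1r addrCA.
Qed.

Lemma hull_convex n (p : 'I_n -> 'rV[R]_d) : (forall i, K (p i)) -> hull p `<=` K.
Proof.
elim: n p => [|n ih] p Kp _ [w [w0 w1 ->]].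
  by move: w1; rewrite big_ord0 => /eqP; rewrite eq_sym oner_eq0.
rewrite big_ord_recl; set s := \sum_(i < n) w (lift ord0 i).
have w1' : w ord0 + s = 1 by rewrite -w1 big_ord_recl.
have s0 : 0 <= s by exact: sumr_ge0.
have [s_eq0|s_neq0] := eqVneq s 0.
  have wi0 i : w (lift ord0 i) = 0.
    apply/eqP; move/eqP: s_eq0; rewrite psumr_eq0// => /allP/(_ i); rewrite mem_index_enum.
    by move=> /(_ isT).
  rewrite big1 => [|i _]; last by rewrite wi0 scale0r.
  by rewrite addr0; move: w1'; rewrite s_eq0 addr0 => ->; rewrite scale1r.
pose q := \sum_(i < n) (w (lift ord0 i) / s) *: p (lift ord0 i).
have Kq : K q.
  apply: (ih (fun i => p (lift ord0 i))) => //; exists (fun i => w (lift ord0 i) / s); split=> //.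
    by move=> i; rewrite divr_ge0.
  by rewrite -mulr_suml -/s divff.
have := convex_conv (Kp ord0) Kq (l := s); rewrite s0 -w1' lerDr w0 => /(_ isT); congr K.
have -> : w ord0 = 1 - s by rewrite -w1' addrK.
rewrite scalerBr scalerBl scale1r addrA addrAC; congr (_ + _).
rewrite scaler_sumr; apply: eq_bigr => i _; rewrite scalerA mulrCA divff// mulr1//.
Qed.

Variable G : normedGroup R.

Definition point_seq n (s : seq 'rV[R]_d) : {ffun 'I_n -> 'rV[R]_d} := [ffun i : 'I_n => nth 0 s i].

(* The degenerate simplexes are replaced by 0. *)
Definition simplex_sum k (s : seq 'rV[R]_d) (g : G) : formal_sum K G k :=
  if insub (point_seq k.+1 s) is Some x then [:: (g, x : simplex K k)] else [::].

Definition simplex_chain k (s : seq 'rV[R]_d) (g : G) : polychain K G k :=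
  \pi_(polychain K G k) (simplex_sum k s g).

Lemma simplex_chainE k s g : simplex_chain k s g =
  if insub (point_seq k.+1 s) is Some x then cell g (x : simplex K k) else 0.
Proof. by rewrite /simplex_chain /simplex_sum; case: insub. Qed.

Lemma simplex_chainD k s g h :
  simplex_chain k s (g + h) = simplex_chain k s g + simplex_chain k s h.
Proof. by rewrite !simplex_chainE; case: insub => [x|]; rewrite ?cellD ?addr0. Qed.

Lemma simplex_chain0 k s : simplex_chain k s 0 = 0.
Proof. by rewrite simplex_chainE; case: insub => [x|]; rewrite ?cell0. Qed.

Lemma simplex_chainN k s g : simplex_chain k s (- g) = - simplex_chain k s g.
Proof. by apply/eqP; rewrite -addr_eq0 -simplex_chainD addNr simplex_chain0. Qed.

Lemma simplex_chain_sum k s I (r : seq I) (F : I -> G) :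
  simplex_chain k s (\sum_(i <- r) F i) = \sum_(i <- r) simplex_chain k s (F i).
Proof.
elim: r => [|i r ih]; first by rewrite !big_nil simplex_chain0.
by rewrite !big_cons simplex_chainD ih.
Qed.

Lemma insub_point_seq k (s : seq 'rV[R]_d) (x : simplex K k) :
  (forall i : 'I_k.+1, x i = nth 0 s i) -> insub (point_seq k.+1 s) = Some x.
Proof.
move=> xE; have -> : point_seq k.+1 s = val x by apply/ffunP => i; rewrite ffunE -xE.
exact: valK.
Qed.

Lemma point_seq_simplex k (s : seq 'rV[R]_d) : (forall i : 'I_k.+1, K (nth 0 s i)) ->
  aff_indep (point_seq k.+1 s) ->
  exists2 x : simplex K k, insub (point_seq k.+1 s) = Some x & forall i, x i = nth 0 s i.
Proof.
move=> Ks ind; have h : `[< aff_indep (point_seq k.+1 s) /\ hull (point_seq k.+1 s) `<=` K >].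
  by apply/asboolP; split=> //; apply: hull_convex => i; rewrite ffunE.
exists (Simplex h); last by move=> i; rewrite /= ffunE.
by apply: insub_point_seq => i; rewrite /= ffunE.
Qed.

Lemma cellN k (g : G) (x : simplex K k) : cell (- g) x = - cell g x.
Proof. by apply/eqP; rewrite -addr_eq0 -cellD addNr cell0. Qed.

Definition segment_chain (a b : 'rV[R]_d) (g : G) : polychain K G 1 := simplex_chain 1 [:: a; b] g.

Lemma cell_segment (x : simplex K 1) g : cell g x = segment_chain (x ord0) (x ord_max) g.
Proof.
rewrite /segment_chain simplex_chainE (@insub_point_seq 1 _ x)// => i.
by case: i => [[|[|//]] hi] /=; congr (x _); exact: val_inj.
Qed.

Lemma segment_chain_same a g : segment_chain a a g = 0.
Proof.
rewrite /segment_chain simplex_chainE; case: insubP => // x _ xE; exfalso.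
have := segment_neq x; rewrite -[vertices x]/(val x) xE !ffunE /= eqxx//.
Qed.

Lemma segment_simplex a b : K a -> K b -> a != b ->
  exists x : simplex K 1, x ord0 = a /\ x ord_max = b.
Proof.
move=> Ka Kb ab; have [||x _ xE] := @point_seq_simplex 1 [:: a; b].
- by case=> [[|[|//]]].
- move=> c; rewrite !sum_ord2 !ffunE /= => c01 cab.
  have c1 : c ord_max = 0.
    move/eqP: cab; have -> : c ord0 = - c ord_max by apply/eqP; rewrite -addr_eq0 c01.
    rewrite scaleNr addrC -scalerBr scaler_eq0 subr_eq0 [b == a]eq_sym (negbTE ab) orbF.
    by move/eqP.
  have c0 : c ord0 = 0 by move: c01; rewrite c1 addr0.
  by move=> [[|[|//]] h]; [rewrite -[RHS]c0|rewrite -[RHS]c1]; congr c; exact: val_inj.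
by exists x; rewrite !xE.
Qed.

Lemma segment_chain_rev a b g : K a -> K b -> segment_chain b a g = - segment_chain a b g.
Proof.
move=> Ka Kb; have [->|ab] := eqVneq a b; first by rewrite !segment_chain_same oppr0.
have [x [x0 x1]] := segment_simplex Ka Kb ab.
have [x' [hx' _ xx']] := swap_vertices x.
have [E1 E0] := opposite_vertices (esym hx') xx'.
rewrite -x0 -x1 -cell_segment E0 E1 -cell_segment.
have -> : cell g x = cell (- g) x'.
  by apply/polychain_eqP; apply: chain_eq_reverse => //; rewrite hx'.
by rewrite -cellN opprK.
Qed.

Lemma segment_chain_split a b l g : K a -> K b -> 0 <= l <= 1 ->
  segment_chain a b g = segment_chain a (a + l *: (b - a)) g + segment_chain (a + l *: (b - a)) b g.
Proof.
move=> Ka Kb /andP[l0 l1].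
have [->|ab] := eqVneq a b; first by rewrite subrr scaler0 addr0 segment_chain_same addr0.
have [->|l0'] := eqVneq l 0; first by rewrite scale0r addr0 segment_chain_same add0r.
have [->|l1'] := eqVneq l 1; first by rewrite scale1r [a + _]addrC subrK segment_chain_same addr0.
have [x [x0 x1]] := segment_simplex Ka Kb ab.
have [||||s1 [s2 [s1j s1l s2i s2l /refines_subdivision xs]]] :=
  @bisect _ _ _ _ x ord0 ord_max (1 - l) l.
- by [].
- by rewrite subr_gt0 lt_neqAle l1'.
- by rewrite lt_neqAle eq_sym l0'.
- by rewrite subrK.
have mE : (1 - l) *: x ord0 + l *: x ord_max = a + l *: (b - a).
  by rewrite x0 x1 scalerBl scale1r scalerBr addrAC -addrA.
rewrite -[in LHS]x0 -[in LHS]x1 -cell_segment (cell_subdivision g xs) big_cons big_seq1.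
by rewrite !cell_segment s1j s2i mE s1l// s2l// x0 x1.
Qed.

Definition triangle_boundary (a b c : 'rV[R]_d) g :=
  segment_chain b c g - segment_chain a c g + segment_chain a b g.

Lemma collinear_boundary a b c (l : R) g : K a -> K c -> 0 <= l <= 1 ->
  b = a + l *: (c - a) ->
  [/\ triangle_boundary a b c g = 0, triangle_boundary b a c g = 0 & triangle_boundary a c b g = 0].
Proof.
move=> Ka Kc l01 bE; have Kb : K b by rewrite bE; exact: convex_conv.
have E : segment_chain a c g = segment_chain a b g + segment_chain b c g by rewrite bE;
  exact: segment_chain_split.
rewrite /triangle_boundary E (segment_chain_rev _ Ka Kb) (segment_chain_rev _ Kb Kc) !opprD; split.
- by rewrite addrCA subrr addr0 addNr.
- by rewrite addrK subrr.
- by rewrite [X in _ + X]addrC addrACA !addNr addr0.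
Qed.

Lemma sum_ord3 (V : nmodType) (F : 'I_3 -> V) :
  \sum_i F i = F ord0 + F (lift ord0 ord0) + F ord_max.
Proof. by rewrite big_ord_recl sum_ord2 addrA; congr (_ + _ + F _); exact: val_inj. Qed.

(** In an affine dependence of three points, one nonzero coefficient is opposite in sign to the
    other two, so its point lies between the other two points and the segments cancel. Degenerate
    triangles can therefore be dropped without changing the formula for the boundary. *)
Lemma triangle_boundary_degenerate a b c g : K a -> K b -> K c ->
  ~ aff_indep (point_seq 3 [:: a; b; c]) -> triangle_boundary a b c g = 0.
Proof.
move=> Ka Kb Kc /existsNP[w] /not_implyP[w0] /not_implyP[wp] /existsNP[i /eqP wi].
move: w0 wp; rewrite !sum_ord3 !ffunE /=.
set u := w ord0; set v := w (lift ord0 ord0); set t := w ord_max => uvt uvtp.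
have nz : ~ [/\ u = 0, v = 0 & t = 0].
  move=> [u0 v0 t0]; case/eqP: wi; case: i => [[|[|[|//]]] hi].
  - by rewrite -u0; congr w; exact: val_inj.
  - by rewrite -v0; congr w; exact: val_inj.
  - by rewrite -t0; congr w; exact: val_inj.
have mid (p q r : 'rV[R]_d) (x y z : R) : x + y + z = 0 -> x *: p + y *: q + z *: r = 0 ->
    y != 0 -> x * y <= 0 -> z * y <= 0 -> exists2 l, 0 <= l <= 1 & q = p + l *: (r - p).
  move=> xyz xyzp y0 xy zy; exists (- z / y).
    have y2 : 0 < y * y by rewrite -expr2 exprn_even_gt0.
    have -> : - z / y = (- (z * y)) / (y * y) by field.
    rewrite divr_ge0 ?oppr_ge0 ?(ltW y2)//= ler_pdivrMr// mul1r.
    have : (x + y + z) * y = 0 by rewrite xyz mul0r.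
    rewrite !mulrDl; lra.
  have -> : q = (- x / y) *: p + (- z / y) *: r.
    have : y^-1 *: (x *: p + y *: q + z *: r) = 0 by rewrite xyzp scaler0.
    rewrite !scalerDr !scalerA mulVf// scale1r => /eqP; rewrite addrAC addrC addr_eq0 => /eqP ->.
    have e1 : - x / y = - (y^-1 * x) by field.
    have e2 : - z / y = - (y^-1 * z) by field.
    by rewrite e1 e2 opprD !scaleNr.
  have -> : - x / y = 1 - - z / y.
    have -> : x = - y - z by lra.
    by field.
  by rewrite scalerBr scalerBl scale1r addrAC -addrA.
have [h|[h|h]] : (v != 0 /\ u * v <= 0 /\ t * v <= 0) \/
    (u != 0 /\ v * u <= 0 /\ t * u <= 0) \/ (t != 0 /\ u * t <= 0 /\ v * t <= 0).
  have sgn (x y z : R) : x + y + z = 0 -> 0 <= x -> 0 <= y -> z != 0 -> x * z <= 0 /\ y * z <= 0.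
    move=> xyz x0 y0 _; have z0 : z <= 0 by lra.
    by rewrite !mulr_ge0_le0.
  have sgn' (x y z : R) : x + y + z = 0 -> x <= 0 -> y <= 0 -> z != 0 -> x * z <= 0 /\ y * z <= 0.
    move=> xyz x0 y0 _; have z0 : 0 <= z by lra.
    by rewrite !mulr_le0_ge0.
  have [u0|u0] := eqVneq u 0.
    have vt : v != 0 by apply/eqP => v0; apply: nz; split=> //; lra.
    left; split=> //; rewrite u0 mul0r; split=> //.
    have -> : t = - v by lra.
    by rewrite mulNr oppr_le0 -expr2 sqr_ge0.
  have [v0|v0] := eqVneq v 0.
    right; left; split=> //; rewrite v0 mul0r; split=> //.
    have -> : t = - u by lra.
    by rewrite mulNr oppr_le0 -expr2 sqr_ge0.
  have [t0|t0] := eqVneq t 0.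
    left; split=> //; rewrite t0 mul0r; split=> //.
    have -> : u = - v by lra.
    by rewrite mulNr oppr_le0 -expr2 sqr_ge0.
  case: (lerP 0 u) => hu; case: (lerP 0 v) => hv; case: (lerP 0 t) => ht.
  - lra.
  - by right; right; split=> //; apply: sgn.
  - by left; split=> //; apply: sgn => //; lra.
  - by right; left; split=> //; apply: sgn' => //; lra.
  - by right; left; split=> //; apply: sgn => //; lra.
  - by left; split=> //; apply: sgn' => //; lra.
  - by right; right; split=> //; apply: sgn' => //; lra.
  - lra.
- have [v0 [uv tv]] := h; have [l l01 bE] := mid _ _ _ _ _ _ uvt uvtp v0 uv tv.
  by have [] := collinear_boundary g Ka Kc l01 bE.
- have [u0 [vu tu]] := h; have [||l l01 aE] := mid b a c v u t _ _ u0 vu tu.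
  + by rewrite [v + u]addrC.
  + by rewrite [v *: _ + _]addrC.
  + by have [] := collinear_boundary g Kb Kc l01 aE.
- have [t0 [ut vt]] := h; have [||l l01 cE] := mid a c b u t v _ _ t0 ut vt.
  + by rewrite addrAC.
  + by rewrite addrAC.
  + by have [] := collinear_boundary g Ka Kb l01 cE.
Qed.

Definition boundary_chain k (q : formal_sum K G k.+1) : polychain K G k :=
  \pi_(polychain K G k) (boundary q).

Lemma boundary_chain_cat k (p q : formal_sum K G k.+1) :
  boundary_chain (p ++ q) = boundary_chain p + boundary_chain q.
Proof. by rewrite /boundary_chain boundary_cat pi_cat. Qed.

Lemma boundary_chain_flatten k I (r : seq I) (F : I -> formal_sum K G k.+1) :
  boundary_chain (flatten [seq F i | i <- r]) = \sum_(i <- r) boundary_chain (F i).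
Proof.
elim: r => [|i r ih]; first by rewrite big_nil /boundary_chain /boundary /= pi_sum big_nil.
by rewrite big_cons -ih /= boundary_chain_cat.
Qed.

Definition triangle_sum (a b c : 'rV[R]_d) (g : G) : formal_sum K G 2 :=
  simplex_sum 2 [:: a; b; c] g.

Lemma boundary_triangle a b c g : K a -> K b -> K c ->
  boundary_chain (triangle_sum a b c g) = triangle_boundary a b c g.
Proof.
move=> Ka Kb Kc; have [ind|nind] := pselect (aff_indep (point_seq 3 [:: a; b; c])); last first.
  rewrite triangle_boundary_degenerate// /triangle_sum /simplex_sum; case: insubP => [x hx|_].
    by case/asboolP: hx => /nind.
  by rewrite /boundary_chain /boundary /= pi_sum big_nil.
have [||x xE xs] := @point_seq_simplex 2 [:: a; b; c]; last 1 first.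
- rewrite /triangle_sum /simplex_sum xE /boundary_chain /boundary /= cats0 pi_sum big_map big_enum.
  rewrite sum_ord3 /= !cell_segment !ffunE !xs /= /triangle_boundary.
  by rewrite /segment_chain !simplex_chainN.
- by case=> [[|[|[|//]]]].
- by [].
Qed.

(** The constant of [hausdorff_box] for [k = 2], times 4: with [eta] the smaller of the lengths of
    the two edges, adding [eta] at most doubles each length. *)
Definition area_const : R := ball_volume R 2 * (d%:R * 2 / 2) ^+ 2 * 4.

Lemma area_const_ge0 : 0 <= area_const.
Proof.
apply: mulr_ge0 => //; apply: mulr_ge0; first exact: ball_volume_ge0.
by rewrite exprn_ge0// divr_ge0// mulr_ge0.
Qed.

Lemma sum_mass_triangle a b c g :
  (sum_mass (triangle_sum a b c g) <= (ng_norm g * (area_const * (`|b - a| * `|c - b|)))%:E)%E.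
Proof.
rewrite /triangle_sum /simplex_sum; case: insubP => [x _ xE|_]; last first.
  by rewrite sum_mass_nil lee_fin mulr_ge0 ?ng_norm_ge0// mulr_ge0 ?area_const_ge0// mulr_ge0.
rewrite /sum_mass big_seq1 /= EFinM lee_wpmul2l ?lee_fin ?ng_norm_ge0//.
have xs i : x i = nth 0 [:: a; b; c] i by rewrite -[vertices x]/(val x) xE ffunE.
have := @simplex_indep _ _ _ _ x => ind.
have xinj i j : i != j -> x i != x j.
  move=> ij; have [bc bE] := barycentric ind; apply/eqP => e.
  have := bE i j; rewrite -e bE eqxx (negbTE ij) => /eqP; rewrite oner_eq0//.
have ab : 0 < `|b - a|.
  by rewrite normr_gt0 subr_eq0; have := xinj (lift ord0 ord0) ord0 isT; rewrite !xs.
have bc : 0 < `|c - b|.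
  by rewrite normr_gt0 subr_eq0; have := xinj ord_max (lift ord0 ord0) isT; rewrite !xs.
pose e (i : 'I_2) := if i == ord0 then b - a else c - b.
apply: le_trans (hausdorff_box (p := a) (e := e) (eta := Num.min `|b - a| `|c - b|) _ _) _.
- by rewrite lt_min ab.
- move=> _ [w [w0 w1 ->]]; move: w1; rewrite sum_ord3 => w1.
  exists (fun i => if i == ord0 then w (lift ord0 ord0) + w ord_max else w ord_max).
    have := w0 ord0; have := w0 (lift ord0 ord0); have := w0 ord_max => h1 h2 h3.
    by move=> i; case: ifP => _; apply/andP; split; lra.
  rewrite sum_ord3 sum_ord2 /e /= !xs /=.
  have -> : w ord0 = 1 - (w (lift ord0 ord0) + w ord_max) by lra.
  by apply/rowP => i; rewrite !mxE; ring.
rewrite lee_fin /area_const -[leRHS]mulrA ler_wpM2l//.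
  apply: mulr_ge0; first exact: ball_volume_ge0.
  by rewrite exprn_ge0// divr_ge0// mulr_ge0.
rewrite big_ord_recl big_ord1 /e /=.
apply: (@le_trans _ _ ((`|b - a| + `|b - a|) * (`|c - b| + `|c - b|))).
  apply: ler_pM; rewrite ?lerD2l ?addr_ge0// ?le_min ?normr_ge0// ge_min lexx ?orbT//.
by rewrite mulrDl !mulrDr; lra.
Qed.

End SegmentsTriangles.

(** * Approximation of cycles by chains on a finite net *)

Section PartitionOfUnity.
Variable R : realType.

Definition clamp n (t : R) : R := Num.min n%:R (Num.max 0 t).

Definition ramp (t : R) : R := Num.min 1 (Num.max 0 t).

Lemma clamp_lipschitz n (s t : R) : s <= t -> clamp n t - clamp n s <= t - s.
Proof.
move=> st; have n0 : 0 <= n%:R :> R by [].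
rewrite /clamp; case: (leP 0 s) => ?; case: (leP 0 t) => ?.
- by case: (leP n%:R s) => ?; case: (leP n%:R t) => ?; lra.
- by exfalso; lra.
- by case: (leP n%:R t) => ?; case: (leP n%:R 0) => ?; lra.
- by case: (leP n%:R 0) => ?; lra.
Qed.

Lemma ramp_cases t : [\/ t <= 0 /\ ramp t = 0, 0 <= t <= 1 /\ ramp t = t | 1 <= t /\ ramp t = 1].
Proof.
rewrite /ramp; case: (leP 0 t) => t0; last by constructor 1; split;
  [exact: ltW|case: (leP 1 0) => //; rewrite ler10].
case: (leP 1 t) => t1; first by constructor 3.
by constructor 2; split=> //; exact: ltW.
Qed.

Lemma clamp_cases n t :
  [\/ t <= 0 /\ clamp n t = 0, 0 <= t <= n%:R /\ clamp n t = t | n%:R <= t /\ clamp n t = n%:R].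
Proof.
have n0 : 0 <= n%:R :> R by [].
rewrite /clamp; case: (leP 0 t) => t0.
  case: (leP n%:R t) => t1; first by constructor 3.
  by constructor 2; split=> //; exact: ltW.
by constructor 1; split; [exact: ltW|case: (leP n%:R 0) => // ?; lra].
Qed.

Lemma ramp_le (s t : R) : s <= t -> ramp s <= ramp t.
Proof.
by move=> st; have := ramp_cases s; have := ramp_cases t; case=> -[? ->]; case=> -[? ->]; lra.
Qed.

Lemma sum_ramp n (t : R) : \sum_(m < n) ramp (t - m%:R) = clamp n t.
Proof.
elim: n => [|n ih].
  by rewrite big_ord0; case: (clamp_cases 0 t) => -[? ->]; lra.
have n0 : 0 <= n%:R :> R by [].
rewrite big_ord_recr /= ih.
have := clamp_cases n.+1 t; have := clamp_cases n t; have := ramp_cases (t - n%:R).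
by rewrite -natr1; case=> -[? ->]; case=> -[? ->]; case=> -[? ->]; lra.
Qed.

(** The tent function max(0, 1 - |t|), written as a difference of ramps so that sums over integer
    translates reduce to clamps. *)
Definition hat (t : R) : R := ramp (t + 1) - ramp t.

Lemma hat_ge0 t : 0 <= hat t.
Proof. by rewrite subr_ge0 ramp_le// lerDl. Qed.

Lemma hat_neq0 t : hat t != 0 -> `|t| < 1.
Proof.
apply: contraNT; rewrite -leNgt lter_normr => /orP[h|h]; apply/eqP.
  by rewrite /hat; case: (ramp_cases (t + 1)) => -[? ->]; case: (ramp_cases t) => -[? ->]; lra.
by rewrite /hat; case: (ramp_cases (t + 1)) => -[? ->]; case: (ramp_cases t) => -[? ->]; lra.
Qed.

Lemma sum_hat n (t : R) : 0 <= t <= n%:R -> \sum_(m < n.+1) hat (t - m%:R) = 1.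
Proof.
move=> /andP[t0 tn]; rewrite /hat sumrB sum_ramp.
under eq_bigr do rewrite addrAC.
have n1 : n.+1%:R = n%:R + 1 :> R by rewrite natr1.
have := clamp_cases n.+1 (t + 1); have := clamp_cases n.+1 t.
rewrite sum_ramp n1 => h1 h2.
by case: h1 => -[? ->]; case: h2 => -[? ->]; lra.
Qed.

(** For [t <= s] each term is at most the sum of the increments of two monotone ramps. Summed over
    [m], these are increments of clamps, which are 1-Lipschitz, so the bound does not depend on
    [n]. *)
Lemma hat_variation n (s t : R) :
  \sum_(m < n) `|hat (s - m%:R) - hat (t - m%:R)| <= 2 * `|s - t|.
Proof.
wlog st : s t / t <= s.
  move=> wl; case: (leP t s) => [|/ltW] ts; first exact: wl.
  by rewrite [`|s - t|]distrC; under eq_bigr do rewrite distrC; exact: wl.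
rewrite ger0_norm ?subr_ge0//.
apply: (@le_trans _ _ (\sum_(m < n) ((ramp (s + 1 - m%:R) - ramp (t + 1 - m%:R)) +
    (ramp (s - m%:R) - ramp (t - m%:R))))).
  apply: ler_sum => m _.
  have h1 : ramp (t - m%:R) <= ramp (s - m%:R) by rewrite ramp_le// lerD2r.
  have h2 : ramp (t + 1 - m%:R) <= ramp (s + 1 - m%:R) by rewrite ramp_le// !lerD2r.
  rewrite /hat ![_ - _ + 1]addrAC ler_norml; apply/andP; split; lra.
rewrite big_split /= !sumrB !sum_ramp.
have h1 := clamp_lipschitz n st.
have st1 : t + 1 <= s + 1 by rewrite lerD2r.
have h2 := clamp_lipschitz n st1; lra.
Qed.

Lemma prod_variation_le n (a b : 'I_n -> R) : (forall i, 0 <= a i) -> (forall i, 0 <= b i) ->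
  `|\prod_i a i - \prod_i b i| <=
  \sum_(k < n) \prod_(i < n) (if (i < k)%N then b i else if i == k then `|a i - b i| else a i).
Proof.
elim: n a b => [|n ih] a b a0 b0; first by rewrite !big_ord0 subrr normr0.
rewrite !big_ord_recl; set A := \prod_(i < n) a _; set B := \prod_(i < n) b _.
have A0 : 0 <= A by exact: prodr_ge0.
have -> : a ord0 * A - b ord0 * B = (a ord0 - b ord0) * A + b ord0 * (A - B) by ring.
apply: le_trans (ler_normD _ _) _; rewrite !normrM (ger0_norm A0) (ger0_norm (b0 _)).
apply: lerD; first by rewrite eqxx.
apply: le_trans (ler_wpM2l (b0 ord0) (ih _ _ (fun i => a0 _) (fun i => b0 _))) _.
rewrite mulr_sumr; apply: ler_sum => k _; rewrite big_ord_recl /=.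
rewrite le_eqVlt; apply/orP; left; apply/eqP; congr (_ * _); apply: eq_bigr => i _.
Qed.

(** The factors are exchanged one at a time. Summed over all [h], the [k]-th of the resulting
    products factorizes, and each factor except the [k]-th sums to 1. *)
Lemma prod_variation n (J : finType) (f g : 'I_n -> J -> R) :
  (forall i j, 0 <= f i j) -> (forall i j, 0 <= g i j) ->
  (forall i, \sum_j f i j = 1) -> (forall i, \sum_j g i j = 1) ->
  \sum_(h : {ffun 'I_n -> J}) `|\prod_i f i (h i) - \prod_i g i (h i)| <=
  \sum_i \sum_j `|f i j - g i j|.
Proof.
move=> f0 g0 f1 g1.
pose F (k i : 'I_n) j := if (i < k)%N then g i j else if i == k then `|f i j - g i j| else f i j.
apply: (@le_trans _ _ (\sum_(h : {ffun 'I_n -> J}) \sum_k \prod_i F k i (h i))).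
  by apply: ler_sum => h _; exact: prod_variation_le.
rewrite exchange_big /=; apply: ler_sum => k _.
rewrite -bigA_distr_bigA (bigD1 k)//= [X in _ * X]big1 ?mulr1.
  by apply: ler_sum => j _; rewrite /F ltnn eqxx.
move=> i /negbTE ik; case: (ltnP i k) => h.
  by under eq_bigr do rewrite /F h; exact: g1.
by under eq_bigr do rewrite /F ltnNge h /= ik; exact: f1.
Qed.

Variable d : nat.

(* Tensor products of hat functions on a cubic grid of mesh e; the points p i are
   chosen in K, within distance 2 e of the support of rho i. *)
Lemma partition_of_unity (K : set 'rV[R]_d) (B : R) (x0 : 'rV[R]_d) (e : R) :
  K x0 -> (forall x, K x -> `|x| <= B) -> 0 < e ->
  exists (I : finType) (p : I -> 'rV[R]_d) (rho : 'rV[R]_d -> I -> R),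
  [/\ forall i, K (p i), forall x i, 0 <= rho x i,
      forall x, K x -> \sum_i rho x i = 1,
      forall x i, K x -> rho x i != 0 -> `|p i - x| <= 2 * e &
      forall x y, K x -> K y -> \sum_i `|rho x i - rho y i| <= 2 * d%:R / e * `|x - y|].
Proof.
move=> Kx0 KB e0; pose N := (Num.trunc (2 * B / e)).+1.
have B0 : 0 <= B by apply: le_trans (KB _ Kx0).
pose t (x : 'rV[R]_d) (k : 'I_d) := (x 0 k + B) / e.
have t0N x k : K x -> 0 <= t x k <= N%:R.
  move=> Kx; have := le_trans (normr_coord_norm x k) (KB _ Kx); rewrite ler_norml => /andP[h1 h2].
  rewrite /t divr_ge0 ?(ltW e0)//=; last lra.
  apply: le_trans (ltW (truncnS_gt _)); rewrite ler_pM2r ?invr_gt0//; lra.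
pose I := {ffun 'I_d -> 'I_N.+1}.
pose rho (x : 'rV[R]_d) (i : I) := \prod_k hat (t x k - (i k)%:R).
have rho_sum x : K x -> \sum_i rho x i = 1.
  move=> Kx; rewrite -(bigA_distr_bigA (fun k (j : 'I_N.+1) => hat (t x k - j%:R))).
  by rewrite big1// => k _; rewrite sum_hat// t0N.
have rho_t x (i : I) k : rho x i != 0 -> `|t x k - (i k)%:R| < 1.
  by rewrite /rho => /prodf_neq0/(_ k isT); exact: hat_neq0.
(* If the function of index [i] vanishes on [K], any point of [K] will do, and [x0] is the
   default. *)
have /choice[p pP] : forall i : I, exists y,
  K y /\ ((exists2 x, K x & rho x i != 0) -> rho y i != 0).
  move=> i; have [[x Kx xi]|h] := pselect (exists2 x, K x & rho x i != 0); first by exists x.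
  by exists x0; split=> // /h.
exists I, p, rho; split.
- by move=> i; case: (pP i).
- by move=> x i; apply: prodr_ge0 => k _; exact: hat_ge0.
- exact: rho_sum.
- move=> x i Kx xi; have pi0 : rho (p i) i != 0 by case: (pP i) => _; apply; exists x.
  apply: norm_ge_coords => [|k]; first by rewrite mulr_ge0// ltW.
  rewrite !mxE; have h1 := rho_t _ _ k xi; have h2 := rho_t _ _ k pi0.
  have -> : p i 0 k - x 0 k = (t (p i) k - t x k) * e.
    by rewrite /t -mulrBl divfK ?gt_eqF// opprD addrACA subrr addr0.
  rewrite normrM (gtr0_norm e0) ler_pM2r//.
  move: h1 h2; rewrite !ltr_norml ler_norml => /andP[? ?] /andP[? ?]; apply/andP; split; lra.
- move=> x y Kx Ky; apply: le_trans (@prod_variation d _ (fun k (j : 'I_N.+1) => hat (t x k - j%:R))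
    (fun k (j : 'I_N.+1) => hat (t y k - j%:R)) _ _ _ _) _.
  + by move=> *; exact: hat_ge0.
  + by move=> *; exact: hat_ge0.
  + by move=> k; apply: sum_hat; exact: t0N.
  + by move=> k; apply: sum_hat; exact: t0N.
  apply: (@le_trans _ _ (\sum_(k < d) 2 * (`|x - y| / e))).
    apply: ler_sum => k _; apply: le_trans (hat_variation _ _ _) _.
    rewrite ler_pM2l// /t -mulrBl opprD addrACA subrr addr0 normrM (gtr0_norm (_ : 0 < e^-1))
      ?invr_gt0//.
    rewrite ler_pM2r ?invr_gt0//; apply: le_trans (normr_coord_norm _ k).
    by rewrite !mxE.
  rewrite sumr_const card_ord -[leLHS]mulr_natl le_eqVlt; apply/orP; left; apply/eqP.
  by field; rewrite gt_eqF.
Qed.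

End PartitionOfUnity.

(** * Homotopies from cycles to chains on the net *)

Section Approximation.
Variables (R : realType) (d : nat) (K : set 'rV[R]_d).
Hypothesis K_convex : convex_set K.
Local Open Scope quotient_scope.
Local Notation RG := (real_group R).

Lemma sum_mass_cat (G : normedGroup R) k (p q : formal_sum K G k) :
  sum_mass (p ++ q) = (sum_mass p + sum_mass q)%E.
Proof. by rewrite /sum_mass big_cat. Qed.

Lemma sum_mass_flatten (G : normedGroup R) k I (r : seq I) (F : I -> formal_sum K G k) :
  sum_mass (flatten [seq F i | i <- r]) = (\sum_(i <- r) sum_mass (F i))%E.
Proof.
elim: r => [|i r ih]; first by rewrite big_nil sum_mass_nil.
by rewrite big_cons -ih -sum_mass_cat.
Qed.

Variables (I : finType) (p : I -> 'rV[R]_d) (rho : 'rV[R]_d -> I -> R) (e L : R).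
Hypothesis Kp : forall i, K (p i).
Hypothesis rho0 : forall x i, 0 <= rho x i.
Hypothesis rho1 : forall x, K x -> \sum_i rho x i = 1.
Hypothesis rho_p : forall x i, K x -> rho x i != 0 -> `|p i - x| <= 2 * e.
Hypothesis rhoL : forall x y, K x -> K y -> \sum_i `|rho x i - rho y i| <= L * `|x - y|.
Hypothesis e0 : 0 < e.
Hypothesis L0 : 0 <= L.

Local Notation seg := (@segment_chain R d K RG).
Local Notation bdc q := (@boundary_chain R d K RG 1 q).

(** The segments that end at a point [v] of [K] have total coefficient [y]. The value is additive in
    [y], so these cones cancel over the vertices of a cycle. *)
Definition cone_chain (v : 'rV[R]_d) (y : R) : polychain K RG 1 := \sum_i seg (p i) v (y * rho v i).

Definition net_chain (c : I -> I -> R) : polychain K RG 1 := \sum_i \sum_j seg (p i) (p j) (c i j).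

(** The 2 comes from the triangles on [p i], [a], [b], with [|a - p i| <= 2 * e]. The 18 is [6 * 3],
    from the triangles on [p i], [p j], [b]: there [p j] is within [3 * e] of [b] and within [6 * e]
    of [p i], and the coefficients sum to at most [L] times the length of the edge. *)
Definition homotopy_const : R := area_const R d * (2 + 18 * (L * e)).

(* The chain H fills the cycle formed by the edge [a, b], the cones over its
   endpoints, and a chain carried by the finitely many segments [p i, p j]. *)
Definition net_approx (a b : 'rV[R]_d) (len : R) (c : I -> I -> R) : Prop :=
  (forall i j, `|c i j| <= L * len) /\
  forall y : R, exists H : formal_sum K RG 2,
    bdc H = seg a b y + cone_chain a y - cone_chain b y - net_chain (fun i j => y * c i j) /\
    (sum_mass H <= (homotopy_const * e * `|y| * len)%:E)%E.

Lemma rho_le1 x i : K x -> rho x i <= 1.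
Proof. by move=> Kx; rewrite -(rho1 Kx) (bigD1 i)//= lerDl sumr_ge0. Qed.

Lemma homotopy_const_ge0 : 0 <= homotopy_const.
Proof.
rewrite /homotopy_const mulr_ge0 ?area_const_ge0// addr_ge0// !mulr_ge0//; exact: ltW.
Qed.

(** The coefficients [c i j] sum to 0 over [j] and to [rho b j - rho a j] over [i]. The triangles on
    [p i], [a], [b] join the edge and the cone over [a] to the point [b], with weights [rho a];
    those on [p i], [p j], [b] change these weights into [rho b] at the cost of the net chain of
    [c]. *)
Lemma net_approx_short a b : K a -> K b -> `|b - a| <= e ->
  net_approx a b `|b - a| (fun i j => rho a i * (rho b j - rho a j)).
Proof.
move=> Ka Kb abe; pose c i j := rho a i * (rho b j - rho a j).
have rL : \sum_j `|rho b j - rho a j| <= L * `|b - a| by exact: rhoL.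
split=> [i j|y].
  rewrite normrM (ger0_norm (rho0 _ _)); apply: le_trans rL.
  apply: (@le_trans _ _ (1 * `|rho b j - rho a j|)); first by rewrite ler_wpM2r// rho_le1.
  by rewrite mul1r (bigD1 j)//= lerDl sumr_ge0.
pose H1 := flatten [seq triangle_sum K (p i) a b (y * rho a i : RG) | i <- index_enum I].
pose H2 := flatten [seq flatten [seq triangle_sum K (p i) (p j) b (- (y * c i j) : RG) |
   j <- index_enum I] | i <- index_enum I].
exists (H1 ++ H2); split.
  rewrite boundary_chain_cat !boundary_chain_flatten.
  under eq_bigr do rewrite boundary_triangle//.
  under [X in _ + X]eq_bigr do rewrite boundary_chain_flatten.
  under [X in _ + X]eq_bigr do under eq_bigr do rewrite boundary_triangle//.
  rewrite /triangle_boundary.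
  have segN u v g : seg u v (- g) = - seg u v g by exact: simplex_chainN.
  have seg_sum u v (F : I -> R) : \sum_i seg u v (F i) = seg u v (\sum_i F i).
    exact: esym (@simplex_chain_sum _ _ _ RG 1 [:: u; v] _ (index_enum I) F).
  under [X in _ + X]eq_bigr do under eq_bigr do rewrite !segN.
  have E1 : \sum_i (seg a b (y * rho a i) - seg (p i) b (y * rho a i) + seg (p i) a (y * rho a i)) =
      seg a b y - \sum_i seg (p i) b (y * rho a i) + cone_chain a y.
    by rewrite big_split sumrB /= seg_sum -mulr_sumr rho1// mulr1.
  have E2 : \sum_i \sum_j seg (p i) b (y * c i j) = 0.
    apply: big1 => i _; rewrite seg_sum -mulr_sumr -mulr_sumr sumrB !rho1// subrr !mulr0.
    exact: simplex_chain0.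
  have E3 : \sum_i \sum_j seg (p j) b (y * c i j) =
      cone_chain b y - \sum_i seg (p i) b (y * rho a i).
    rewrite exchange_big /= /cone_chain -sumrB; apply: eq_bigr => j _.
    rewrite seg_sum -mulr_sumr -mulr_suml rho1// mul1r mulrBr -segN.
    exact: (@simplex_chainD _ _ _ RG).
  rewrite E1; under [X in _ + X]eq_bigr do rewrite !(big_split, sumrN) /=.
  rewrite !sumrB !sumrN E3 E2 oppr0 subr0 opprB addrA; congr (_ - _).
  by rewrite addrA [_ + cone_chain a y]addrAC subrK.
rewrite sum_mass_cat !sum_mass_flatten.
under [X in (_ + X)%E]eq_bigr do rewrite sum_mass_flatten.
apply: (@le_trans _ _ ((\sum_i `|y| * rho a i * (area_const R d * (2 * e * `|b - a|))) +
   \sum_i \sum_j `|y| * `|c i j| * (area_const R d * (6 * e * (3 * e))))%:E).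
  rewrite EFinD -!sumEFin; apply: leeD.
    apply: lee_sum => i _; apply: le_trans; first exact: sum_mass_triangle.
    rewrite lee_fin /= normrM (ger0_norm (rho0 _ _)).
    have [->|ri] := eqVneq (rho a i) 0; first by rewrite mulr0 !mul0r.
    rewrite ler_wpM2l ?mulr_ge0// ler_wpM2l ?area_const_ge0// ler_wpM2r//.
    by rewrite distrC rho_p.
  apply: lee_sum => i _; rewrite -sumEFin; apply: lee_sum => j _.
  apply: le_trans; first exact: sum_mass_triangle.
  rewrite lee_fin /= normrN normrM.
  have [->|cij] := eqVneq (c i j) 0; first by rewrite normr0 mulr0 !mul0r.
  rewrite ler_wpM2l ?mulr_ge0// ler_wpM2l ?area_const_ge0//.
  move: cij; rewrite /c mulf_eq0 negb_or => /andP[ri rj].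
  have pia := rho_p Ka ri.
  have pjb : `|b - p j| <= 3 * e.
    have [rbj|rbj] := eqVneq (rho b j) 0; last first.
      by rewrite distrC; apply: le_trans (rho_p Kb rbj) _; rewrite ler_pM2r// ler_nat.
    have raj : rho a j != 0 by apply: contraNneq rj => ->; rewrite rbj subrr.
    have := ler_normD (b - a) (a - p j); rewrite addrA subrK [`|a - _|]distrC => h.
    have := rho_p Ka raj; lra.
  apply: ler_pM => //.
  have := ler_normD (p j - b) (b - p i); rewrite addrA subrK [`|p j - b|]distrC => h.
  have := ler_normD (b - a) (a - p i); rewrite addrA subrK [`|a - p i|]distrC => h'.
  lra.
rewrite lee_fin -mulr_suml -mulr_sumr (rho1 Ka) mulr1.
under eq_bigr do rewrite -mulr_suml -mulr_sumr.
rewrite -mulr_suml -mulr_sumr.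
have cL : \sum_i \sum_j `|c i j| <= L * `|b - a|.
  apply: le_trans rL; rewrite -[leRHS]mul1r -(rho1 Ka) mulr_suml; apply: ler_sum => i _.
  by rewrite mulr_sumr; apply: ler_sum => j _; rewrite /c normrM (ger0_norm (rho0 _ _)).
have h : `|y| * (\sum_i \sum_j `|c i j|) * (area_const R d * (6 * e * (3 * e))) <=
    `|y| * (L * `|b - a|) * (area_const R d * (6 * e * (3 * e))).
  rewrite ler_wpM2r ?ler_wpM2l//; apply: mulr_ge0; first exact: area_const_ge0.
  by rewrite !mulr_ge0// ltW.
apply: le_trans (lerD (lexx _) h) _; rewrite le_eqVlt /homotopy_const; apply/orP; left; apply/eqP.
by ring.
Qed.

(** The two cones over the common endpoint cancel. *)
Lemma net_approx_cat a b l l1 l2 c1 c2 : K a -> K b -> 0 <= l <= 1 ->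
  net_approx a (a + l *: (b - a)) l1 c1 -> net_approx (a + l *: (b - a)) b l2 c2 ->
  net_approx a b (l1 + l2) (fun i j => c1 i j + c2 i j).
Proof.
move=> Ka Kb l01; set m := a + _ => -[cL1 h1] [cL2 h2]; split=> [i j|y].
  by rewrite mulrDr; apply: le_trans (ler_normD _ _) _; exact: lerD.
have [H1 [bH1 mH1]] := h1 y; have [H2 [bH2 mH2]] := h2 y.
exists (H1 ++ H2); split; last first.
  by rewrite sum_mass_cat mulrDr EFinD; exact: leeD.
rewrite boundary_chain_cat bH1 bH2 (segment_chain_split K_convex _ Ka Kb l01) -/m.
have -> : net_chain (fun i j => y * (c1 i j + c2 i j)) =
    net_chain (fun i j => y * c1 i j) + net_chain (fun i j => y * c2 i j).
  rewrite /net_chain -big_split; apply: eq_bigr => i _ /=; rewrite -big_split;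
    apply: eq_bigr => j _ /=.
  by rewrite mulrDr; exact: (@simplex_chainD _ _ _ RG).
rewrite addrACA -opprD; congr (_ - _).
rewrite addrACA [X in X + _]addrACA -[LHS]addrA -[RHS]addrA; congr (_ + _).
by rewrite addrA addrK.
Qed.

(** The edge is cut into [n] parts of length at most [e], which are joined starting from [a]. Both
    bounds are linear in the length, so the number of parts does not enter. *)
Lemma net_approx_edge a b : K a -> K b -> exists c, net_approx a b `|b - a| c.
Proof.
move=> Ka Kb; pose n := (Num.trunc (`|b - a| / e)).+1.
have n0 : 0 < n%:R :> R by rewrite ltr0n.
have nE : `|b - a| / n%:R <= e.
  by rewrite ler_pdivrMr// mulrC -ler_pdivrMr//; exact/ltW/truncnS_gt.
pose q m := a + (m%:R / n%:R) *: (b - a).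
have Kq m : (m <= n)%N -> K (q m).
  by move=> mn; apply: convex_conv => //; rewrite divr_ge0//= ler_pdivrMr// mul1r ler_nat.
suff H m : (m <= n)%N -> exists c, net_approx a (q m) (m%:R / n%:R * `|b - a|) c.
  have := H n (leqnn n); rewrite /q divff ?gt_eqF// scale1r mul1r.
  by rewrite [a + _]addrC subrK.
elim: m => [_|m ih mn].
  have := @net_approx_short a a Ka Ka; rewrite subrr normr0 => h.
  by rewrite /q mul0r scale0r mul0r addr0; eexists; exact: h (ltW e0).
have [c hc] := ih (ltnW mn).
have m1 : m.+1%:R != 0 :> R by rewrite pnatr_eq0.
(* [net_approx_cat] divides the edge from [a] to [q m.+1], on which [q m] has parameter
   [m / (m + 1)]. *)
have qE : q m = a + (m%:R / m.+1%:R) *: (q m.+1 - a).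
  rewrite /q [a + _ - a]addrAC subrr add0r scalerA; congr (_ + _ *: _).
  by rewrite mulrA divfK.
have qd : q m.+1 - q m = n%:R^-1 *: (b - a).
  by rewrite /q opprD addrACA subrr add0r -scalerBl -mulrBl -natr1 [m%:R + 1]addrC addrK mul1r.
have qn : `|q m.+1 - q m| = `|b - a| / n%:R.
  by rewrite qd normrZ gtr0_norm ?invr_gt0// mulrC.
have l01 : 0 <= m%:R / m.+1%:R :> R /\ m%:R / m.+1%:R <= 1 :> R.
  by rewrite divr_ge0// ler_pdivrMr ?ltr0n// mul1r ler_nat.
move/andP: l01 => l01; have := @net_approx_short (q m) (q m.+1) (Kq _ (ltnW mn)) (Kq _ mn);
  rewrite qn => /(_ nE) hs.
have -> : m.+1%:R / n%:R * `|b - a| = m%:R / n%:R * `|b - a| + `|b - a| / n%:R.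
  by rewrite -natr1; field; rewrite gt_eqF.
eexists; apply: (net_approx_cat Ka (Kq _ mn) l01); rewrite -qE; [exact: hc|exact: hs].
Qed.

(** Regrouped by vertices, the sum consists of the values of [F w] at [bd_at w s]. It is used with
    the cones for [F]. *)
Lemma bd_at_sum_eq0 (A : zmodType) (F : 'rV[R]_d -> {additive R -> A}) (s : formal_sum K RG 1) :
  (forall v, bd_at v s = 0) ->
  \sum_(x <- s) (F (x.2 ord_max) x.1 - F (x.2 ord0) x.1) = 0.
Proof.
move=> s0; pose pt i (x : RG * simplex K 1) : 'rV[R]_d := x.2 i.
pose V := undup ([seq pt ord0 x | x <- s] ++ [seq pt ord_max x | x <- s]).
have FV (v : 'rV[R]_d) (g : R) : v \in V -> F v g = \sum_(w <- V) F w (if v == w then g else 0).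
  move=> vV; rewrite (bigD1_seq v)//= ?undup_uniq// eqxx big1 ?addr0// => w.
  by rewrite eq_sym => /negbTE ->; rewrite raddf0.
have V0 x : x \in s -> x.2 ord0 \in V.
  by move=> xs; rewrite mem_undup mem_cat; apply/orP; left; apply/mapP; exists x.
have V1 x : x \in s -> x.2 ord_max \in V.
  by move=> xs; rewrite mem_undup mem_cat; apply/orP; right; apply/mapP; exists x.
transitivity (\sum_(x <- s) \sum_(w <- V)
    F w ((if x.2 ord_max == w then x.1 else 0) - (if x.2 ord0 == w then x.1 else 0))).
  rewrite big_seq [RHS]big_seq; apply: eq_bigr => x xs;
    rewrite (FV _ _ (V0 _ xs)) (FV _ _ (V1 _ xs)).
  by rewrite -sumrB; apply: eq_bigr => w _; rewrite raddfB.
rewrite exchange_big big1//= => w _; rewrite -raddf_sum.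
by have := s0 w; rewrite /bd_at => ->; rewrite raddf0.
Qed.

Lemma segment_length_le (x : simplex K 1) :
  (`|x ord_max - x ord0|%:E <= 2%:E * hausdorff 1 (hull x))%E.
Proof. by apply: norm_le_hausdorff1 => t; exact: segment_point. Qed.

Lemma segment_chain_additive_subproof a b : zmod_morphism (seg a b).
Proof.
by move=> x y; rewrite [LHS](@simplex_chainD _ _ _ RG) [X in _ + X](@simplex_chainN _ _ _ RG).
Qed.

HB.instance Definition _ a b := GRing.isZmodMorphism.Build R (polychain K RG 1) (seg a b)
  (segment_chain_additive_subproof a b).

Lemma cone_chain_additive_subproof v : zmod_morphism (cone_chain v).
Proof.
move=> x y; rewrite /cone_chain -sumrB; apply: eq_bigr => i _.
by rewrite mulrBl raddfB.
Qed.

HB.instance Definition _ v := GRing.isZmodMorphism.Build R (polychain K RG 1) (cone_chain v)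
  (cone_chain_additive_subproof v).

Lemma net_chain_sum J (r : seq J) (F : J -> I -> I -> R) :
  net_chain (fun i j => \sum_(x <- r) F x i j) = \sum_(x <- r) net_chain (F x).
Proof.
rewrite /net_chain [RHS]exchange_big; apply: eq_bigr => i _ /=.
by rewrite [RHS]exchange_big; apply: eq_bigr => j _ /=; rewrite raddf_sum.
Qed.

Lemma net_chainN c : net_chain (fun i j => - c i j) = - net_chain c.
Proof.
rewrite /net_chain -sumrN; apply: eq_bigr => i _; rewrite -sumrN; apply: eq_bigr => j _.
by rewrite raddfN.
Qed.

(** The cones cancel, so the fillings of the edges add up to a filling of the cycle minus a net
    chain. The 2 in [2 * M] is that of [segment_length_le]: lengths are taken in the sup norm and
    bounded by twice the Hausdorff measure. *)
Lemma net_approx_cycle (s : formal_sum K RG 1) (M : R) : (forall v, bd_at v s = 0) ->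
  (sum_mass s <= M%:E)%E ->
  exists c : I -> I -> R, (forall i j, `|c i j| <= L * (2 * M)) /\
    (poly_flat (\pi_(polychain K RG 1) s - net_chain c)%R <= (homotopy_const * e * (2 * M))%:E)%E.
Proof.
move=> s0 sM.
have Kx (x : simplex K 1) i : K (x i) by apply: (@simplex_sub _ _ _ _ x); exact: hull_vertex.
have /choice[cc ccP] : forall x : simplex K 1, exists c, net_approx (x ord0) (x ord_max)
    `|x ord_max - x ord0| c by move=> x; exact: net_approx_edge.
have /choice[H HP] : forall ex : RG * simplex K 1, exists H : formal_sum K RG 2,
    bdc H = cell ex.1 ex.2 + (cone_chain (ex.2 ord0) ex.1 - cone_chain (ex.2 ord_max) ex.1) -
      net_chain (fun i j => ex.1 * cc ex.2 i j) /\
    (sum_mass H <= (homotopy_const * e * `|ex.1| * `|ex.2 ord_max - ex.2 ord0|)%:E)%E.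
  move=> [y x] /=; have [_ h] := ccP x; have [H [bH mH]] := h y; exists H; split=> //.
  by rewrite bH cell_segment addrA.
have massE : (\sum_(ex <- s) (`|ex.1| * `|ex.2 ord_max - ex.2 ord0|)%:E <= (2 * M)%:E)%E.
  rewrite EFinM; apply: (@le_trans _ _ (2%:E * sum_mass s)%E); last by rewrite lee_pmul2l.
  rewrite /sum_mass ge0_sume_distrr; last by move=> ex _;
    rewrite mule_ge0 ?hausdorff_ge0// lee_fin ng_norm_ge0.
  apply: lee_sum => -[y x] _ /=; rewrite EFinM muleCA lee_wpmul2l//.
  exact: segment_length_le.
exists (fun i j => \sum_(ex <- s) ex.1 * cc ex.2 i j); split.
  move=> i j; apply: le_trans (ler_norm_sum _ _ _) _; rewrite -lee_fin EFinM.
  apply: (@le_trans _ _ (L%:E * \sum_(ex <- s) (`|ex.1| * `|ex.2 ord_max - ex.2 ord0|)%:E)%E);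
    last first.
    by rewrite lee_wpmul2l.
  rewrite ge0_sume_distrr; last by move=> ex _; rewrite lee_fin mulr_ge0.
  rewrite -sumEFin; apply: lee_sum => -[y x] _ /=; rewrite -EFinM lee_fin normrM mulrCA ler_wpM2l//.
  by have [h _] := ccP x; exact: h.
apply: le_trans (poly_flat_le _ (flatten [seq H ex | ex <- s])) _.
have -> : \pi_(polychain K RG 1) s - net_chain (fun i j => \sum_(ex <- s) ex.1 * cc ex.2 i j) -
    \pi_(polychain K RG 1) (boundary (flatten [seq H ex | ex <- s])) = 0.
  have -> : \pi_(polychain K RG 1) (boundary (flatten [seq H ex | ex <- s])) =
      bdc (flatten [seq H ex | ex <- s]) by [].
  rewrite boundary_chain_flatten pi_sum
    (net_chain_sum _ (fun ex : RG * simplex K 1 => fun i j => ex.1 * cc ex.2 i j)).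
  under [X in _ - X]eq_bigr do rewrite (HP _).1.
  rewrite sumrB big_split /=.
  have -> : \sum_(i <- s) (cone_chain (i.2 ord0) i.1 - cone_chain (i.2 ord_max) i.1) = 0.
    have := @bd_at_sum_eq0 _ (fun v => cone_chain v : {additive R -> polychain K RG 1}) s s0.
    move=> /(congr1 -%R); rewrite -sumrN oppr0 => h; rewrite -[RHS]h.
    by apply: eq_bigr => ex _; rewrite opprB.
  by rewrite addr0 subrr.
rewrite sum_mass_flatten; apply: (@le_trans _ _ ((homotopy_const * e * (2 * M))%:E + 0)%E);
  last by rewrite adde0.
apply: leeD; last exact: poly_mass0.
have he0 : 0 <= homotopy_const * e by rewrite mulr_ge0 ?homotopy_const_ge0// ltW.
apply: (@le_trans _ _ ((homotopy_const * e)%:E *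
  \sum_(ex <- s) (`|ex.1| * `|ex.2 ord_max - ex.2 ord0|)%:E)%E); last first.
  by rewrite [leRHS]EFinM lee_wpmul2l.
rewrite ge0_sume_distrr; last by move=> ex _; rewrite lee_fin mulr_ge0.
apply: lee_sum => ex _; rewrite -EFinM; apply: le_trans (HP ex).2 _.
by rewrite !mulrA.
Qed.

(** The net has finitely many segments, so uniformly close coefficients give chains close in mass;
    [w] is the total measure of the nondegenerate segments. *)
Lemma net_chain_mass : exists2 w, 0 <= w & forall (c c' : I -> I -> R) (del : R), 0 <= del ->
  (forall i j, `|c i j - c' i j| <= del) ->
  (poly_mass (net_chain c - net_chain c')%R <= (del * w)%:E)%E.
Proof.
have /choice[w wP] : forall ij : I * I, exists w, 0 <= w /\ forall g : RG,
    (poly_mass (seg (p ij.1) (p ij.2) g) <= (`|g| * w)%:E)%E.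
  move=> [i j] /=; case E : (insub (point_seq 2 [:: p i; p j]) : option (simplex K 1)) => [x|].
    exists (fine (hausdorff 1 (hull x))); split=> [|g]; first exact/fine_ge0/hausdorff_ge0.
    rewrite /segment_chain simplex_chainE E; apply: le_trans (poly_mass_le _) _.
    rewrite /sum_mass big_seq1 /= EFinM fineK// ge0_fin_numE ?hausdorff_ge0//.
    exact: hausdorff_simplex_lty.
  exists 0; split=> // g; rewrite /segment_chain simplex_chainE E mulr0.
  exact: poly_mass0.
exists (\sum_i \sum_j w (i, j)).
  by apply: sumr_ge0 => i _; apply: sumr_ge0 => j _; case: (wP (i, j)).
move=> c c' del del0 cc'.
have massS (J : Type) (r : seq J) (F : J -> polychain K RG 1) :
    (poly_mass (\sum_(x <- r) F x)%R <= \sum_(x <- r) poly_mass (F x))%E.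
  elim: r => [|x r ih]; first by rewrite !big_nil poly_mass0.
  by rewrite !big_cons; apply: le_trans (poly_massD _ _) _; rewrite leeD2l.
rewrite -net_chainN /net_chain -big_split /= mulr_sumr -sumEFin.
apply: le_trans (massS _ _ _) _; apply: lee_sum => i _.
rewrite -big_split /= mulr_sumr -sumEFin; apply: le_trans (massS _ _ _) _; apply: lee_sum => j _.
rewrite -raddfD; case: (wP (i, j)) => w0 /= h; apply: le_trans (h _) _.
by rewrite lee_fin ler_wpM2r.
Qed.

End Approximation.

Lemma sub_telescope3 (V : zmodType) (a b c e : V) : a - c = (a - b) + ((b - e) - (c - e)).
Proof. by rewrite opprB !addrA !subrK. Qed.

Lemma sub_sub_telescope (V : zmodType) (a b a' b' : V) : a - b = (a' - b') + ((a - a') + (b' - b)).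
Proof.
by rewrite [RHS]addrC -[RHS]addrA [b' - b + _]addrC [a' - b' + _]addrA subrK addrA subrK.
Qed.

(** * Precompactness and lifting of flat chains *)

Section Ultrafilters.
Variable R : realType.

Lemma ultra_bounded_limit (T : Type) (U : set_system T) (f : T -> R) (B : R) : UltraFilter U ->
  (forall t, `|f t| <= B) -> exists l, forall e, 0 < e -> U [set t | `|f t - l| < e].
Proof.
move=> UU fB; have PU : ProperFilter U by exact: ultra_proper.
have FB : (f @ U) `[- B, B]%classic.
  by rewrite /fmap /=; apply: filterS filterT => t _ /=; rewrite in_itv /= -ler_norml.
have [l [_ cl]] := @segment_compact R (- B) B _ (fmap_proper_filter f PU) FB.
exists l => e e0; have [//|UC] := in_ultra_setVsetC [set t | `|f t - l| < e] UU.
have lb : nbhs l (ball l e) by exact: nbhsx_ballx.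
have fU : (f @ U) [set x | ~ `|x - l| < e] by exact: UC.
have [x [h]] := cl _ _ fU lb; rewrite -ball_normE /= distrC => h'.
by case: h.
Qed.

(** This replaces a diagonal extraction: a single ultrafilter contains the sets [A j] of all scales,
    hence their finite intersections, and these contain arbitrarily large indices. *)
Lemma ultra_subsequence (U : set_system nat) (A : nat -> set nat) : UltraFilter U ->
  \oo `<=` U -> (forall j, U (A j)) ->
  exists f : nat -> nat, (forall j, (j <= f j)%N) /\ forall i j, (i <= j)%N -> A i (f j).
Proof.
move=> UU ooU UA; have PU : ProperFilter U by exact: ultra_proper.
have h j : U ([set n | (j <= n)%N] `&` [set n | forall i, (i <= j)%N -> A i n]).
  apply: filterI; first by apply: ooU; exists j.
  elim: j => [|j ih].
    by apply: filterS (UA 0%N) => n An i; rewrite leqn0 => /eqP ->.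
  apply: filterS (filterI ih (UA j.+1)) => n [h An] i; rewrite leq_eqVlt => /orP[/eqP -> //|].
  exact: h.
have /choice[f fP] : forall j, exists n, (j <= n)%N /\ forall i, (i <= j)%N -> A i n.
  by move=> j; have [n [h1 h2]] := filter_ex (h j); exists n.
by exists f; split=> [j|i j]; case: (fP j) => // _; apply.
Qed.

End Ultrafilters.

Section Precompactness.
Variables (R : realType) (d : nat) (K : set 'rV[R]_d).
Hypothesis K_convex : convex_set K.
Hypothesis K_compact : compact K.
Local Open Scope quotient_scope.
Local Notation RG := (real_group R).

(** At mesh [e] the partition of unity has Lipschitz constant [L = 2 d / e], so [L * e], and with it
    [homotopy_const], is independent of [e]: the approximation error is proportional to [e]. For
    fixed [e] the coefficients on the net are bounded by [L * (2 * M)] and converge along [U]. *)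
Lemma cycles_precompact (x0 : 'rV[R]_d) (s : nat -> formal_sum K RG 1) (M : R)
  (U : set_system nat) :
  K x0 -> 0 <= M -> (forall n v, bd_at v (s n) = 0) -> (forall n, (sum_mass (s n) <= M%:E)%E) ->
  UltraFilter U -> forall eta : R, 0 < eta -> exists2 A : set nat, U A &
    forall m n, A m -> A n -> (poly_flat
      (\pi_(polychain K RG 1) (s m) - \pi_(polychain K RG 1) (s n))%R < eta%:E)%E.
Proof.
move=> Kx0 M0 s0 sM UU eta eta0; have PU : ProperFilter U by exact: ultra_proper.
have [B KB] : exists B, forall x, K x -> `|x| <= B.
  have [B [_ hB]] := compact_bounded K_compact; exists (B + 1) => x Kx.
  by apply: hB Kx; rewrite ltrDl.
pose C := area_const R d * (2 + 18 * (2 * d%:R)).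
have C0 : 0 <= C by rewrite mulr_ge0 ?area_const_ge0// addr_ge0// !mulr_ge0.
have CM1 : 0 < C * M + 1 by rewrite ltr_wpDl// mulr_ge0.
(* This puts every cycle within [eta / 8] of its net chain; [del] below does the same for two net
   chains with indices in [A]. The summand 1 avoids a zero denominator. *)
pose e := eta / (16 * (C * M + 1)).
have e0 : 0 < e by rewrite divr_gt0// mulr_gt0.
have [I [p [rho [Kp rho0 rho1 rho_p rhoL]]]] := partition_of_unity Kx0 KB e0.
have L0 : 0 <= 2 * d%:R / e by apply: divr_ge0; [exact: mulr_ge0|exact: ltW].
have /choice[c cP] := fun n => net_approx_cycle K_convex Kp rho0 rho1 rho_p rhoL e0 L0 (s0 n)
  (sM n).
have hcE : homotopy_const d e (2 * d%:R / e) * e * (2 * M) <= eta / 8.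
  have -> : homotopy_const d e (2 * d%:R / e) = C.
    by rewrite /homotopy_const divfK// gt_eqF.
  have h : C * M <= C * M + 1 by rewrite lerDl.
  have -> : C * e * (2 * M) = (C * M) / (C * M + 1) * (eta / 8).
    by rewrite /e; field; rewrite gt_eqF.
  by rewrite ler_piMl ?divr_ge0 ?(ltW eta0)// ler_pdivrMr// mul1r.
have [w w0 hw] := @net_chain_mass R d K I p.
pose del := eta / (16 * (w + 1)).
have w1 : 0 < w + 1 by rewrite ltr_wpDl.
have del0 : 0 < del by rewrite divr_gt0// mulr_gt0.
have /choice[l lP] : forall ij : I * I, exists l, forall e, 0 < e ->
    U [set n | `|c n ij.1 ij.2 - l| < e].
  move=> [i j] /=; apply: (@ultra_bounded_limit _ _ _ _ (2 * d%:R / e * (2 * M))) => n.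
  by case: (cP n) => h _; exact: h.
pose A := [set n | forall ij : I * I, `|c n ij.1 ij.2 - l ij| < del].
have UA : U A by apply: filter_forall => ij; exact: lP.
exists A => // m n Am An.
have cmn i j : `|c m i j - c n i j| <= 2 * del.
  have h1 := Am (i, j); have h2 := An (i, j); rewrite /= in h1 h2.
  have := ler_normD (c m i j - l (i, j)) (l (i, j) - c n i j).
  rewrite addrA subrK [`|l _ - _|]distrC => h; apply: ltW; apply: le_lt_trans h _; lra.
pose P k := \pi_(polychain K RG 1) (s k); pose N k := net_chain K p (c k).
have -> : \pi_(polychain K RG 1) (s m) - \pi_(polychain K RG 1) (s n) =
    (P m - N m) + ((N m - N n) - (P n - N n)).
  exact: sub_telescope3.
apply: le_lt_trans (poly_flatD _ _) _.
apply: (@le_lt_trans _ _ ((eta / 8)%:E + ((eta / 8)%:E + (eta / 8)%:E))%E); last first.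
  by rewrite -!EFinD lte_fin; lra.
apply: leeD.
  by case: (cP m) => _ h; apply: le_trans h _; rewrite lee_fin.
apply: le_trans (poly_flatD _ _) _; apply: leeD; last first.
  by rewrite poly_flatN; case: (cP n) => _ h; apply: le_trans h _; rewrite lee_fin.
apply: le_trans (poly_flat_le_mass _) _.
apply: le_trans (hw (c m) (c n) (2 * del) _ cmn) _; first by rewrite mulr_ge0// ltW.
rewrite lee_fin; have -> : 2 * del * w = w / (w + 1) * (eta / 8).
  by rewrite /del; field; rewrite gt_eqF.
by rewrite ler_piMl ?divr_ge0 ?(ltW eta0)// ler_pdivrMr// mul1r lerDl.
Qed.

End Precompactness.

(** * Flat chains as classes of Cauchy sequences *)

Section FlatClasses.
Variables (R : realType) (d : nat) (K : set 'rV[R]_d) (G : normedGroup R) (k : nat).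
Implicit Types (u v : nat -> polychain K G k.+1) (T : flat_chain K G k.+1).

Lemma fin_cvge0P (x : nat -> \bar R) : (forall n, x n \is a fin_num) -> (forall n, 0 <= x n)%E ->
  (x n @[n --> \oo] --> 0%E) <->
  (forall e : R, 0 < e -> exists N, forall n, (N <= n)%N -> (x n < e%:E)%E).
Proof.
move=> xfin x0; have xE n : x n = (fine (x n))%:E by rewrite fineK.
rewrite (fine_cvgP _ (0 : R)); split=> [[_ /cvgrPdist_lt h] e e0|h].
  have [N _ hN] := h _ e0; exists N => n Nn; have := hN n Nn.
  by rewrite /= sub0r normrN ger0_norm ?fine_ge0// xE lte_fin.
split; first by apply: nearW => n.
apply/cvgrPdist_lt => e e0; have [N hN] := h _ e0; exists N => // n Nn /=.
by rewrite sub0r normrN ger0_norm ?fine_ge0// -lte_fin -xE; exact: hN.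
Qed.

Lemma flat_class_refl u : flat_cauchy u -> flat_class u u.
Proof.
move=> cu; split=> //; apply/fin_cvge0P => [n|n|e e0]; first exact: poly_flat_fin.
  exact: poly_flat_ge0.
by exists 0%N => n _; rewrite subrr poly_flat0 lte_fin.
Qed.

Lemma flat_classP u v : flat_class u v <-> flat_cauchy v /\
  forall e : R, 0 < e -> exists N, forall n, (N <= n)%N -> (poly_flat (u n - v n)%R < e%:E)%E.
Proof.
split=> -[cv h]; split=> //; apply/fin_cvge0P => // n;
  [exact: poly_flat_fin|exact: poly_flat_ge0|exact: poly_flat_fin|exact: poly_flat_ge0].
Qed.

Lemma poly_flatB P Q : poly_flat (P - Q : polychain K G k.+1) = poly_flat (Q - P).
Proof. by rewrite -opprB poly_flatN. Qed.

Lemma poly_flat_triangle (P Q S : polychain K G k.+1) (e f : R) :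
  (poly_flat (P - Q)%R < e%:E)%E -> (poly_flat (Q - S)%R < f%:E)%E ->
  (poly_flat (P - S)%R < (e + f)%:E)%E.
Proof.
move=> h1 h2; have -> : P - S = (P - Q) + (Q - S) by rewrite addrA subrK.
by apply: le_lt_trans (poly_flatD _ _) _; rewrite EFinD lteD.
Qed.

Lemma flat_class_mem_eq u v w : flat_class u w -> flat_class v w -> flat_class u = flat_class v.
Proof.
have sub u' v' : flat_class u' w -> flat_class v' w -> flat_class u' `<=` flat_class v'.
  move=> /flat_classP[_ uw] /flat_classP[_ vw] z /flat_classP[cz uz]; apply/flat_classP;
    split=> // e e0.
  have e3 : 0 < e / 3 by rewrite divr_gt0.
  have [N1 h1] := uw _ e3; have [N2 h2] := vw _ e3; have [N3 h3] := uz _ e3.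
  exists (maxn N1 (maxn N2 N3)) => n; rewrite !geq_max => /and3P[n1 n2 n3].
  have -> : e = e / 3 + (e / 3 + e / 3) by lra.
  apply: poly_flat_triangle (h2 n n2) _; apply: poly_flat_triangle (h3 n n3).
  by rewrite poly_flatB; exact: h1.
by move=> uw vw; apply/seteqP; split; exact: sub.
Qed.

Lemma flat_chain_eq T T' : flat_chain_set T = flat_chain_set T' -> T = T'.
Proof.
by case: T T' => [A hA] [B hB] /= AB; subst B; congr FlatChain; exact: Prop_irrelevance.
Qed.

Lemma flat_reprE T : flat_chain_set T = flat_class (flat_repr T).
Proof. exact: s2valP' (cid2 (flat_chainP T)). Qed.

Lemma flat_repr_mem T : flat_chain_set T (flat_repr T).
Proof. by rewrite flat_reprE; apply: flat_class_refl; exact: flat_repr_cauchy. Qed.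

Lemma flat_dist_cvg T T' : exists l : R,
  poly_flat (flat_repr T n - flat_repr T' n) @[n --> \oo] --> l%:E.
Proof.
pose x n := poly_flat (flat_repr T n - flat_repr T' n).
have xfin n : x n \is a fin_num by exact: poly_flat_fin.
have [|l lP] := @real_complete R (fun n => fine (x n)).
  move=> e e0; have e2 : 0 < e / 2 by rewrite divr_gt0.
  have [N1 h1] := flat_repr_cauchy T e2; have [N2 h2] := flat_repr_cauchy T' e2.
  exists (maxn N1 N2) => m n; rewrite !geq_max => /andP[m1 m2] /andP[n1 n2].
  have half i j : (N1 <= i)%N -> (N2 <= i)%N -> (N1 <= j)%N -> (N2 <= j)%N ->
      fine (x i) < fine (x j) + e.
    move=> i1 i2 j1 j2; rewrite -lte_fin EFinD !fineK//.
    have E : flat_repr T i - flat_repr T' i = (flat_repr T j - flat_repr T' j) +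
        ((flat_repr T i - flat_repr T j) + (flat_repr T' j - flat_repr T' i)).
      exact: sub_sub_telescope.
    rewrite {1}/x E; apply: le_lt_trans (poly_flatD _ _) _.
    rewrite -/(x j) lteD2lE//; apply: le_lt_trans (poly_flatD _ _) _.
    rewrite [e]splitr EFinD; apply: lteD; first exact: h1.
    exact: h2.
  have := half m n m1 m2 n1 n2; have := half n m n1 n2 m1 m2 => ? ?.
  by rewrite ltr_norml; apply/andP; split; lra.
exists l; apply/fine_cvgP; split; first by apply: nearW => n; exact: xfin.
apply/cvgrPdist_lt => e e0; have [N hN] := lP _ e0; exists N => // n Nn.
by rewrite /= distrC; exact: hN.
Qed.

Lemma flat_dist_le T T' (e : R) :
  (exists N, forall n, (N <= n)%N -> (poly_flat (flat_repr T n - flat_repr T' n)%R <= e%:E)%E) ->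
  (flat_dist T T' <= e%:E)%E.
Proof.
move=> [N hN]; have [l hl] := flat_dist_cvg T T'.
by apply: lime_le; [apply/cvg_ex; exists l%:E|exists N].
Qed.

Lemma flat_dist_fin T T' : flat_dist T T' \is a fin_num.
Proof. by have [l hl] := flat_dist_cvg T T'; rewrite /flat_dist (cvg_lim _ hl). Qed.

Lemma flat_dist_ge0 T T' : (0 <= flat_dist T T')%E.
Proof.
have [l hl] := flat_dist_cvg T T'; apply: lime_ge; first by apply/cvg_ex; exists l%:E.
by apply: nearW => n; exact: poly_flat_ge0.
Qed.

Lemma flat_dist_lt T T' (e : R) : (flat_dist T T' < e%:E)%E ->
  exists N, forall n, (N <= n)%N -> (poly_flat (flat_repr T n - flat_repr T' n)%R < e%:E)%E.
Proof.
have [l hl] := flat_dist_cvg T T'; rewrite /flat_dist (cvg_lim _ hl)// lte_fin => le.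
have /hl[N _ hN] : nbhs l%:E [set y | (y < e%:E)%E].
  by apply: open_nbhs_nbhs; split; [exact: open_ereal_lt_ereal|rewrite /= lte_fin].
by exists N => n Nn; exact: hN.
Qed.

Lemma flat_repr_of_poly (P : polychain K G k.+1) (e : R) : 0 < e ->
  exists N, forall n, (N <= n)%N -> (poly_flat (P - flat_repr (flat_of_poly P) n)%R < e%:E)%E.
Proof.
by move=> e0; have /flat_classP[_ h] := flat_repr_mem (flat_of_poly P); exact: h.
Qed.

(** The relaxed mass can thus be computed with members of the class. [flat_dist] evaluates
    [flat_of_poly (P n)] on an arbitrary representative instead of the constant sequence, so
    distances are compared at a common large index [m]. *)
Lemma flat_cvg_mem T (P : nat -> polychain K G k.+1) :
  (flat_dist (flat_of_poly (P n)) T @[n --> \oo] --> 0%E) <-> flat_chain_set T P.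
Proof.
rewrite fin_cvge0P; [|by move=> n; exact: flat_dist_fin|by move=> n; exact: flat_dist_ge0].
rewrite flat_reprE flat_classP; set u := flat_repr T; split=> [h|[cP h] e e0].
  have near_u e : 0 < e -> exists N, forall n, (N <= n)%N -> (poly_flat (u n - P n)%R < e%:E)%E.
    move=> e0; have e3 : 0 < e / 3 by rewrite divr_gt0.
    have [N hN] := h _ e3; have [N' hN'] := flat_repr_cauchy T e3.
    exists (maxn N N') => n; rewrite geq_max => /andP[n1 n2].
    have [N1 h1] := flat_dist_lt (hN n n1); have [N2 h2] := flat_repr_of_poly (P n) e3.
    pose m := maxn N' (maxn N1 N2).
    have m1 : (N1 <= m)%N by rewrite !leq_max leqnn /= orbT.
    have m2 : (N2 <= m)%N by rewrite !leq_max leqnn !orbT.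
    have m3 : (N' <= m)%N by rewrite leq_max leqnn.
    rewrite poly_flatB; have -> : e = e / 3 + (e / 3 + e / 3) by lra.
    apply: poly_flat_triangle (h2 m m2) _; apply: poly_flat_triangle (h1 m m1) _.
    exact: hN'.
  split=> // e e0; have e3 : 0 < e / 3 by rewrite divr_gt0.
  have [N hN] := near_u _ e3; have [N' hN'] := flat_repr_cauchy T e3.
  exists (maxn N N') => m n; rewrite !geq_max => /andP[m1 m2] /andP[n1 n2].
  have -> : e = e / 3 + (e / 3 + e / 3) by lra.
  apply: (@poly_flat_triangle _ (u m)); first by rewrite poly_flatB; exact: hN.
  by apply: (@poly_flat_triangle _ (u n)); [exact: hN'|exact: hN].
have e4 : 0 < e / 4 by rewrite divr_gt0.
have [N hN] := h _ e4; have [N' hN'] := cP _ e4; exists (maxn N N') => n.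
rewrite geq_max => /andP[n1 n2]; apply: (@le_lt_trans _ _ (e / 4 + (e / 4 + e / 4))%:E); last first.
  by rewrite lte_fin; lra.
apply: flat_dist_le; have [N1 h1] := flat_repr_of_poly (P n) e4.
exists (maxn N1 (maxn N N')) => m; rewrite !geq_max => /and3P[m1 m2 m3]; apply: ltW.
apply: (@poly_flat_triangle _ (P n)); first by rewrite poly_flatB; exact: h1.
apply: (@poly_flat_triangle _ (P m)); first exact: hN'.
by rewrite poly_flatB; exact: hN.
Qed.

Lemma flat_mass_le T (P : nat -> polychain K G k.+1) : flat_chain_set T P ->
  (flat_mass T <= limn_einf (fun n => poly_mass (P n)))%E.
Proof. by move=> TP; apply: ereal_inf_lbound; exists P => //; exact/flat_cvg_mem. Qed.

Lemma flat_mass_lty T : (flat_mass T < +oo)%E ->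
  exists2 P, flat_chain_set T P & (limn_einf (fun n => poly_mass (P n)) < +oo)%E.
Proof. by move=> /ereal_inf_lt[_ [P /flat_cvg_mem TP <-] h]; exists P. Qed.

End FlatClasses.

Section Liminf.
Variable R : realType.

Lemma limn_einf_ereal_sup (x : nat -> \bar R) : limn_einf x = ereal_sup (range (einfs x)).
Proof. by rewrite limn_einf_lim; apply: cvg_lim => //; exact: cvg_einfs_sup. Qed.

Lemma limn_einf_le (x y : nat -> \bar R) : (forall n, x n <= y n)%E ->
  (limn_einf x <= limn_einf y)%E.
Proof.
move=> xy; rewrite !limn_einf_ereal_sup; apply: ge_ereal_sup => _ [N _ <-].
apply: (@le_trans _ _ (einfs y N)); last by apply: ereal_sup_ubound; exists N.
apply: le_ereal_inf_tmp => _ [n Nn <-]; apply: le_trans (xy n).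
by apply: ereal_inf_lbound; exists n.
Qed.

Lemma limn_einf_le_bound (x : nat -> \bar R) (c : \bar R) : (forall n, x n <= c)%E ->
  (limn_einf x <= c)%E.
Proof.
move=> xc; rewrite limn_einf_ereal_sup; apply: ge_ereal_sup => _ [N _ <-].
by apply: le_trans (xc N); apply: ereal_inf_lbound; exists N => //=.
Qed.

Lemma limn_einf_frequently (x : nat -> \bar R) (c : \bar R) : (limn_einf x < c)%E ->
  forall N, exists2 n, (N <= n)%N & (x n < c)%E.
Proof.
rewrite limn_einf_ereal_sup => xc N; have : (einfs x N < c)%E.
  by apply: le_lt_trans xc; apply: ereal_sup_ubound; exists N.
by move=> /ereal_inf_lt[_ [n Nn <-] h]; exists n.
Qed.

End Liminf.

Lemma sub_sub_sub (V : zmodType) (a b c b' c' : V) :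
  a - b - c - (a - b' - c') = (b' - b) + (c' - c).
Proof.
have subD (x y : V) : a - x - y = a - (x + y) by rewrite opprD addrA.
by rewrite (subD b c) (subD b' c') opprB [LHS]addrC addrA subrK opprD addrACA.
Qed.

(** * Lifting a flat chain of finite mass *)

Section FiniteMassLift.
Variables (R : realType) (d : nat) (K : set 'rV[R]_d).
Local Open Scope quotient_scope.
Local Notation RG := (real_group R).
Local Notation SG := (circle_group R).

Lemma flat_pi_mem k (T : flat_chain K RG k.+1) P : flat_chain_set T P ->
  flat_chain_set (flat_pi T) (fun n => poly_pi (P n)).
Proof.
rewrite flat_reprE => /flat_classP[cP h]; apply/flat_classP; split; first exact: flat_cauchy_pi.
move=> e e0; have [N hN] := h _ e0; exists N => n Nn.
by rewrite -raddfB; apply: le_lt_trans (poly_flat_pi _) _; exact: hN.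
Qed.

Lemma flat_mem_subsequence (G : normedGroup R) k (T : flat_chain K G k.+1) P (f : nat -> nat) :
  flat_chain_set T P -> (forall j, (j <= f j)%N) -> flat_chain_set T (P \o f).
Proof.
move=> + fj; rewrite flat_reprE => /flat_classP[cP h]; apply/flat_classP; split=> e e0.
  have [N hN] := cP _ e0; exists N => m n Nm Nn.
  by apply: hN; [exact: leq_trans Nm (fj m)|exact: leq_trans Nn (fj n)].
have e2 : 0 < e / 2 by rewrite divr_gt0.
have [N hN] := h _ e2; have [N' hN'] := cP _ e2; exists (maxn N N') => n.
rewrite geq_max => /andP[n1 n2]; rewrite [e]splitr.
apply: poly_flat_triangle (hN n n1) _; apply: hN' => //; exact: leq_trans n2 (fj n).
Qed.

(** The strict bound yields a representative below [c] even if the infimum is not attained. *)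
Lemma lift_polychain k (P : polychain K SG k.+1) (c : \bar R) : (poly_mass P < c)%E ->
  exists P' : polychain K RG k.+1, poly_pi P' = P /\ (poly_mass P' < c)%E.
Proof.
move=> /ereal_inf_lt[_ [s [<- _] <-] sc]; have [s' [ss' ms']] := lift_formal_sum s.
exists (\pi_(polychain K RG k.+1) s'); split; first by rewrite poly_piE ss'.
by apply: le_lt_trans (poly_mass_le _) _; rewrite ms'.
Qed.

(** A representative of small mass need not be [boundary q] itself, but it denotes the same chain,
    and the invariance of [bd_at] makes it a cycle. *)
Lemma lift_boundary (B : polychain K SG 1) (q : formal_sum K SG 2) (c : R) :
  B = \pi_(polychain K SG 1) (boundary q) -> (poly_mass B < c%:E)%E ->
  exists s : formal_sum K RG 1, [/\ forall v, bd_at v s = 0,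
    poly_pi (\pi_(polychain K RG 1) s) = B & (sum_mass s <= (2 * c)%:E)%E].
Proof.
move=> Bq /ereal_inf_lt[_ [s [sB _] <-] sc].
have s0 v : bd_at v s = 0.
  rewrite -(bd_at_boundary v q); apply: bd_at_chain_eq.
  by apply/polychain_eqP; rewrite sB Bq.
have [s' [ss' s'0 ms']] := lift_cycle s0; exists s'; split=> //.
  by rewrite poly_piE ss'.
by apply: le_trans ms' _; rewrite EFinM lee_pmul2l// ltW.
Qed.

Lemma half_expr_lt (e : R) : 0 < e -> exists n, (2^-1 : R) ^+ n < e.
Proof.
move=> e0; exists (Num.trunc e^-1).+1.
rewrite exprVn -[ltRHS]invrK ltf_pV2 ?posrE ?invr_gt0 ?exprn_gt0//.
apply: lt_le_trans (truncnS_gt _) _; by rewrite -natrX ler_nat ltnW// ltn_expl.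
Qed.

Lemma mass_telescope (G : normedGroup R) k (r : nat -> polychain K G k.+1) :
  (forall j, (poly_mass (r j) < ((2^-1) ^+ j.+1)%:E)%E) ->
  forall a b, (a <= b)%N ->
  (poly_mass (\sum_(j < b) r j - \sum_(j < a) r j)%R <= ((2^-1) ^+ a - (2^-1) ^+ b)%:E)%E.
Proof.
move=> rj a; elim=> [|b ih]; first by rewrite leqn0 => /eqP ->; rewrite !subrr poly_mass0.
rewrite leq_eqVlt => /orP[/eqP ->|]; first by rewrite !subrr poly_mass0.
rewrite ltnS => /ih h; rewrite big_ord_recr /= addrAC.
apply: le_trans (poly_massD _ _) _; apply: le_trans (leeD h (ltW (rj b))) _.
by rewrite -EFinD lee_fin exprS; lra.
Qed.

Hypothesis K_convex : convex_set K.
Hypothesis K_compact : compact K.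

Lemma circle_flat_chain_lift (x0 : 'rV[R]_d) (T : flat_chain K SG 1) : K x0 ->
  (flat_mass T < +oo)%E ->
  exists2 T' : flat_chain K RG 1, (flat_mass T' < +oo)%E & flat_pi T' = T.
Proof.
move=> Kx0 /flat_mass_lty[P TP Plim].
have [C PC] : exists C : R, (limn_einf (fun n => poly_mass (P n)) < C%:E)%E.
  case: (limn_einf _) Plim => [r _|//|_]; last by exists 0; exact: ltNyr.
  by exists (r + 1); rewrite lte_fin ltrDl.
have freq := limn_einf_frequently PC.
have C0 : 0 <= C.
  by have [n _ h] := freq 0%N; rewrite -lee_fin; exact: ltW (le_lt_trans (poly_mass_ge0 _) h).
pose eps j : R := (2^-1) ^+ j.+1.
have eps0 j : 0 < eps j by rewrite exprn_gt0.
have cP : flat_cauchy P by move: TP; rewrite flat_reprE => /flat_classP[].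
have /choice[Nf hNf] := fun j => cP _ (eps0 j).
(* [f j] and [f j.+1] are both at least [Nf j], so consecutive terms are at flat distance less than
   [eps j]. In place of monotonicity, [j <= f j] is what keeps the subsequence in its class. *)
have /choice[f fP] : forall j, exists n, [/\ (j <= n)%N, forall i, (i <= j)%N -> (Nf i <= n)%N &
    (poly_mass (P n) < C%:E)%E].
  move=> j; have [n jn Pn] := freq (maxn j (\max_(i < j.+1) Nf i)).
  move: jn; rewrite geq_max => /andP[jn /bigmax_leqP h]; exists n; split=> // i ij.
  by have := h (Ordinal (ij : (i < j.+1)%N)) isT.
have fge j : (j <= f j)%N by case: (fP j).
have PfC j : (poly_mass (P (f j)) < C%:E)%E by case: (fP j).
have /choice[q qP] : forall j, exists q : formal_sum K SG 2,
    (poly_mass ((P (f j) - P (f j.+1)) - \pi_(polychain K SG 1) (boundary q))%R < (eps j)%:E)%E.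
  move=> j; have : (poly_flat (P (f j) - P (f j.+1))%R < (eps j)%:E)%E.
    by apply: hNf; [case: (fP j) => _ h _|case: (fP j.+1) => _ h _]; apply: h.
  move=> /ereal_inf_lt[_ [q _ <-] h]; exists q; apply: le_lt_trans h.
  by rewrite leeDr// poly_mass_ge0.
pose r j := (P (f j) - P (f j.+1)) - \pi_(polychain K SG 1) (boundary (q j)).
have /choice[r' r'P] := fun j => lift_polychain (qP j).
have r'eps j : (poly_mass (r' j) < ((2^-1) ^+ j.+1)%:E)%E by case: (r'P j).
pose Q n := flatten [seq q (j : 'I_n) | j <- index_enum 'I_n].
pose B n := \pi_(polychain K SG 1) (boundary (Q n)).
have BE n : B n = P (f 0%N) - P (f n) - \sum_(j < n) r j.
  rewrite /B -[LHS]/(boundary_chain _) boundary_chain_flatten /r sumrB.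
  have -> : \sum_(j < n) (P (f j) - P (f j.+1)) = P (f 0%N) - P (f n).
    elim: n => [|n ih]; first by rewrite big_ord0 subrr.
    by rewrite big_ord_recr /= ih addrA subrK.
  by rewrite opprB addrC subrK.
have mass_sum (G : normedGroup R) (t : nat -> polychain K G 1) n :
    (forall j, (poly_mass (t j) < ((2^-1) ^+ j.+1)%:E)%E) ->
    (poly_mass (\sum_(j < n) t j)%R <= 1%:E)%E.
  move=> tj; have := mass_telescope tj (leq0n n); rewrite big_ord0 subr0 expr0.
  by move/le_trans; apply; rewrite lee_fin gerBl exprn_ge0.
(* [C] for each of the two terms of [P] and 1 for the sum of the [r j]; one more unit makes the
   bound strict, as [lift_boundary] demands. *)
have Bmass n : (poly_mass (B n) < (2 * C + 2)%:E)%E.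
  rewrite BE; apply: le_lt_trans (poly_massD _ _) _; rewrite poly_massN.
  apply: (@le_lt_trans _ _ ((C%:E + C%:E) + 1%:E)%E); last by rewrite -!EFinD lte_fin; lra.
  apply: leeD; last by apply: mass_sum => j; exact: qP.
  apply: le_trans (poly_massD _ _) _; rewrite poly_massN; apply: leeD; exact/ltW/PfC.
have /choice[s sP] := fun n => @lift_boundary (B n) (Q n) (2 * C + 2) erefl (Bmass n).
have [P0 [P0E P0C]] := lift_polychain (PfC 0%N).
pose S n := \pi_(polychain K RG 1) (s n); pose V n := \sum_(j < n) r' j.
pose M := 2 * (2 * C + 2).
have M0 : 0 <= M by rewrite mulr_ge0// addr_ge0// mulr_ge0.
pose P' n := P0 - S n - V n.
have piP' n : poly_pi (P' n) = P (f n).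
  have -> : poly_pi (P' n) = poly_pi P0 - poly_pi (S n) - \sum_(j < n) poly_pi (r' j).
    by rewrite -(raddf_sum (@poly_pi R d K 1)) -!(raddfB (@poly_pi R d K 1)).
  under eq_bigr => j _ do rewrite (r'P j).1.
  case: (sP n) => _ -> _; rewrite P0E BE -addrA -opprD subrK.
  exact: subKr.
have P'mass n : (poly_mass (P' n) <= (C + M + 1)%:E)%E.
  rewrite /P' EFinD; apply: le_trans (poly_massD _ _) _; rewrite poly_massN; apply: leeD;
    last first.
    exact: mass_sum.
  rewrite EFinD; apply: le_trans (poly_massD _ _) _; rewrite poly_massN; apply: leeD;
    first exact: ltW.
  by apply: le_trans (poly_mass_le _) _; case: (sP n).
have [U [UU ooU]] := ultraFilterLemma (eventually_filter : ProperFilter \oo).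
have s0 n v : bd_at v (s n) = 0 by case: (sP n).
have sM n : (sum_mass (s n) <= M%:E)%E by case: (sP n).
have /choice[A AP] : forall j, exists A : set nat, U A /\ forall m n, A m -> A n ->
    (poly_flat (S m - S n)%R < (eps j)%:E)%E.
  move=> j; have [A UA hA] := cycles_precompact K_convex K_compact Kx0 M0 s0 sM UU (eps0 j).
  by exists A.
(* From the index [j] on, the values of [g] lie in [A j], which controls [S], and are at least [j],
   which controls the tails of [V]. *)
have [g [gj gA]] := ultra_subsequence UU ooU (fun j => (AP j).1).
have Vflat J m n : (J <= m)%N -> (m <= n)%N -> (poly_flat (V n - V m)%R <= ((2^-1) ^+ J)%:E)%E.
  move=> Jm mn; apply: le_trans (poly_flat_le_mass _) _.
  apply: le_trans (mass_telescope r'eps mn) _; rewrite lee_fin.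
  apply: (@le_trans _ _ ((2^-1) ^+ m)); first by rewrite gerBl exprn_ge0.
  by rewrite ler_wiXn2l// invf_le1// ler1n.
have cv : flat_cauchy (P' \o g).
  move=> e e_gt0; have e2 : 0 < e / 2 by rewrite divr_gt0.
  have [J hJ] := half_expr_lt e2; exists J => m n Jm Jn /=.
  have -> : P' (g m) - P' (g n) = (S (g n) - S (g m)) + (V (g n) - V (g m)).
    exact: sub_sub_sub.
  apply: le_lt_trans (poly_flatD _ _) _; rewrite [e]splitr EFinD; apply: lteD.
    apply: lt_trans ((AP J).2 _ _ (gA _ _ Jn) (gA _ _ Jm)) _; rewrite lte_fin.
    apply: le_lt_trans hJ; rewrite /eps exprS ler_piMl ?exprn_ge0//.
    by rewrite invf_le1// ler1n.
  apply: (@le_lt_trans _ _ ((2^-1) ^+ J)%:E); last by rewrite lte_fin.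
  have [mn|/ltnW nm] := leqP (g m) (g n); first exact: Vflat (leq_trans Jm (gj m)) mn.
  by rewrite poly_flatB; exact: Vflat (leq_trans Jn (gj n)) nm.
exists (flat_chain_of cv).
  apply: (@le_lt_trans _ _ (C + M + 1)%:E); last exact: ltry.
  apply: le_trans (@flat_mass_le _ _ _ _ _ (flat_chain_of cv) (P' \o g) (flat_class_refl cv)) _.
  by apply: limn_einf_le_bound => n; exact: P'mass.
apply: flat_chain_eq.
(* The sequence [P \o (f \o g)] represents both the image of the lift and [T], and classes with a
   common member coincide. *)
have h1 : flat_chain_set (flat_pi (flat_chain_of cv)) (P \o (f \o g)).
  have -> : P \o (f \o g) = (fun n => poly_pi ((P' \o g) n)).
    by apply/funext => n /=; rewrite piP'.
  by apply: flat_pi_mem; exact: flat_class_refl.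
have h2 : flat_chain_set T (P \o (f \o g)).
  by apply: flat_mem_subsequence => // j; apply: leq_trans (gj j) (fge _).
by rewrite flat_reprE in h1; rewrite flat_reprE in h2; rewrite !flat_reprE;
  exact: flat_class_mem_eq h1 h2.
Qed.

End FiniteMassLift.

Unset Implicit Arguments.

Theorem theorem5p11 (R : realType) (d : nat) (K : set 'rV[R]_d)
    (K_convex : convex_set K) (K_compact : compact K)
    (K_interior : K° !=set0) :
  let finite_mass_R :=
    [set T : flat_chain K (real_group R) 1 | (flat_mass T < +oo)%E] in
  let finite_mass_S1 :=
    [set T : flat_chain K (circle_group R) 1 | (flat_mass T < +oo)%E] in
  set_fun finite_mass_R finite_mass_S1 (@flat_pi R d K 1) /\
  set_surj finite_mass_R finite_mass_S1 (@flat_pi R d K 1).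
Proof.
move=> finite_mass_R finite_mass_S1; split.
  (* The images of an approximating sequence approximate the image, and [poly_pi] does not increase
     the mass. *)
  move=> T /flat_mass_lty[P TP Plim] /=.
  apply: le_lt_trans (flat_mass_le (flat_pi_mem TP)) _.
  by apply: le_lt_trans Plim; apply: limn_einf_le => n; exact: poly_mass_pi.
have [x0 /interior_subset Kx0] := K_interior.
move=> T /(circle_flat_chain_lift K_convex K_compact Kx0)[T' T'm T'T].
by exists T'.
Qed.
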